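(* In the setting described in the context, let the Regularity Assumption (A.1)-(A.3) and the Approximation Assumption (with parameters $\theta_\varepsilon\in\mathcal{R}_\varepsilon$) hold, and let $(\mathbf{y}^*_\varepsilon,\mathbf{p}^*_\varepsilon,\theta^*_\varepsilon)$ denote an optimal triple of $(\mathcal{P}_\varepsilon)$ for all $\varepsilon>0$ small enough. Assume additionally that $\gamma_\varepsilon\|\theta_\varepsilon\|^2_{\mathcal{R}_\varepsilon}=O(\varepsilon)$. Then there is a constant $c>0$ independent of $\varepsilon$ such that $$0\le\int_{Y_0}\omega(y_0)\big[J(\mathbf{y}^*_\varepsilon(y_0),\mathcal{F}^\varepsilon_{\theta^*_\varepsilon}(\mathbf{y}^*_\varepsilon(y_0)))-V^*(0,y_0)\big]\,d\mathcal{L}(y_0)\le c\,\varepsilon,$$ and, if $\gamma_1,\gamma_2>0$, also $$\int_{Y_0}\omega(y_0)\Big(\big\|V^\varepsilon_{\theta^*_\varepsilon}(\cdot,\mathbf{y}^*_\varepsilon(y_0))-J_\bullet(\mathbf{y}^*_\varepsilon(y_0),\mathcal{F}^\varepsilon_{\theta^*_\varepsilon}(\mathbf{y}^*_\varepsilon(y_0)))\big\|^2_{L^2(I)}+\big\|\partial_yV^\varepsilon_{\theta^*_\varepsilon}(\cdot,\mathbf{y}^*_\varepsilon(y_0))-\mathbf{p}^*_\varepsilon(y_0)\big\|^2_{L^2(I;\mathbb{R}^n)}\Big)d\mathcal{L}(y_0)\le c\,\varepsilon,$$ where $V^\varepsilon_\theta(\cdot,y)$ denotes $t\mapsto V^\varepsilon_\theta(t,y(t))$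 (similarly for $\partial_yV^\varepsilon_\theta$) and $J_\bullet(y,u)$ denotes $t\mapsto J_t(y,u)$.
   Context: Setting. Let $n,m\in\mathbb{N}$, $T>0$, $I=(0,T)$, $\bar I=[0,T]$; $W_T=\{y\in L^2(I;\mathbb{R}^n):\dot y\in L^2(I;\mathbb{R}^n)\}$ with $\|y\|_{W_T}^2=\|\dot y\|_{L^2}^2+\|y\|_{L^2}^2$, and $\imath:W_T\to\mathcal{C}(\bar I;\mathbb{R}^n)$ is the continuous embedding. Let $f:\bar I\times\mathbb{R}^n\to\mathbb{R}^n$, $g:\bar I\times\mathbb{R}^n\to\mathbb{R}^{n\times m}$, with Nemytskii operators $\mathbf{f}(y)(t)=f(t,y(t))$, $(\mathbf{g}(y)u)(t)=g(t,y(t))u(t)$. Let $Q_1,Q_2\in\mathbb{R}^{n\times n}$ be symmetric positive semi-definite, $\beta>0$, $y_d\in L^2(I;\mathbb{R}^n)$, and $y_d^T\in\mathbb{R}^n$ a desired terminal state; $\mathbf{Q}_1$ denotes pointwise multiplication by $Q_1$. For $t\in\bar I$ put $$J_t(y,u)=\tfrac12\int_t^T\big(|Q_1(y(s)-y_d(s))|^2+\beta|u(s)|^2\big)\,ds+\tfrac12|Q_2(y(T)-y_d^T)|^2,\qquad J=J_0.$$ For $y_0\in\mathbb{R}^n$, problem $(P_{y_0})$ is: minimize $J(y,u)$ over $(y,u)\in W_T\times L^2(I;\mathbb{R}^m)$ subject to $\dot y=\mathbf{f}(y)+\mathbf{g}(y)u$, $y(0)=y_0$. The value function is $V^*(t_0,y_0)=\inf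 J_{t_0}(y,u)$ over $y\in H^1(t_0,T;\mathbb{R}^n)$, $u\in L^2(t_0,T;\mathbb{R}^m)$ with $\dot y=f(\cdot,y)+g(\cdot,y)u$, $y(t_0)=y_0$; so $V^*(T,y_0)=\frac12|Q_2(y_0-y_d^T)|^2$. $\partial_y,\partial_{yy}$ denote gradient and Hessian in $y$. $Y_0\subset\mathbb{R}^n$ is compact. Regularity Assumption. (A.1) $f,g$ are twice continuously differentiable, and their Jacobians and Hessians with respect to $y$ are Lipschitz continuous on compact sets, uniformly in $t$. (A.2) There is $M_{Y_0}>0$ such that, with $\widehat M=M_{Y_0}\|\imath\|$, $V^*$ is twice continuously differentiable on $\bar I\times\bar B_{2\widehat M}(0)$ with gradient and Hessian Lipschitz continuous (w.r.t. $y$, uniformly in $t$). Let $\mathcal{Y}_{ad}=\{y\in W_T:\|y\|_{W_T}\le 2M_{Y_0}\}$ and $\mathcal{F}^*(y)(t)=-\frac1\beta g(t,y(t))^\top\partial_yV^*(t,y(t))$ for $y\in\mathcal{Y}_{ad}$. (A.3) For every $y_0\in Y_0$ there is a unique $y=\mathbf{y}^*(y_0)\in W_T$ with $\dot y=\mathbf{f}(y)+\mathbf{g}(y)\mathcal{F}^*(y)$, $y(0)=y_0$, $\|y\|_{W_T}\le M_{Y_0}$, and $(\mathbf{y}^*(y_0),\mathcal{F}^*(\mathbf{y}^*(y_0)))$ is a minimizer of $(P_{y_0})$. Approximation Assumption. Let $\varepsilon_0>0$. For each $0<\varepsilon\le\varepsilon_0$, $\mathcal{R}_\varepsilon\simeq\mathbb{R}^{N_\varepsilon}$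 is a finite-dimensional parameter space with Hilbert norm $\|\cdot\|_{\mathcal{R}_\varepsilon}$, and $(\theta,t,y)\mapsto V^\varepsilon_\theta(t,y)$ belongs to $\mathcal{C}^4(\mathcal{R}_\varepsilon\times\mathbb{R}\times\mathbb{R}^n)$ with $V^\varepsilon_\theta(T,y)=\frac12|Q_2(y-y_d^T)|^2$ for all $y,\theta$. There are $\theta_\varepsilon\in\mathcal{R}_\varepsilon$ and $c>0$ independent of $\varepsilon$ with $$\max_{t\in\bar I,\,|y|\le2\widehat M}\big(|V^\varepsilon_{\theta_\varepsilon}-V^*|+|\partial_y(V^\varepsilon_{\theta_\varepsilon}-V^* )|+\|\partial_{yy}(V^\varepsilon_{\theta_\varepsilon}-V^* )\|\big)(t,y)\le c\varepsilon .$$ Put $F^\varepsilon_\theta(t,y)=-\frac1\beta g(t,y)^\top\partial_yV^\varepsilon_\theta(t,y)$ and $\mathcal{F}^\varepsilon_\theta(y)(t)=F^\varepsilon_\theta(t,y(t))$. Learning problem. $\mathcal{C}(Y_0;W_T)$ carries the norm $\|\mathbf{y}\|_{\mathcal{C}}=\max_{y_0\in Y_0}\|\mathbf{y}(y_0)\|_{W_T}$. $\mathcal{L}$ is normalized Lebesgue measure on $Y_0$; $\omega\in L^\infty(Y_0)$ with $\omega\ge c_\omega>0$ a.e.; $\gamma_1,\gamma_2\ge0$ (independent of $\varepsilon$), $\gamma_\varepsilon>0$. Put $$J_\varepsilon(y,p,\theta)=J(y,\mathcal{F}^\varepsilon_\theta(y))+\int_0^T\tfrac{\gamma_1}2|V^\varepsilon_\theta(t,y(t))-J_t(y,\mathcal{F}^\varepsilon_\theta(y))|^2+\tfrac{\gamma_2}2|\partial_yV^\varepsilon_\theta(t,y(t))-p(t)|^2\,dt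 .$$ $\mathbf{Y}_{ad}=\{\mathbf{y}\in\mathcal{C}(Y_0;W_T):\|\mathbf{y}\|_{\mathcal{C}}\le2M_{Y_0}\}$, $\mathbf{U}_{ad}=L^2(Y_0;L^2(I;\mathbb{R}^m))$. $(\mathcal{P}_\varepsilon)$ is: minimize $\mathcal{J}_\varepsilon(\mathbf{y},\mathbf{p},\theta)=\int_{Y_0}\omega(y_0)J_\varepsilon(\mathbf{y}(y_0),\mathbf{p}(y_0),\theta)\,d\mathcal{L}(y_0)+\frac{\gamma_\varepsilon}2\|\theta\|^2_{\mathcal{R}_\varepsilon}$ over $\mathbf{y}\in\mathbf{Y}_{ad}$, $\mathbf{p}\in\mathcal{C}(Y_0;W_T)$, $\theta\in\mathcal{R}_\varepsilon$ with $\mathcal{F}^\varepsilon_\theta(\mathbf{y})\in\mathbf{U}_{ad}$ (where $\mathcal{F}^\varepsilon_\theta(\mathbf{y})(y_0)=\mathcal{F}^\varepsilon_\theta(\mathbf{y}(y_0))$), such that for $\mathcal{L}$-a.e. $y_0\in Y_0$ the pair $(y,p)=(\mathbf{y}(y_0),\mathbf{p}(y_0))$ satisfies $y\in\mathcal{Y}_{ad}$ and $$\dot y=\mathbf{f}(y)+\mathbf{g}(y)\mathcal{F}^\varepsilon_\theta(y),\ y(0)=y_0,\qquad -\dot p=D\mathbf{f}(y)^\top p+[D\mathbf{g}(y)^\top\mathcal{F}^\varepsilon_\theta(y)]p+\mathbf{Q}_1^\top\mathbf{Q}_1(y-y_d),\ p(T)=Q_2^\top Q_2(y(T)-y_d^T).$$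 Here $D\mathbf{f}(y)^\top$ is pointwise multiplication by $D_yf(t,y(t))^\top$ and $([D\mathbf{g}(y)^\top u]p)_k=\sum_{i,j}\partial_{y_k}g_{ij}(t,y(t))u_j(t)p_i(t)$. *)

(* Defs.v *)
From HB Require Import structures.
From mathcomp Require Import all_boot all_order all_algebra.
From mathcomp Require Import all_classical all_reals all_analysis.
From mathcomp Require Import measurable_realfun lra.
Set Implicit Arguments.
Unset Strict Implicit.
Unset Printing Implicit Defensive.
Import Order.TTheory GRing.Theory Num.Theory.
Import numFieldNormedType.Exports.
Local Open Scope classical_set_scope.
Local Open Scope ring_scope.

(** Lebesgue measure on R^n, on the Borel sets of 'cV[R]_n: the image of the
    n-fold product of the one-dimensional Lebesgue measure. *)
Definition tuple_cons (T : Type) n (p : T * n.-tuple T) : n.+1.-tuple T :=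
  [tuple of p.1 :: p.2].

Definition col_of_tuple (R : realType) n (t : n.-tuple (measurableTypeR R)) :
  'cV[R]_n := \col_i tnth t i.

Definition borel_cV (R : realType) n := g_sigma_algebraType (@open 'cV[R]_n).

Section lebesgue_measure_construction.
Context (R : realType).
Local Notation mR := (measurableTypeR R).
Local Open Scope ereal_scope.

Lemma measurable_tuple_cons n :
  measurable_fun [set: mR * n.-tuple mR] (@tuple_cons mR n).
Proof. exact: (measurable_cons measurable_fst measurable_snd). Qed.

HB.instance Definition _ n := isMeasurableFun.Build _ _ _ _ (@tuple_cons mR n)
  (@measurable_tuple_cons n).

Section step.
Context n (mu : {sigma_finite_measure set (n.-tuple mR) -> \bar R}).

Definition lebesgue_step : set (n.+1.-tuple mR) -> \bar R :=
  pushforward ((@lebesgue_measure R) \x mu) (@tuple_cons mR n).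

Let step0 : lebesgue_step set0 = 0. Proof. exact: measure0. Qed.

Let step_ge0 A : 0 <= lebesgue_step A. Proof. exact: measure_ge0. Qed.

Let step_sigma_additive : semi_sigma_additive lebesgue_step.
Proof. exact: measure_semi_sigma_additive. Qed.

HB.instance Definition _ := isMeasure.Build _ _ _ lebesgue_step
  step0 step_ge0 step_sigma_additive.

Let step_sigma_finite : sigma_finite setT lebesgue_step.
Proof.
have /sigma_finiteP[A [AT ndA Aoo]] := sigma_finiteT (@lebesgue_measure R).
have /sigma_finiteP[B [BT ndB Boo]] := sigma_finiteT mu.
pose F k := A k `*` B k.
have FT : [set: mR * n.-tuple mR] = \bigcup_k F k.
  rewrite -setXTT AT BT; apply/seteqP; split=> [[x y] /=|[x y]].
    move=> [[k _ Akx] [l _ Bly]]; exists (maxn k l) => //; split.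
      by move: x Akx; exact/subsetPset/ndA/leq_maxl.
    by move: y Bly; exact/subsetPset/ndB/leq_maxr.
  by move=> [k _ []/= ? ?]; split; exists k.
have Ffin k : measurable (F k) /\ ((@lebesgue_measure R) \x mu) (F k) < +oo.
  have [? ?] := Aoo k; have [? ?] := Boo k; split; first exact: measurableX.
  by rewrite product_measure1E// lte_mul_pinfty// ge0_fin_numE.
pose h (t : n.+1.-tuple mR) : mR * n.-tuple mR := (thead t, [tuple of behead t]).
have hK : cancel (@tuple_cons mR n) h.
  by move=> [x t]; rewrite /h /thead tnth0; congr (_, _); exact/val_inj.
have mh : measurable_fun setT h.
  by apply: measurable_fun_pair; [exact: measurable_tnth|exact: measurable_behead].
exists (fun k => h @^-1` F k).
  apply/seteqP; split=> // t _.
  by have : [set: mR * n.-tuple mR] (h t) by []; rewrite FT => -[k _ Fk]; exists k.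
move=> k; have [mF Foo] := Ffin k; split.
  by rewrite -[X in measurable X]setTI; exact: mh.
rewrite /lebesgue_step /pushforward -comp_preimage.
rewrite (_ : h \o _ = id); first by rewrite preimage_id.
exact/funext/hK.
Qed.

HB.instance Definition _ := Measure_isSigmaFinite.Build _ _ _ lebesgue_step
  step_sigma_finite.

End step.

Let dirac_sigma_finite (t : 0.-tuple mR) : sigma_finite setT (@dirac _ _ t R).
Proof.
exists (fun=> setT); first by rewrite bigcup_const.
by move=> _; split=> //; rewrite diracT ltry.
Qed.

Fixpoint lebesgue_tuple n : {sigma_finite_measure set (n.-tuple mR) -> \bar R} :=
  match n with
  | 0 => @dirac _ _ ([tuple] : 0.-tuple mR) R
  | k.+1 => lebesgue_step (lebesgue_tuple k)
  end.

Lemma measurable_col_of_tuple n :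
  measurable_fun [set: n.-tuple mR] (@col_of_tuple R n : _ -> borel_cV R n).
Proof.
apply: (@measurability _ _ _ (borel_cV R n) _ _ (@open 'cV[R]_n)) => //.
move=> _ [U oU <-]; rewrite setTI.
pose box (q : 'cV[rat]_n * rat) : set 'cV[R]_n :=
  [set v | forall i, `|v i ord0 - ratr (q.1 i ord0)| < ratr q.2]%R.
pose F (q : 'cV[rat]_n * rat) : set (n.-tuple mR) :=
  if `[< box q `<=` U >] then @col_of_tuple R n @^-1` box q else set0.
rewrite (_ : _ @^-1` U = \bigcup_q F q); last first.
  apply/seteqP; split=> [t Ut|t [q _]]; last first.
    by rewrite /F; case: asboolP => // + bt; exact.
  have /nbhs_ballP[e /= e0 eU] := open_nbhs_nbhs (conj oU Ut).
  have [r] : exists r : rat, ratr r \in `]0%R, (e / 2)%R[.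
    by apply: rat_in_itvoo; rewrite divr_gt0.
  rewrite in_itv /= => /andP[r0 re].
  have /choice[q qP] : forall i, exists qi : rat,
      (`|(col_of_tuple t : 'cV[R]_n) i ord0 - ratr qi| < ratr r :> R)%R.
    move=> i; set x := (_ i ord0).
    have [qi] : exists qi : rat, ratr qi \in `](x - ratr r)%R, (x + ratr r)%R[.
      by apply: rat_in_itvoo; rewrite ltrD2l gtrN.
    by rewrite in_itv /= => /andP[? ?]; exists qi; rewrite ltr_norml; lra.
  exists (\col_i q i, r) => //; rewrite /F asboolT.
    by move=> i /=; rewrite [X in ratr X]mxE; exact: qP.
  move=> v bv; apply: eU; split=> // i j; rewrite ord1.
  have := qP i; have := bv i; rewrite /ball/= [X in ratr X]mxE.
  by rewrite !ltr_norml; lra.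
apply: countable_bigcupT_measurable; first exact: countableP.
move=> q; rewrite /F; case: asboolP => // _.
rewrite (_ : _ @^-1` _ =
    \bigcap_(i in [set: 'I_n]) ((fun t : n.-tuple mR => tnth t i) @^-1`
      ball (ratr (q.1 i ord0) : R) (ratr q.2)))%R; last first.
  apply/seteqP; split=> t /= bt i; first by move=> _; have := bt i; rewrite mxE distrC.
  by have := bt i Logic.I; rewrite mxE /= /ball/= distrC.
apply: fin_bigcap_measurable; first exact: finite_finset.
move=> i _; rewrite -[X in measurable X]setTI.
by apply: measurable_tnth => //; exact: measurable_ball.
Qed.
HB.instance Definition _ n := isMeasurableFun.Build _ _ _ _
  (@col_of_tuple R n : _ -> borel_cV R n) (@measurable_col_of_tuple n).

Definition lebesgue_cV n : set (borel_cV R n) -> \bar R :=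
  pushforward (lebesgue_tuple n) (@col_of_tuple R n : _ -> borel_cV R n).

Section lebesgue_cV_measure.
Variable n : nat.

Let lebesgue_cV0 : @lebesgue_cV n set0 = 0. Proof. exact: measure0. Qed.

Let lebesgue_cV_ge0 A : 0 <= @lebesgue_cV n A. Proof. exact: measure_ge0. Qed.

Let lebesgue_cV_sigma_additive : semi_sigma_additive (@lebesgue_cV n).
Proof. exact: measure_semi_sigma_additive. Qed.

HB.instance Definition _ := isMeasure.Build _ _ _ (@lebesgue_cV n)
  lebesgue_cV0 lebesgue_cV_ge0 lebesgue_cV_sigma_additive.

End lebesgue_cV_measure.

Lemma invr_lebesgue_cV_ge0 n (Y0 : set (borel_cV R n)) :
  (0 <= (fine (lebesgue_cV Y0))^-1)%R.
Proof. by rewrite invr_ge0 fine_ge0. Qed.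

(* Normalized so that Y0 has mass 1; only integrated over Y0. *)
Definition normalized_lebesgue n (Y0 : set (borel_cV R n)) :
  {measure set (borel_cV R n) -> \bar R} :=
  mscale (NngNum (invr_lebesgue_cV_ge0 Y0)) (@lebesgue_cV n).

End lebesgue_measure_construction.

Section spaces.
Context (R : realType).
Local Notation mu := (@lebesgue_measure R).

(* The library norm of a matrix is the maximum norm; this is the Euclidean
   (Frobenius) norm. *)
Definition enorm p q (A : 'M[R]_(p, q)) : R :=
  Num.sqrt (\sum_i \sum_j A i j ^+ 2).

Definition eball p (r : R) : set 'cV[R]_p := [set y | enorm y <= r].

Definition L2 p (a b : R) (v : R -> 'cV[R]_p) : Prop :=
  (forall i, measurable_fun (`]a, b[ : set (measurableTypeR R))
                            (fun t => v t i ord0)) /\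
  (\int[mu]_(t in `]a, b[) (enorm (v t) ^+ 2)%:E < +oo)%E.

Definition L2norm p (a b : R) (v : R -> 'cV[R]_p) : R :=
  Num.sqrt (\int[mu]_(t in `]a, b[) enorm (v t) ^+ 2).

(* An element of H^1(a, b; R^p) is represented by its continuous version on
   [a, b], which is the primitive of its weak derivative v. In particular y is
   square integrable, and for a = b every y qualifies. *)
Definition is_weak_deriv p (a b : R) (y v : R -> 'cV[R]_p) : Prop :=
  L2 a b v /\
  forall t, t \in `[a, b] ->
    y t = y a + \col_i \int[mu]_(s in `]a, t[) v s i ord0.

Definition H1 p (a b : R) (y : R -> 'cV[R]_p) : Prop :=
  exists v, is_weak_deriv a b y v.

(* Unique up to a null set. *)
Definition dot p (a b : R) (y : R -> 'cV[R]_p) : R -> 'cV[R]_p :=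
  get [set v | is_weak_deriv a b y v].

Definition H1norm p (a b : R) (y : R -> 'cV[R]_p) : R :=
  Num.sqrt (L2norm a b (dot a b y) ^+ 2 + L2norm a b y ^+ 2).

(* Operator norm of the embedding of H^1(0, T; R^p) into C([0, T]; R^p). *)
Definition embedding_norm p (T : R) : R :=
  sup [set sup [set enorm (y t) | t in `[0, T]] |
       y in [set y : R -> 'cV[R]_p | H1 0 T y /\ H1norm 0 T y <= 1]].

End spaces.

(** Differentiability relative to a set. All derivatives are the library's
    Fréchet derivatives, taken along [within K (nbhs x)]; they are unique when
    K is convex with nonempty interior, the only case considered. At boundary
    points they are the one-sided derivatives, hence the continuous extensions
    of the interior ones. *)
Section derivatives.
Context (R : realType).

Fixpoint Ck_on (V W : normedModType R) (k : nat) (K : set V) (h : V -> W) :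
    Prop :=
  match k with
  | 0 => {within K, continuous h}
  | k'.+1 => [/\ {within K, continuous h},
               forall x, K x -> differentiable h (within K (nbhs x)) &
               forall v, Ck_on k' K (fun x => 'd h (within K (nbhs x)) v)]
  end.

Section partial.
Context (n : nat) (W : normedModType R).
Implicit Types (K C : set 'cV[R]_n).

Definition partial K (h : 'cV[R]_n -> W) (y : 'cV[R]_n) (k : 'I_n) : W :=
  'd h (within K (nbhs y)) (delta_mx k ord0).

Definition partial2 K (h : 'cV[R]_n -> W) (y : 'cV[R]_n) (k l : 'I_n) : W :=
  partial K (fun z => partial K h z k) y l.

(* First and second y-derivatives are Lipschitz in y on C, uniformly in t. *)
Definition lipschitz_derivs (T : R) K C (h : R -> 'cV[R]_n -> W) : Prop :=
  exists L : R, forall t, t \in `[0, T] -> forall y z, C y -> C z ->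
    forall k l,
    `|partial K (h t) y k - partial K (h t) z k| <= L * enorm (y - z) /\
    `|partial2 K (h t) y k l - partial2 K (h t) z k l| <= L * enorm (y - z).

End partial.

Definition grad n (K : set 'cV[R]_n) (h : 'cV[R]_n -> R) y : 'cV[R]_n :=
  \col_k partial K h y k.

Definition hess n (K : set 'cV[R]_n) (h : 'cV[R]_n -> R) y : 'M[R]_n :=
  \matrix_(k, l) partial2 K h y k l.

Definition Jac n p (h : 'cV[R]_n -> 'cV[R]_p) y : 'M[R]_(p, n) :=
  \matrix_(i, k) partial setT h y k i ord0.

End derivatives.

Record ocp (R : realType) (n m : nat) := Ocp {
  horizon : R;
  dyn : R -> 'cV[R]_n -> 'cV[R]_n;
  ctl : R -> 'cV[R]_n -> 'M[R]_(n, m);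
  Q1 : 'M[R]_n;
  Q2 : 'M[R]_n;
  beta : R;
  yd : R -> 'cV[R]_n;
  ydT : 'cV[R]_n }.

Section control.
Context (R : realType) (n m : nat) (P : ocp R n m).
Local Notation mu := (@lebesgue_measure R).
Local Notation T := (horizon P).
Local Notation state := (R -> 'cV[R]_n).
Local Notation control := (R -> 'cV[R]_m).

Definition psd (Q : 'M[R]_n) : Prop :=
  Q^T = Q /\ forall x : 'cV[R]_n, 0 <= (x^T *m Q *m x) ord0 ord0.

Definition standing : Prop :=
  [/\ 0 < T, psd (Q1 P), psd (Q2 P), 0 < beta P & L2 0 T (yd P)].

Definition terminal_cost (x : 'cV[R]_n) : R :=
  1 / 2 * enorm (Q2 P *m (x - ydT P)) ^+ 2.

Definition cost (t : R) (y : state) (u : control) : R :=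
  1 / 2 * (\int[mu]_(s in `]t, T[)
     (enorm (Q1 P *m (y s - yd P s)) ^+ 2 + beta P * enorm (u s) ^+ 2))
  + terminal_cost (y T).

Definition state_eq (t0 : R) (y : state) (u : control) : Prop :=
  {ae mu, forall t, t \in `]t0, T[ ->
    dot t0 T y t = dyn P t (y t) + ctl P t (y t) *m u t}.

Definition admissible (t0 : R) (y0 : 'cV[R]_n) (y : state) (u : control) : Prop :=
  [/\ H1 t0 T y, L2 t0 T u, state_eq t0 y u & y t0 = y0].

(* +oo when there is no admissible pair. *)
Definition value (t0 : R) (y0 : 'cV[R]_n) : \bar R :=
  ereal_inf [set c | exists y u,
    admissible t0 y0 y u /\ c = (cost t0 y u)%:E].

Definition minimizer (y0 : 'cV[R]_n) (y : state) (u : control) : Prop :=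
  admissible 0 y0 y u /\
  forall y' u', admissible 0 y0 y' u' -> cost 0 y u <= cost 0 y' u'.

Definition feedback (dV : R -> 'cV[R]_n -> 'cV[R]_n) (y : state) : control :=
  fun t => - (beta P)^-1 *: ((ctl P t (y t))^T *m dV t (y t)).

Definition rvalue (t : R) (y : 'cV[R]_n) : R := fine (value t y).

Section regularity.
Variables (Y0 : set 'cV[R]_n) (M : R).

Definition Mhat : R := M * @embedding_norm R n T.

Definition value_ball : set 'cV[R]_n := eball (2 * Mhat).

Definition optimal_feedback : state -> control :=
  feedback (fun t => grad value_ball (rvalue t)).

Definition regularity1 : Prop :=
  [/\ Ck_on 2 (`[0, T] `*` setT) (fun x : R * 'cV[R]_n => dyn P x.1 x.2),
      Ck_on 2 (`[0, T] `*` setT) (fun x : R * 'cV[R]_n => ctl P x.1 x.2) &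
      forall C : set 'cV[R]_n, compact C ->
        lipschitz_derivs T setT C (dyn P) /\
        lipschitz_derivs T setT C (ctl P)].

Definition regularity2 : Prop :=
  [/\ forall t (y : 'cV[R]_n), t \in `[0, T] -> value_ball y -> value t y \is a fin_num,
      Ck_on 2 (`[0, T] `*` value_ball)
        (fun x : R * 'cV[R]_n => rvalue x.1 x.2) &
      lipschitz_derivs T value_ball value_ball rvalue].

Definition optimal_closed_loop (y0 : 'cV[R]_n) (y : state) : Prop :=
  [/\ H1 0 T y, state_eq 0 y (optimal_feedback y), y 0 = y0 &
      H1norm 0 T y <= M].

(* Uniqueness in H^1 is uniqueness of the continuous version on [0, T]. *)
Definition regularity3 : Prop :=
  forall y0, Y0 y0 -> exists y,
    [/\ optimal_closed_loop y0 y,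
        forall y', optimal_closed_loop y0 y' ->
          forall t, t \in `[0, T] -> y' t = y t &
        minimizer y0 y (optimal_feedback y)].

Definition regularity_assumption : Prop :=
  [/\ 0 < M, regularity1, regularity2 & regularity3].

End regularity.

Definition state_adm (M : R) (y : state) : Prop := H1 0 T y /\ H1norm 0 T y <= 2 * M.

Definition ctl_adjoint (y : state) (u : control) (p : state) : state := fun t =>
  \col_k \sum_i \sum_j
    partial setT (ctl P t) (y t) k i j * u t j ord0 * p t i ord0.

Definition adjoint_eq (y : state) (u : control) (p : state) : Prop :=
  {ae mu, forall t, t \in `]0, T[ ->
    - dot 0 T p t = (Jac (dyn P t) (y t))^T *m p t + ctl_adjoint y u p t
                    + (Q1 P)^T *m Q1 P *m (y t - yd P t)} /\
  p T = (Q2 P)^T *m Q2 P *m (y T - ydT P).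

End control.

Section approximation.
Context (R : realType).

Definition inner_product N (ip : 'cV[R]_N -> 'cV[R]_N -> R) : Prop :=
  [/\ forall x y, ip x y = ip y x,
      forall a x y z, ip (a *: x + y) z = a * ip x z + ip y z &
      forall x, x != 0 -> 0 < ip x x].

Definition ipnorm N (ip : 'cV[R]_N -> 'cV[R]_N -> R) x : R :=
  Num.sqrt (ip x x).

Definition approximation_assumption n m (P : ocp R n m) (M eps0 : R) (N : R -> nat)
    (ip : forall e, 'cV[R]_(N e) -> 'cV[R]_(N e) -> R)
    (V : forall e, 'cV[R]_(N e) -> R -> 'cV[R]_n -> R)
    (theta : forall e, 'cV[R]_(N e)) : Prop :=
  (forall e, 0 < e <= eps0 ->
    [/\ inner_product (@ip e),
        Ck_on 4 setT (fun x : 'cV[R]_(N e) * R * 'cV[R]_n =>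
                        V e x.1.1 x.1.2 x.2) &
        forall th y, V e th (horizon P) y = terminal_cost P y]) /\
  exists c, 0 < c /\ forall e, 0 < e <= eps0 ->
    forall t y, t \in `[0, horizon P] -> value_ball P M y ->
    let D := fun z => V e (theta e) t z - rvalue P t z in
    `|D y| + enorm (grad (value_ball P M) D y)
           + enorm (hess (value_ball P M) D y) <= c * e.

End approximation.

(* Throughout, v stands for the function V_theta. *)
Section learning.
Context (R : realType) (n m : nat) (P : ocp R n m).
Variables (M : R) (Y0 : set 'cV[R]_n) (w : 'cV[R]_n -> R) (gam1 gam2 : R).
Local Notation mu := (@lebesgue_measure R).
Local Notation T := (horizon P).
Local Notation nu := (normalized_lebesgue (Y0 : set (borel_cV R n))).
Implicit Types (Y p : 'cV[R]_n -> R -> 'cV[R]_n) (v : R -> 'cV[R]_n -> R).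

Definition weight : Prop :=
  measurable_fun (Y0 : set (borel_cV R n)) (w : borel_cV R n -> R) /\
  exists C, {ae nu, forall y0, Y0 y0 -> `|w y0| <= C}.

(* C(Y0; W_T), with W_T = H^1(0, T; R^n) *)
Definition CH1 Y : Prop :=
  forall y0, Y0 y0 -> H1 0 T (Y y0) /\
    H1norm 0 T (fun t => Y z t - Y y0 t) @[z --> within Y0 (nbhs y0)] --> (0 : R).

Definition CH1norm Y : R := sup [set H1norm 0 T (Y y0) | y0 in Y0].

(* The Bochner space L^2(Y0; L^2(0, T; R^p)). As L^2(0, T; R^p) is separable,
   strong measurability means that preimages of balls are measurable. *)
Definition L2L2 q (U : 'cV[R]_n -> R -> 'cV[R]_q) : Prop :=
  [/\ forall y0, Y0 y0 -> L2 0 T (U y0),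
      forall u, L2 0 T u -> measurable_fun (Y0 : set (borel_cV R n))
        ((fun y0 => L2norm 0 T (fun t => U y0 t - u t)) : borel_cV R n -> R) &
      (\int[nu]_(y0 in (Y0 : set (borel_cV R n)))
         (L2norm 0 T (U y0) ^+ 2)%:E < +oo)%E].

Definition net_feedback v : (R -> 'cV[R]_n) -> R -> 'cV[R]_m :=
  feedback P (fun t => grad setT (v t)).

Definition value_error v (y : R -> 'cV[R]_n) : R :=
  \int[mu]_(t in `]0, T[) `|v t (y t) - cost P t y (net_feedback v y)| ^+ 2.

Definition grad_error v (y p : R -> 'cV[R]_n) : R :=
  \int[mu]_(t in `]0, T[) enorm (grad setT (v t) (y t) - p t) ^+ 2.

Definition sample_cost v (y p : R -> 'cV[R]_n) : R :=
  cost P 0 y (net_feedback v y) +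
  \int[mu]_(t in `]0, T[)
    (gam1 / 2 * `|v t (y t) - cost P t y (net_feedback v y)| ^+ 2
     + gam2 / 2 * enorm (grad setT (v t) (y t) - p t) ^+ 2).

Definition mean (h : 'cV[R]_n -> R) : R :=
  \int[nu]_(y0 in (Y0 : set (borel_cV R n))) (w y0 * h y0).

Definition feasible v Y p : Prop :=
  [/\ CH1 Y, CH1norm Y <= 2 * M, CH1 p, L2L2 (fun y0 => net_feedback v (Y y0)) &
      {ae nu, forall y0 : 'cV[R]_n, Y0 y0 ->
        [/\ state_adm P M (Y y0),
            state_eq P 0 (Y y0) (net_feedback v (Y y0)),
            Y y0 0 = y0 &
            adjoint_eq P (Y y0) (net_feedback v (Y y0)) (p y0)]}].

Section optimal.
Context (N : nat) (ip : 'cV[R]_N -> 'cV[R]_N -> R).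
Variables (V : 'cV[R]_N -> R -> 'cV[R]_n -> R) (game : R).

Definition learning_cost Y p (th : 'cV[R]_N) : R :=
  mean (fun y0 => sample_cost (V th) (Y y0) (p y0))
  + game / 2 * ipnorm ip th ^+ 2.

Definition optimal_triple Y p (th : 'cV[R]_N) : Prop :=
  feasible (V th) Y p /\
  forall Y' p' th', feasible (V th') Y' p' ->
    learning_cost Y p th <= learning_cost Y' p' th'.

End optimal.
End learning.

(* Main.v *)
Require Import Defs.
From HB Require Import structures.
From mathcomp Require Import all_boot all_order all_algebra.
From mathcomp Require Import all_classical all_reals all_analysis.
From mathcomp Require Import measurable_realfun lra ring.

(** The optimal triple is compared with the candidate made of [theta e], the closed
    loop [y] driven by the feedback of [V (theta e)], and its adjoint state. The
    gradients of [V (theta e)] and of the value function differ by O(e) on the ball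
    of radius [2 * Mhat], so Picard iteration for the radially truncated field and
    Gronwall put [y] within O(e) of the optimal trajectory [x]; for small [e] the
    truncation is inactive and [y] is admissible. The cost of [y] is then O(e)-close
    to the optimal one, and along [x] the value function equals the cost to go.
    Along [x] its gradient equals the optimal adjoint state: keeping the optimal
    control fixed, the cost to go from nearby states lies above the value function
    and touches it on [x], and its linear part is computed by integration by parts
    (no Hamilton-Jacobi equation is needed). Hence both error terms of the candidate
    are O(e^2), and minimality of the triple bounds the sum of its nonnegative
    excess cost and error terms by O(e).

    Integrals are only meaningful for integrable integrands, so the candidate and
    the functionals are also shown to depend continuously on the initial state. *)

(** Every constant in the final bounds must be independent of [e], and this decides how the
    estimates are arranged. A trajectory of the network loop is compared with the optimal one by
    changing first the gradient at the same point, from network to value function, and only then the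
    point, in the gradient of the value function. Thus only bounds and Lipschitz constants of the
    value function and of the data enter the O(e) estimates. The network's own constants, for which
    no bound uniform in [e] is derived, serve at fixed [e] only: for existence of the loop and for
    continuity in the initial state.

    The radii leave room twice. Optimal trajectories stay in the ball of radius [Mhat] and network
    loops in radius [3 / 2 * Mhat], both strictly inside the ball of radius [2 * Mhat] of the
    assumptions, so derivatives relative to that closed ball become ordinary ones and the truncation
    can be removed. Likewise an H1 distance of at most [M] from the optimal trajectory gives the
    norm bound [2 * M].

    Trajectories and controls are bounded in the sup norm throughout; [yd] is only square integrable
    and is always kept under an integral. *)

Set Implicit Arguments.
Unset Strict Implicit.
Unset Printing Implicit Defensive.
Import Order.TTheory GRing.Theory Num.Theory.
Import numFieldNormedType.Exports.
Local Open Scope classical_set_scope.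
Local Open Scope ring_scope.

(** * Integrals over intervals *)

Section interval_integrals.
Context {R : realType}.
Local Notation mu := (@lebesgue_measure R).
Implicit Types (a b c t : R) (f g : R -> R).

Definition intg a b f : Prop := mu.-integrable `]a, b[ (EFin \o f).

Lemma intg_measurable a b f : intg a b f ->
  measurable_fun (`]a, b[ : set (measurableTypeR R)) f.
Proof. by move=> /measurable_int /measurable_EFinP. Qed.

Lemma intgS a b c d f : a <= c -> d <= b -> intg a b f -> intg c d f.
Proof.
move=> ac db; apply: integrableS => //.
by apply: subset_itv; rewrite bnd_simp.
Qed.

Lemma eq_intg a b f g : {in `]a, b[, f =1 g} -> intg a b f -> intg a b g.
Proof.
move=> fg; apply: eq_integrable => // x /set_mem /= xab.
by rewrite /= fg.
Qed.

Lemma intgD a b f g : intg a b f -> intg a b g -> intg a b (fun x => f x + g x).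
Proof. exact: integrableD. Qed.

Lemma intgZ a b k f : intg a b f -> intg a b (fun x => k * f x).
Proof. exact: (@integrableZl _ _ _ _ _ _ k). Qed.

Lemma intgN a b f : intg a b f -> intg a b (fun x => - f x).
Proof. exact: integrableN. Qed.

Lemma intgB a b f g : intg a b f -> intg a b g -> intg a b (fun x => f x - g x).
Proof. exact: integrableB. Qed.

Lemma intg_sum a b (I : finType) (h : I -> R -> R) :
  (forall i, intg a b (h i)) -> intg a b (fun x => \sum_i h i x).
Proof.
move=> hi; have := @integrable_sum _ _ _ mu `]a, b[ (measurable_itv _) I
  (index_enum I) xpredT (fun i => EFin \o h i) (fun i _ => hi i).
apply: eq_integrable => // x _ /=.
by rewrite sumEFin.
Qed.

Lemma intg_dom a b f g :
  measurable_fun (`]a, b[ : set (measurableTypeR R)) f ->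
  {in `]a, b[, forall x, `|f x| <= g x} -> intg a b g -> intg a b f.
Proof.
move=> mf fg; apply: le_integrable => //; first exact/measurable_EFinP.
move=> x xab /=; rewrite lee_fin (le_trans (fg _ xab))//.
by rewrite ler_norm.
Qed.

Lemma intg_norm a b f : intg a b f -> intg a b (fun x => `|f x|).
Proof. exact: integrable_norm. Qed.

Lemma mu_itvoo_fine a b : a <= b -> fine (mu `]a, b[) = b - a.
Proof.
move=> ab; rewrite lebesgue_measure_itv /= lte_fin.
by case: ltP => [_|ba] //=; apply/eqP; rewrite eq_sym subr_eq0 eq_le ab ba.
Qed.

Lemma mu_itvoo_lty a b : (mu `]a, b[ < +oo)%E.
Proof. by rewrite lebesgue_measure_itv /= lte_fin; case: ifP => // _; rewrite -EFinB ltry. Qed.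

Lemma intg_cst a b k : intg a b (cst k).
Proof.
apply: measurable_bounded_integrable => //; first exact: mu_itvoo_lty.
by exists `|k|; split; [exact: num_real|move=> M kM x _; exact: ltW].
Qed.

Lemma intg_bounded a b f C :
  measurable_fun (`]a, b[ : set (measurableTypeR R)) f ->
  {in `]a, b[, forall x, `|f x| <= C} -> intg a b f.
Proof. by move=> mf fC; apply: (intg_dom mf fC); exact: intg_cst. Qed.

Lemma within_measurable a b f : {within `[a, b], continuous f} ->
  measurable_fun (`]a, b[ : set (measurableTypeR R)) f.
Proof.
move=> cf; apply: subspace_continuous_measurable_fun => //.
apply: continuous_subspaceW cf; exact: subset_itv_oo_cc.
Qed.

Lemma within_bounded a b f : {within `[a, b], continuous f} ->
  exists C, {in `[a, b], forall x, `|f x| <= C}.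
Proof.
move=> cf; have := @segment_compact _ a b.
move=> /(continuous_compact cf) /compact_bounded [M [Mr H]].
exists (`|M| + 1) => x xab; apply: (H (`|M| + 1)); last by exists x.
by rewrite (le_lt_trans (ler_norm M))// ltrDl.
Qed.

Lemma within_intg a b f : {within `[a, b], continuous f} -> intg a b f.
Proof.
move=> cf; have [C fC] := within_bounded cf.
apply: (@intg_bounded _ _ _ C); first exact: within_measurable.
by move=> x /subset_itv_oo_cc; exact: fC.
Qed.

Lemma IntD a b f g : intg a b f -> intg a b g ->
  \int[mu]_(x in `]a, b[) (f x + g x) =
  \int[mu]_(x in `]a, b[) f x + \int[mu]_(x in `]a, b[) g x.
Proof. exact: RintegralD. Qed.

Lemma IntB a b f g : intg a b f -> intg a b g ->
  \int[mu]_(x in `]a, b[) (f x - g x) =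
  \int[mu]_(x in `]a, b[) f x - \int[mu]_(x in `]a, b[) g x.
Proof. exact: RintegralB. Qed.

Lemma IntZ a b k f : intg a b f ->
  \int[mu]_(x in `]a, b[) (k * f x) = k * \int[mu]_(x in `]a, b[) f x.
Proof. exact: RintegralZl. Qed.

Lemma IntN a b f : intg a b f ->
  \int[mu]_(x in `]a, b[) (- f x) = - \int[mu]_(x in `]a, b[) f x.
Proof.
move=> fi; rewrite -mulN1r -IntZ//.
by apply: eq_Rintegral => x _; rewrite mulN1r.
Qed.

Lemma Int_sum a b (I : finType) (h : I -> R -> R) :
  (forall i, intg a b (h i)) ->
  \int[mu]_(x in `]a, b[) (\sum_i h i x) = \sum_i \int[mu]_(x in `]a, b[) h i x.
Proof.
move=> hi; rewrite /Rintegral.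
have := @integral_sum _ _ _ mu `]a, b[ (measurable_itv _) I
  (fun i => EFin \o h i) hi (index_enum I) xpredT.
under eq_integral do rewrite sumEFin.
move=> ->; rewrite -sum_fine// => i _.
by apply: integrable_fin_num => //; exact: hi.
Qed.

Lemma Int_cst a b k : a <= b -> \int[mu]_(x in `]a, b[) k = k * (b - a).
Proof. by move=> ab; rewrite Rintegral_cst// mu_itvoo_fine. Qed.

Lemma eq_Int a b f g : {in `]a, b[, f =1 g} ->
  \int[mu]_(x in `]a, b[) f x = \int[mu]_(x in `]a, b[) g x.
Proof. by move=> fg; apply: eq_Rintegral => x /set_mem /= xab; exact: fg. Qed.

Lemma le_Int a b f g : intg a b f -> intg a b g ->
  {in `]a, b[, forall x, f x <= g x} ->
  \int[mu]_(x in `]a, b[) f x <= \int[mu]_(x in `]a, b[) g x.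
Proof. by move=> fi gi fg; apply: le_Rintegral => // x xab; exact: fg. Qed.

Lemma Int_ge0 a b f : {in `]a, b[, forall x, 0 <= f x} ->
  0 <= \int[mu]_(x in `]a, b[) f x.
Proof. by move=> f0; apply: Rintegral_ge0 => x xab; exact: f0. Qed.

Lemma norm_Int_le a b f g : intg a b f -> intg a b g ->
  {in `]a, b[, forall x, `|f x| <= g x} ->
  `|\int[mu]_(x in `]a, b[) f x| <= \int[mu]_(x in `]a, b[) g x.
Proof.
move=> fi gi fg; apply: (le_trans (le_normr_Rintegral _ fi)) => //.
by apply: le_Int => //; exact: intg_norm.
Qed.

Lemma Int_empty a b f : b <= a -> \int[mu]_(x in `]a, b[) f x = 0.
Proof. by move=> ba; rewrite set_itv_ge ?Rintegral_set0// bnd_simp -leNgt. Qed.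

Lemma Int_chasles a b c f : a <= c <= b -> intg a b f ->
  \int[mu]_(x in `]a, b[) f x =
  \int[mu]_(x in `]a, c[) f x + \int[mu]_(x in `]c, b[) f x.
Proof.
move=> /andP[]; rewrite le_eqVlt => /predU1P[->|ac].
  by rewrite (@Int_empty c c)// add0r.
rewrite le_eqVlt => /predU1P[->|cb].
  by rewrite (@Int_empty b b)// addr0.
move=> fi.
have ic : intg a c f by apply: intgS fi => //; exact: ltW.
rewrite [X in _ = X + _]Rintegral_itv_bndo_bndc//.
rewrite -(@Rintegral_itvB _ f (BRight a) (BLeft b) c) ?bnd_simp//; last exact: ltW.
by rewrite addrC subrK.
Qed.

Lemma intg_cc a b f : intg a b f -> mu.-integrable `[a, b] (EFin \o f).
Proof.
move=> /integrableP[mf fi]; apply/integrableP; split.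
  exact: emeasurable_fun_itv_cc mf.
by rewrite integral_itv_bndoo//; exact: measurableT_comp.
Qed.

Lemma Int_cc a t f : intg a t f ->
  \int[mu]_(x in `]a, t[) f x = \int[mu]_(x in `[a, t]) f x.
Proof.
move=> fi; have fc := intg_cc fi.
rewrite Rintegral_itv_bndo_bndc// Rintegral_itv_obnd_cbnd//.
apply: (integrableS _ _ _ fc) => //; exact: subset_itv_oc_cc.
Qed.

Lemma within_Int a b f : a <= b -> intg a b f ->
  {within `[a, b], continuous (fun t => \int[mu]_(x in `]a, t[) f x)}.
Proof.
move=> ab fi; have := parameterized_integral_continuous ab (intg_cc fi).
apply: subspace_eq_continuous => t /set_mem /=.
rewrite in_itv /= => /andP[at_ tb].
by rewrite /from_subspace /parameterized_integral Int_cc//; apply: intgS fi.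
Qed.

Lemma within_Int_tail a b f : a <= b -> intg a b f ->
  {within `[a, b], continuous (fun t => \int[mu]_(x in `]t, b[) f x)}.
Proof.
move=> ab fi.
have c : {within `[a, b], continuous (fun t =>
    \int[mu]_(x in `]a, b[) f x - \int[mu]_(x in `]a, t[) f x)}.
  move=> x; apply: cvgB; first exact: cvg_cst.
  exact: (within_Int ab fi).
move: c; apply: subspace_eq_continuous => t /set_mem /= /[!in_itv]/= abt.
by rewrite /from_subspace (Int_chasles abt)// addrC addKr.
Qed.

End interval_integrals.

Section almost_everywhere.
Context d (T : measurableType d) (R : realType) (mu : {measure set T -> \bar R}).
Implicit Types P Q : T -> Prop.

Lemma aeS P Q : (forall x, P x -> Q x) ->
  {ae mu, forall x, P x} -> {ae mu, forall x, Q x}.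
Proof. by move=> PQ; apply: filterS; exact: PQ. Qed.

Lemma aeI P Q : {ae mu, forall x, P x} -> {ae mu, forall x, Q x} ->
  {ae mu, forall x, P x /\ Q x}.
Proof. by move=> aP aQ; apply: filterI. Qed.

Lemma aeE P : (forall x, P x) -> {ae mu, forall x, P x}.
Proof. exact: aeW. Qed.

Lemma aeall (I : finType) (P : I -> T -> Prop) :
  (forall i, {ae mu, forall x, P i x}) -> {ae mu, forall x, forall i, P i x}.
Proof. by move=> aP; apply: filter_forall. Qed.

End almost_everywhere.

Section interval_integrals_ae.
Context {R : realType}.
Local Notation mu := (@lebesgue_measure R).
Implicit Types (a b c t : R) (f g : R -> R).

Lemma eq_Int_ae a b f g : intg a b f ->
  measurable_fun (`]a, b[ : set (measurableTypeR R)) g ->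
  {ae mu, forall t, t \in `]a, b[ -> f t = g t} ->
  \int[mu]_(x in `]a, b[) f x = \int[mu]_(x in `]a, b[) g x.
Proof.
move=> fi mg fg; rewrite /Rintegral; congr fine; apply: ae_eq_integral => //.
- exact: measurable_int fi.
- exact/measurable_EFinP.
- by apply: aeS fg => t fgt tab /=; rewrite fgt.
Qed.

Lemma le_Int_ae a b f g : intg a b f -> intg a b g ->
  {ae mu, forall t, t \in `]a, b[ -> f t <= g t} ->
  \int[mu]_(x in `]a, b[) f x <= \int[mu]_(x in `]a, b[) g x.
Proof.
move=> fi gi fg; rewrite -subr_ge0 -IntB//.
rewrite (@eq_Int_ae _ _ _ (fun x => `|g x - f x|)); last first.
- by apply: aeS fg => t fgt tab; rewrite ger0_norm// subr_ge0 fgt.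
- by apply: intg_measurable; apply: intg_norm; exact: intgB.
- exact: intgB.
- by apply: Int_ge0.
Qed.

Lemma norm_Int_ae a b f g : intg a b f -> intg a b g ->
  {ae mu, forall t, t \in `]a, b[ -> `|f t| <= g t} ->
  `|\int[mu]_(x in `]a, b[) f x| <= \int[mu]_(x in `]a, b[) g x.
Proof.
move=> fi gi fg; rewrite ler_norml -IntN//; apply/andP; split.
  apply: le_Int_ae => //; first exact: intgN.
  by apply: aeS fg => t fgt tab; have := fgt tab; rewrite ler_norml => /andP[].
apply: le_Int_ae => //.
by apply: aeS fg => t fgt tab; have := fgt tab; rewrite ler_norml => /andP[].
Qed.

(** Extended by zero outside the interval, [f] has an identically vanishing primitive on the whole
    line, and by Lebesgue differentiation the derivative of the primitive is the function itself
    almost everywhere. *)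
Lemma Int_eq0_ae a b f : intg a b f ->
  {in `[a, b], forall t, \int[mu]_(x in `]a, t[) f x = 0} ->
  {ae mu, forall t, t \in `]a, b[ -> f t = 0}.
Proof.
move=> fi f0.
have [ba|ab] := leP b a.
  by apply: aeW => t; rewrite itv_ge ?in_itv// bnd_simp -leNgt.
pose w := (f \_ `]a, b[) : R -> R.
have wi : mu.-integrable setT (EFin \o w).
  move: fi; rewrite /intg integrable_mkcond//.
  by rewrite /w restrict_EFin.
have wiS (D : set R) : measurable D -> mu.-integrable D (EFin \o w).
  by move=> mD; apply: integrableS wi.
have wl : locally_integrable setT w.
  split; first by have /measurable_int/measurable_EFinP := wi.
    exact: openT.
  move=> K _ cK; have mK : measurable K by apply: compact_measurable.
  have /integrableP[_] := wiS _ mK.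
  by under eq_integral do rewrite /=.
have := @FTC1 R w (BRight a) (fun y => wiS _ (measurable_itv _)) wl.
have -> : (fun x => \int[mu]_(t in [set` Interval (BRight a) (BRight x)]) w t)
    = cst 0.
  apply/funext => y /=.
  have [ya|ay] := leP y a.
    by rewrite set_itv_ge ?Rintegral_set0// bnd_simp -leNgt.
  rewrite -Rintegral_itv_bndo_bndc; last exact: wiS.
  have w0 s t : `]s, t[ `<=` ~` `]a, b[ ->
      \int[mu]_(x in `]s, t[) w x = 0.
    move=> H; rewrite (@eq_Int _ _ _ _ (cst 0)).
      by rewrite /Rintegral /= integral0.
    move=> x /H xab; rewrite /w patchE ifF//.
    by apply/negbTE/negP => /set_mem.
  have wf t : t <= b -> \int[mu]_(x in `]a, t[) w x = \int[mu]_(x in `]a, t[) f x.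
    move=> tb; apply: eq_Int => x xat; rewrite /w patchE ifT// inE /=.
    by move: xat; rewrite !in_itv /= => /andP[-> xt]; exact: lt_le_trans tb.
  have [yb|/ltW by_] := leP y b.
    by rewrite wf// f0// in_itv/= ltW.
  rewrite (@Int_chasles _ a y b) ?(ltW ab)//; last exact: wiS.
  rewrite wf// f0 ?in_itv/= ?lexx ?(ltW ab)// add0r w0//.
  by move=> x /=; rewrite !in_itv /= => /andP[bx _] /andP[_ xb]; lra.
apply: aeS => x H /[dup] xab; rewrite in_itv /= => /andP[ax xb].
have [_] := H ax; rewrite derive1_cst /w patchE ifT//.
by rewrite inE.
Qed.

(* Both sides are additive over intervals and differ by at most the square of
   [m], the total variation of [p] and [q] on the interval; halving [m]
   repeatedly kills the difference. *)
Lemma Int_by_parts a b (phi psi p q : R -> R) : a <= b ->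
  intg a b phi -> intg a b psi ->
  {in `[a, b], forall t, p t = p a + \int[mu]_(x in `]a, t[) phi x} ->
  {in `[a, b], forall t, q t = q a + \int[mu]_(x in `]a, t[) psi x} ->
  p b * q b - p a * q a =
  \int[mu]_(x in `]a, b[) (phi x * q x + p x * psi x).
Proof.
move=> ab iphi ipsi pE qE.
have cp (r rho : R -> R) : intg a b rho ->
    {in `[a, b], forall t, r t = r a + \int[mu]_(x in `]a, t[) rho x} ->
    {within `[a, b], continuous r}.
  move=> irho rE.
  have c : {within `[a, b], continuous (fun t => r a + \int[mu]_(x in `]a, t[) rho x)}.
    by move=> x; apply: cvgD; [exact: cvg_cst|exact: (within_Int ab irho)].
  move: c; apply: subspace_eq_continuous => t /set_mem /= tab.
  by rewrite /from_subspace [RHS]rE.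
have iM (r rho : R -> R) : intg a b rho -> {within `[a, b], continuous r} ->
    intg a b (fun x => r x * rho x).
  move=> irho /[dup] /within_bounded[C rC] cr.
  apply: (@intg_dom _ _ _ _ (fun x => C * `|rho x|)).
  - by apply: measurable_funM; [exact: within_measurable|exact: intg_measurable irho].
  - move=> x /subset_itv_oo_cc xab; rewrite normrM ler_wpM2r//; exact: rC.
  - by apply: intgZ; exact: intg_norm.
pose h x := phi x * q x + p x * psi x.
have ih : intg a b h.
  apply: intgD; last by apply: iM => //; exact: cp pE.
  apply: (@eq_intg _ _ _ (fun x => q x * phi x)); first by move=> x _; rewrite mulrC.
  by apply: iM => //; exact: cp qE.
pose m s t := \int[mu]_(x in `]s, t[) (`|phi x| + `|psi x|).
have im : intg a b (fun x => `|phi x| + `|psi x|) by apply: intgD; exact: intg_norm.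
pose E s t := p t * q t - p s * q s - \int[mu]_(x in `]s, t[) h x.
have mC s c t : a <= s -> s <= c -> c <= t -> t <= b -> m s t = m s c + m c t.
  move=> as_ sc ct tb; rewrite /m (@Int_chasles _ s t c) ?sc//.
  exact: intgS im.
have EC s c t : a <= s -> s <= c -> c <= t -> t <= b -> E s t = E s c + E c t.
  move=> as_ sc ct tb; rewrite /E (@Int_chasles _ s t c h) ?sc//; first by ring.
  exact: intgS ih.
have m0 s t : 0 <= m s t by apply: Int_ge0 => x _; rewrite addr_ge0.
have incr (r rho : R -> R) s t : intg a b rho ->
    {in `[a, b], forall t, r t = r a + \int[mu]_(x in `]a, t[) rho x} ->
    a <= s -> s <= t -> t <= b -> r t - r s = \int[mu]_(x in `]s, t[) rho x.
  move=> irho rE as_ st tb.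
  rewrite (rE t) ?in_itv/= ?(le_trans as_ st)// (rE s) ?in_itv/= ?as_ ?(le_trans st tb)//.
  rewrite (@Int_chasles _ a t s rho) ?as_//; first by ring.
  exact: intgS irho.
have base s t : a <= s -> s <= t -> t <= b -> `|E s t| <= m s t ^+ 2.
  move=> as_ st tb.
  have i1 : intg s t phi by exact: intgS iphi.
  have i2 : intg s t psi by exact: intgS ipsi.
  (* The increment of the product is split by freezing [q] at the left end and [p] at the right end.
     What remains after subtracting [h] contains only increments of [p] and [q], each at most
     [m s t]. *)
  have -> : E s t = \int[mu]_(x in `]s, t[) (q s * phi x + p t * psi x - h x).
    rewrite IntB; last exact: intgS ih.
      rewrite IntD; [|exact: intgZ|exact: intgZ].
      rewrite !IntZ// -(incr p phi)// -(incr q psi)// /E; ring.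
    by apply: intgD; exact: intgZ.
  have -> : m s t ^+ 2 = \int[mu]_(x in `]s, t[) (m s t * (`|phi x| + `|psi x|)).
    by rewrite IntZ ?expr2//; exact: intgS im.
  apply: norm_Int_le.
  - apply: intgB; last exact: intgS ih.
    by apply: intgD; exact: intgZ.
  - by apply: intgZ; exact: intgS im.
  move=> x; rewrite in_itv /= => /andP[sx xt].
  have -> : q s * phi x + p t * psi x - h x =
      - (q x - q s) * phi x + (p t - p x) * psi x by rewrite /h; ring.
  have mle s' t' : s <= s' -> t' <= t -> s' <= t' -> m s' t' <= m s t.
    move=> ss' t't s't'; rewrite (mC s s' t) ?(mC s' t' t)//; try lra.
    by have := m0 s s'; have := m0 t' t; lra.
  have bq : `|q x - q s| <= m s t.
    rewrite (incr q psi)//; [|lra|lra].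
    apply: (le_trans _ (mle s x _ _ _)); try lra.
    apply: norm_Int_le; [by apply: intgS ipsi; lra|by apply: intgS im; lra|].
    by move=> y _; rewrite lerDr.
  have bp : `|p t - p x| <= m s t.
    rewrite (incr p phi)//; [|lra|lra].
    apply: (le_trans _ (mle x t _ _ _)); try lra.
    apply: norm_Int_le; [by apply: intgS iphi; lra|by apply: intgS im; lra|].
    by move=> y _; rewrite lerDl.
  rewrite (le_trans (ler_normD _ _))// !normrM normrN mulrDr.
  by rewrite lerD// ler_wpM2r.
have halve s t : a <= s -> s <= t -> t <= b ->
    exists c, [/\ s <= c, c <= t, m s c = m s t / 2 & m c t = m s t / 2].
  move=> as_ st tb.
  have ist : intg s t (fun x => `|phi x| + `|psi x|) by exact: intgS im.
  have [|c] := @IVT R (m s) s t (m s t / 2) st (within_Int st ist).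
    have -> : m s s = 0 by rewrite /m Int_empty.
    have := m0 s t; rewrite ge_min le_max => H; apply/andP; split; apply/orP.
      by left; lra.
    by right; lra.
  rewrite in_itv /= => /andP[sc ct] mE; exists c; split => //.
  by have := mC s c t as_ sc ct tb; rewrite mE => H; lra.
have fine_ k : forall s t, a <= s -> s <= t -> t <= b ->
    `|E s t| <= 2^-1 ^+ k * m s t ^+ 2.
  elim: k => [|k IH] s t as_ st tb; first by rewrite expr0 mul1r; exact: base.
  have [c [sc ct m1 m2]] := halve s t as_ st tb.
  rewrite (EC s c t)// (le_trans (ler_normD _ _))//.
  have ca : a <= c by lra.
  have cb : c <= b by lra.
  have := IH s c as_ sc cb; have := IH c t ca ct tb.
  rewrite m1 m2 (exprS _ k) => h1 h2.
  have := lerD h2 h1; move=> /le_trans; apply.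
  by rewrite le_eqVlt; apply/orP; left; apply/eqP; field.
suff : E a b = 0 by move/eqP; rewrite /E subr_eq0 => /eqP ->.
apply/eqP; rewrite -normr_le0; apply/ler_addgt0Pr => e e0; rewrite add0r.
have /cvgrPdist_lt/(_ e e0) : (fun k => 2^-1 ^+ k * m a b ^+ 2 : R) @ \oo --> (0 : R).
  rewrite -[X in _ --> X](mul0r (m a b ^+ 2)); apply: cvgMl.
  by apply: cvg_expr; rewrite ger0_norm// invf_lt1// ltr1n.
case=> N _ /(_ N (leqnn N)) /=; rewrite sub0r normrN => H.
apply: (le_trans (fine_ N a b (lexx a) ab (lexx b))).
by apply: le_trans (ltW H); exact: ler_norm.
Qed.

Lemma Int_is_derive a b (F f : R -> R) : a <= b -> continuous f ->
  (forall x, is_derive x (1 : R) F (f x)) ->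
  \int[mu]_(x in `]a, b[) f x = F b - F a.
Proof.
rewrite le_eqVlt => /predU1P[->|ab] cf dF; first by rewrite Int_empty// subrr.
have cF : continuous F.
  by move=> x; apply/differentiable_continuous/derivable1_diffP; have [] := dF x.
rewrite Int_cc; last by apply: within_intg; exact: continuous_subspaceT.
rewrite /Rintegral (@continuous_FTC2 _ f F)//.
- exact: continuous_subspaceT.
- split.
  + by move=> x _; have [] := dF x.
  + exact/cvg_at_right_filter/cF.
  + exact/cvg_at_left_filter/cF.
- by move=> x _; rewrite derive1E; have [] := dF x.
Qed.

End interval_integrals_ae.

(** * Norms and continuity on subsets *)

Section vector_norms.
Context {R : realType}.
Implicit Types n : nat.

(** A sum over coordinates commutes with integrals, so vector estimates of Gronwall and Picard type
    reduce to scalar ones. The library norm and [enorm] are both comparable to it up to a factor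
    [n%:R]. *)
Definition l1 n (v : 'cV[R]_n) : R := \sum_i `|v i ord0|.

Definition mx1 p q (A : 'M[R]_(p, q)) : R := \sum_i \sum_j `|A i j|.

Definition dotv n (u v : 'cV[R]_n) : R := \sum_i u i ord0 * v i ord0.

Lemma l1_ge0 n (v : 'cV[R]_n) : 0 <= l1 v.
Proof. by apply: sumr_ge0. Qed.

Lemma mx1_ge0 p q (A : 'M[R]_(p, q)) : 0 <= mx1 A.
Proof. by apply: sumr_ge0 => i _; exact: sumr_ge0. Qed.

Lemma l10 n : l1 (0 : 'cV[R]_n) = 0.
Proof. by rewrite /l1 big1// => i _; rewrite mxE normr0. Qed.

Lemma l1N n (v : 'cV[R]_n) : l1 (- v) = l1 v.
Proof. by apply: eq_bigr => i _; rewrite mxE normrN. Qed.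

Lemma l1BC n (u v : 'cV[R]_n) : l1 (u - v) = l1 (v - u).
Proof. by rewrite -l1N opprB. Qed.

Lemma ler_l1D n (u v : 'cV[R]_n) : l1 (u + v) <= l1 u + l1 v.
Proof. by rewrite -big_split ler_sum// => i _; rewrite mxE ler_normD. Qed.

Lemma ler_l1B n (u v : 'cV[R]_n) : l1 (u - v) <= l1 u + l1 v.
Proof. by rewrite -(l1N v) ler_l1D. Qed.

Lemma ler_l1_sub n (u v : 'cV[R]_n) : l1 u <= l1 v + l1 (u - v).
Proof. by have := ler_l1D v (u - v); rewrite [v + _]addrC subrK. Qed.

Lemma ler_l1_distD n (v u w : 'cV[R]_n) : l1 (u - w) <= l1 (u - v) + l1 (v - w).
Proof. by have := ler_l1D (u - v) (v - w); rewrite addrA subrK. Qed.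

Lemma l1Z n k (v : 'cV[R]_n) : l1 (k *: v) = `|k| * l1 v.
Proof. by rewrite /l1 mulr_sumr; apply: eq_bigr => i _; rewrite mxE normrM. Qed.

Lemma l1_coord n (v : 'cV[R]_n) i : `|v i ord0| <= l1 v.
Proof. by rewrite /l1 (bigD1 i)//= lerDl sumr_ge0. Qed.

Lemma l1_eq0 n (v : 'cV[R]_n) : l1 v <= 0 -> v = 0.
Proof.
move=> v0; apply/matrixP => i j; rewrite ord1 mxE; apply/eqP.
by rewrite -normr_le0 (le_trans (l1_coord v i)).
Qed.

Lemma norm_mx_le p q (A : 'M[R]_(p, q)) (C : R) : 0 <= C ->
  (forall i j, `|A i j| <= C) -> `|A| <= C.
Proof.
move=> C0 AC; rewrite [`|A|]mx_normrE; apply: (big_ind (fun x => x <= C)) => // x y xC yC.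
by rewrite ge_max xC.
Qed.

Lemma norm_mx_coord p q (A : 'M[R]_(p, q)) i j : `|A i j| <= `|A|.
Proof. by rewrite [`|A|]mx_normrE; exact: (le_bigmax _ (fun ij => `|A ij.1 ij.2|) (i, j)). Qed.

Lemma norm_le_l1 n (v : 'cV[R]_n) : `|v| <= l1 v.
Proof. by apply: norm_mx_le => [|i j]; [exact: l1_ge0|rewrite ord1 l1_coord]. Qed.

Lemma l1_le_norm n (v : 'cV[R]_n) : l1 v <= n%:R * `|v|.
Proof.
rewrite mulr_natl -[n in _ *+ n]card_ord -sumr_const ler_sum// => i _.
exact: norm_mx_coord.
Qed.

Lemma l1_mulmx p q (A : 'M[R]_(p, q)) (v : 'cV[R]_q) : l1 (A *m v) <= mx1 A * l1 v.
Proof.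
rewrite /mx1 mulr_suml ler_sum// => i _; rewrite mxE (le_trans (ler_norm_sum _ _ _))//.
rewrite mulr_suml ler_sum// => j _; rewrite normrM ler_wpM2l//; exact: l1_coord.
Qed.

Lemma ler_dotv n (u v : 'cV[R]_n) : `|dotv u v| <= l1 u * l1 v.
Proof.
rewrite (le_trans (ler_norm_sum _ _ _))// /l1 mulr_suml ler_sum// => i _.
by rewrite normrM ler_wpM2l// l1_coord.
Qed.

Lemma dotvDl n (u v w : 'cV[R]_n) : dotv (u + v) w = dotv u w + dotv v w.
Proof. by rewrite -big_split; apply: eq_bigr => i _; rewrite mxE mulrDl. Qed.

Lemma dotvC n (u v : 'cV[R]_n) : dotv u v = dotv v u.
Proof. by apply: eq_bigr => i _; rewrite mulrC. Qed.

Lemma dotvDr n (u v w : 'cV[R]_n) : dotv w (u + v) = dotv w u + dotv w v.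
Proof. by rewrite dotvC dotvDl !(dotvC w). Qed.

Lemma dotvZl n k (u v : 'cV[R]_n) : dotv (k *: u) v = k * dotv u v.
Proof. by rewrite /dotv mulr_sumr; apply: eq_bigr => i _; rewrite mxE mulrA. Qed.

Lemma dotvNl n (u v : 'cV[R]_n) : dotv (- u) v = - dotv u v.
Proof. by rewrite -scaleN1r dotvZl mulN1r. Qed.

Lemma dotvNr n (u v : 'cV[R]_n) : dotv u (- v) = - dotv u v.
Proof. by rewrite dotvC dotvNl dotvC. Qed.

Lemma dotv_trmx p q (A : 'M[R]_(p, q)) (u : 'cV[R]_p) (v : 'cV[R]_q) :
  dotv (A^T *m u) v = dotv u (A *m v).
Proof.
rewrite /dotv; under eq_bigr do rewrite mxE mulr_suml.
rewrite exchange_big; apply: eq_bigr => i _ /=; rewrite mxE mulr_sumr.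
by apply: eq_bigr => j _; rewrite mxE; ring.
Qed.

Lemma enorm_ge0 p q (A : 'M[R]_(p, q)) : 0 <= enorm A.
Proof. exact: sqrtr_ge0. Qed.

Lemma sqr_enorm n (v : 'cV[R]_n) : enorm v ^+ 2 = dotv v v.
Proof.
rewrite /enorm sqr_sqrtr; last by apply: sumr_ge0 => i _; apply: sumr_ge0 => j _; rewrite sqr_ge0.
by apply: eq_bigr => i _; rewrite big_ord1 expr2.
Qed.

Lemma enorm_coord n (v : 'cV[R]_n) i : `|v i ord0| <= enorm v.
Proof.
rewrite -(@ler_pXn2r _ 2)// ?nnegrE ?enorm_ge0// sqr_enorm real_normK ?num_real//.
by rewrite /dotv (bigD1 i)//= -expr2 lerDl sumr_ge0// => j _; rewrite -expr2 sqr_ge0.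
Qed.

Lemma l1_le_enorm n (v : 'cV[R]_n) : l1 v <= n%:R * enorm v.
Proof.
rewrite mulr_natl -[n in _ *+ n]card_ord -sumr_const ler_sum// => i _.
exact: enorm_coord.
Qed.

Lemma enorm_le_l1 n (v : 'cV[R]_n) : enorm v <= l1 v.
Proof.
rewrite -(@ler_pXn2r _ 2)// ?nnegrE ?enorm_ge0 ?l1_ge0// sqr_enorm.
by rewrite (le_trans (ler_norm _))// (le_trans (ler_dotv _ _))// expr2.
Qed.

Lemma dotv_enorm n (u v : 'cV[R]_n) : dotv u v <= enorm u * enorm v.
Proof.
apply: (le_trans (ler_norm _)).
rewrite -(@ler_pXn2r _ 2)// ?nnegrE ?mulr_ge0 ?enorm_ge0// exprMn !sqr_enorm.
rewrite real_normK ?num_real// -subr_ge0.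
(* Lagrange's identity: this double sum is twice the Gram determinant of [u] and [v]. *)
have : 0 <= \sum_i \sum_j (u i ord0 * v j ord0 - u j ord0 * v i ord0) ^+ 2.
  by apply: sumr_ge0 => i _; apply: sumr_ge0 => j _; rewrite sqr_ge0.
suff -> : \sum_i \sum_j (u i ord0 * v j ord0 - u j ord0 * v i ord0) ^+ 2 =
   2 * (dotv u u * dotv v v - dotv u v ^+ 2) by rewrite pmulr_rge0.
have E (a b c d : 'cV[R]_n) : \sum_i \sum_j (a i ord0 * b i ord0) * (c j ord0 * d j ord0)
   = dotv a b * dotv c d.
  by rewrite /dotv mulr_suml; apply: eq_bigr => i _; rewrite mulr_sumr.
transitivity (dotv u u * dotv v v + dotv v v * dotv u u - 2 * (dotv u v * dotv u v)); last by ring.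
rewrite -!E mulr_sumr -big_split -sumrB; apply: eq_bigr => i _ /=.
rewrite mulr_sumr -big_split -sumrB; apply: eq_bigr => j _ /=; ring.
Qed.

Lemma ler_enormD n (u v : 'cV[R]_n) : enorm (u + v) <= enorm u + enorm v.
Proof.
rewrite -(@ler_pXn2r _ 2)// ?nnegrE ?addr_ge0 ?enorm_ge0// sqrrD !sqr_enorm.
rewrite dotvDl !dotvDr (dotvC v u); have := dotv_enorm u v; rewrite mulr2n; lra.
Qed.

Lemma enormN n (v : 'cV[R]_n) : enorm (- v) = enorm v.
Proof.
apply/eqP; rewrite -(@eqrXn2 _ 2)// ?enorm_ge0// !sqr_enorm.
by rewrite dotvNl dotvC dotvNl opprK.
Qed.

Lemma enormZ n k (v : 'cV[R]_n) : enorm (k *: v) = `|k| * enorm v.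
Proof.
apply/eqP; rewrite -(@eqrXn2 _ 2)// ?mulr_ge0 ?enorm_ge0// exprMn !sqr_enorm.
by rewrite dotvZl dotvC dotvZl mulrA -expr2 real_normK ?num_real.
Qed.

Lemma ler_enorm_sub n (u v : 'cV[R]_n) : enorm u <= enorm v + enorm (u - v).
Proof. by have := ler_enormD v (u - v); rewrite [v + _]addrC subrK. Qed.

Lemma ler_dist_enorm n (u v : 'cV[R]_n) : `|enorm u - enorm v| <= enorm (u - v).
Proof.
have := ler_enorm_sub u v; have := ler_enorm_sub v u.
by rewrite -[enorm (v - u)]enormN opprB ler_norml; lra.
Qed.

Lemma ler_sqr_enormB n (u v : 'cV[R]_n) :
  `|enorm u ^+ 2 - enorm v ^+ 2| <= (2 * enorm v + enorm (u - v)) * enorm (u - v).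
Proof.
have -> : enorm u ^+ 2 - enorm v ^+ 2 = (enorm u + enorm v) * (enorm u - enorm v) by ring.
have := ler_enorm_sub u v; have := enorm_ge0 u; have := enorm_ge0 v.
move=> v0 u0 uv; rewrite normrM ger0_norm ?addr_ge0//.
by rewrite ler_pM// ?addr_ge0// ?ler_dist_enorm//; lra.
Qed.

End vector_norms.

Section within_continuity.
Context {T : topologicalType} {R : realType}.
Implicit Types (A : set T) (f g : T -> R).

Lemma wc_cst A (k : R) : {within A, continuous (fun _ : T => k)}.
Proof. by move=> x; exact: cvg_cst. Qed.

Lemma wcD A f g : {within A, continuous f} -> {within A, continuous g} ->
  {within A, continuous (fun x => f x + g x)}.
Proof. by move=> cf cg x; apply: cvgD; [exact: cf|exact: cg]. Qed.

Lemma wcB A f g : {within A, continuous f} -> {within A, continuous g} ->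
  {within A, continuous (fun x => f x - g x)}.
Proof. by move=> cf cg x; apply: cvgB; [exact: cf|exact: cg]. Qed.

Lemma wcM A f g : {within A, continuous f} -> {within A, continuous g} ->
  {within A, continuous (fun x => f x * g x)}.
Proof. by move=> cf cg x; apply: cvgM; [exact: cf|exact: cg]. Qed.

Lemma wcZ A k f : {within A, continuous f} -> {within A, continuous (fun x => k * f x)}.
Proof. by apply: wcM; exact: wc_cst. Qed.

Lemma wc_norm A f : {within A, continuous f} -> {within A, continuous (fun x => `|f x|)}.
Proof. by move=> cf x; apply: cvg_norm; exact: cf. Qed.

Lemma wc_sum A (I : finType) (F : I -> T -> R) :
  (forall i, {within A, continuous (F i)}) ->
  {within A, continuous (fun x => \sum_i F i x)}.
Proof.
move=> cF; elim: (index_enum I) => [|i s IH].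
  by under eq_fun do rewrite big_nil; exact: wc_cst.
by under eq_fun do rewrite big_cons; apply: wcD.
Qed.

Lemma eq_wc A f g : (forall x, A x -> f x = g x) ->
  {within A, continuous f} -> {within A, continuous g}.
Proof. by move=> fg; apply: subspace_eq_continuous => x /set_mem /fg. Qed.

Lemma wc_uniform A f :
  (forall e : R, 0 < e -> exists2 g : T -> R, {within A, continuous g} &
     forall x, A x -> `|f x - g x| <= e) ->
  {within A, continuous f}.
Proof.
move=> fg; apply/subspace_continuousP => x Ax; apply/cvgrPdist_lt => e e0.
have [|g cg gE] := fg (e / 4); first by rewrite divr_gt0.
have /subspace_continuousP/(_ x Ax)/cvgrPdist_lt/(_ (e / 4) _)/= H := cg.
have {}H := H (divr_gt0 e0 (ltr0n _ 4)).
have gx := gE x Ax.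
apply: filterS2 (@withinT _ _ A _) H.
move=> z Az h; have := gE z Az.
have -> : f x - f z = (f x - g x) + (g x - g z) - (f z - g z) by ring.
move=> gz; rewrite (le_lt_trans (ler_normB _ _))//.
by have := ler_normD (f x - g x) (g x - g z); lra.
Qed.

End within_continuity.

(** * Gronwall and Picard *)

Section volterra.
Context {R : realType}.
Local Notation mu := (@lebesgue_measure R).
Implicit Types (fwd : bool) (f g : R -> R).

(** One Volterra operator for both directions of time: the state equation is integrated forward from
    its initial value, the adjoint equation backward from its terminal value. *)
Definition vint fwd (a b : R) f (t : R) : R :=
  if fwd then \int[mu]_(x in `]a, t[) f x else \int[mu]_(x in `]t, b[) f x.

Definition ctn n (a b : R) (y : R -> 'cV[R]_n) : Prop :=
  forall i, {within `[a, b], continuous (fun t => y t i ord0)}.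

Lemma within_vint fwd (a b : R) f : a <= b -> intg a b f ->
  {within `[a, b], continuous (vint fwd a b f)}.
Proof. by case: fwd => ab fi; [exact: within_Int|exact: within_Int_tail]. Qed.

Lemma le_vint fwd (a b : R) f g t : t \in `[a, b] -> intg a b f -> intg a b g ->
  {ae mu, forall s, s \in `]a, b[ -> f s <= g s} -> vint fwd a b f t <= vint fwd a b g t.
Proof.
rewrite in_itv /= => /andP[at_ tb] fi gi fg; rewrite /vint; case: ifP => _.
  apply: le_Int_ae; [exact: intgS fi|exact: intgS gi|].
  apply: aeS fg => s + /[!in_itv]/= /andP[as_ st]; apply.
  by rewrite in_itv/= as_ (lt_le_trans st).
apply: le_Int_ae; [exact: intgS fi|exact: intgS gi|].
apply: aeS fg => s + /[!in_itv]/= /andP[ts sb]; apply.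
by rewrite in_itv/= sb (le_lt_trans at_).
Qed.

Lemma norm_vint_le fwd (a b : R) f g t : t \in `[a, b] -> intg a b f -> intg a b g ->
  {ae mu, forall s, s \in `]a, b[ -> `|f s| <= g s} -> `|vint fwd a b f t| <= vint fwd a b g t.
Proof.
rewrite in_itv /= => /andP[at_ tb] fi gi fg; rewrite /vint; case: ifP => _.
  apply: norm_Int_ae; [exact: intgS fi|exact: intgS gi|].
  apply: aeS fg => s + /[!in_itv]/= /andP[as_ st]; apply.
  by rewrite in_itv/= as_ (lt_le_trans st).
apply: norm_Int_ae; [exact: intgS fi|exact: intgS gi|].
apply: aeS fg => s + /[!in_itv]/= /andP[ts sb]; apply.
by rewrite in_itv/= sb (le_lt_trans at_).
Qed.

Lemma vintZ fwd (a b : R) k f t : t \in `[a, b] -> intg a b f ->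
  vint fwd a b (fun x => k * f x) t = k * vint fwd a b f t.
Proof.
rewrite in_itv /= => /andP[at_ tb] fi; rewrite /vint; case: ifP => _; apply: IntZ; exact: intgS fi.
Qed.

Lemma vintD fwd (a b : R) f g t : t \in `[a, b] -> intg a b f -> intg a b g ->
  vint fwd a b (fun x => f x + g x) t = vint fwd a b f t + vint fwd a b g t.
Proof.
rewrite in_itv /= => /andP[at_ tb] fi gi; rewrite /vint; case: ifP => _; apply: IntD;
  by [exact: intgS fi|exact: intgS gi].
Qed.

Lemma vintB fwd (a b : R) f g t : t \in `[a, b] -> intg a b f -> intg a b g ->
  vint fwd a b (fun x => f x - g x) t = vint fwd a b f t - vint fwd a b g t.
Proof.
rewrite in_itv /= => /andP[at_ tb] fi gi; rewrite /vint; case: ifP => _; apply: IntB;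
  by [exact: intgS fi|exact: intgS gi].
Qed.

Lemma vint_sum fwd (a b : R) (I : finType) (h : I -> R -> R) t : t \in `[a, b] ->
  (forall i, intg a b (h i)) ->
  vint fwd a b (fun x => \sum_i h i x) t = \sum_i vint fwd a b (h i) t.
Proof.
rewrite in_itv /= => /andP[at_ tb] hi; rewrite /vint; case: ifP => _; apply: Int_sum => i;
  exact: intgS (hi i).
Qed.

Lemma vint_cst_le fwd (a b c : R) t : t \in `[a, b] -> 0 <= c ->
  vint fwd a b (fun=> c) t <= c * (b - a).
Proof.
rewrite in_itv /= => /andP[at_ tb] c0; rewrite /vint; case: ifP => _;
  by rewrite Int_cst// ler_wpM2l//; lra.
Qed.

Lemma vint_sub fwd (a b : R) f t : a <= b -> t \in `[a, b] -> intg a b f ->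
  (forall s, s \in `]a, b[ -> 0 <= f s) -> vint fwd a b f t <= \int[mu]_(x in `]a, b[) f x.
Proof.
move=> ab /[!in_itv]/= /andP[at_ tb] fi f0.
rewrite (@Int_chasles _ a b t) ?at_// /vint; case: ifP => _.
  rewrite lerDl; apply: Int_ge0 => s /[!in_itv]/= /andP[ts sb].
  by apply: f0; rewrite in_itv/= sb (le_lt_trans at_).
rewrite lerDr; apply: Int_ge0 => s /[!in_itv]/= /andP[as_ st].
by apply: f0; rewrite in_itv/= as_ (lt_le_trans st).
Qed.

(** Exponential weight of Bielecki. Since [L * vweight] is, up to sign, the derivative of
    [vweight / 2], the Volterra operator with constant [L] has norm at most one half in the weighted
    sup norm, whatever the length of the interval. *)
Definition vweight fwd (a b L t : R) : R :=
  expR (if fwd then 2 * L * (t - a) else 2 * L * (b - t)).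

Lemma vweight_cont fwd (a b L : R) : continuous (vweight fwd a b L).
Proof.
move=> t; rewrite /vweight; case: fwd; apply: continuous_comp; last exact: continuous_expR.
- by apply: cvgM; [exact: cvg_cst|apply: cvgB; [exact: cvg_id|exact: cvg_cst]].
- exact: continuous_expR.
- by apply: cvgM; [exact: cvg_cst|apply: cvgB; [exact: cvg_cst|exact: cvg_id]].
Qed.

Lemma vweight_ge1 fwd (a b L t : R) : 0 <= L -> t \in `[a, b] ->
  1 <= vweight fwd a b L t <= expR (2 * L * (b - a)).
Proof.
move=> L0; rewrite in_itv /= => /andP[at_ tb].
rewrite -[X in X <= vweight _ _ _ _ _]expR0 /vweight !ler_expR.
by case: fwd; apply/andP; split; rewrite ?mulr_ge0 ?ler_wpM2l ?mulr_ge0//; lra.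
Qed.

Lemma vint_vweight fwd (a b L t : R) : 0 < L -> t \in `[a, b] ->
  vint fwd a b (fun s => L * vweight fwd a b L s) t <= vweight fwd a b L t / 2.
Proof.
move=> L0; rewrite in_itv /= => /andP[at_ tb]; rewrite /vint.
have cW : continuous (fun s => L * vweight fwd a b L s).
  by move=> s; apply: cvgM; [exact: cvg_cst|exact: vweight_cont].
case: fwd cW => cW.
  have dW (s : R) : is_derive s (1 : R) (fun s => vweight true a b L s / 2)
      (L * vweight true a b L s).
    rewrite /vweight; apply: is_derive_eq; rewrite ?scaler0 ?add0r ?addr0 ?subr0.
    by rewrite /GRing.scale /=; field.
  rewrite (Int_is_derive at_ cW dW).
  by rewrite lerBlDl lerDr divr_ge0// expR_ge0.
have dW (s : R) : is_derive s (1 : R) (fun s => - (vweight false a b L s / 2))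
    (L * vweight false a b L s).
  rewrite /vweight; apply: is_derive_eq; rewrite ?scaler0 ?add0r ?addr0 ?subr0.
  by rewrite /GRing.scale /=; field.
rewrite (Int_is_derive tb cW dW).
by rewrite opprK addrC lerBlDl lerDr divr_ge0// expR_ge0.
Qed.

(** At a maximum point of [d / W], for the exponential weight [W], a positive maximum makes the
    integral term at most half of [d] there. It is absorbed on the left, which leaves [d / W] at
    most [2 * c]. *)
Lemma gronwall fwd (a b L c : R) (d : R -> R) : a <= b -> 0 <= L -> 0 <= c ->
  {within `[a, b], continuous d} ->
  {in `[a, b], forall t, d t <= c + vint fwd a b (fun s => L * d s) t} ->
  {in `[a, b], forall t, d t <= 2 * c * expR (2 * (L + 1) * (b - a))}.
Proof.
move=> ab L0 c0 cd dE.
(* The rate of the weight has to be positive, and [L] may be zero. *)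
pose L' := L + 1; have L'0 : 0 < L' by rewrite ltr_wpDl.
pose W := vweight fwd a b L'.
have W0 t : 0 < W t by exact: expR_gt0.
have cW : {within `[a, b], continuous W} by apply: continuous_subspaceT; exact: vweight_cont.
have cg : {within `[a, b], continuous (fun t => d t * (W t)^-1)}.
  apply: wcM => // t; apply: cvgV; first by rewrite gt_eqF// W0.
  exact: cW.
have [t0 t0ab tmax] := EVT_max ab cg.
pose S := d t0 * (W t0)^-1.
have dS t : t \in `[a, b] -> d t <= S * W t.
  by move=> tab; rewrite -ler_pdivrMr//; exact: tmax.
have S2 : S <= 2 * c.
  have [S0|/ltW S0] := leP S 0; first by rewrite (le_trans S0)// mulr_ge0.
  have /andP[W1 _] := vweight_ge1 fwd (ltW L'0) t0ab.
  have iW : intg a b W by exact: within_intg.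
  have h1 : vint fwd a b (fun s => L * d s) t0 <= vint fwd a b (fun s => S * (L' * W s)) t0.
    apply: le_vint => //; first by apply: intgZ; exact: within_intg.
      by do 2 apply: intgZ.
    apply: aeE => s /subset_itv_oo_cc sab.
    apply: (@le_trans _ _ (L * (S * W s))); first by rewrite ler_wpM2l// dS.
    by rewrite mulrCA ler_wpM2l// ler_wpM2r ?(ltW (W0 _))// lerDl.
  have h2 : vint fwd a b (fun s => S * (L' * W s)) t0 <= S * (W t0 / 2).
    by rewrite vintZ//; [rewrite ler_wpM2l// vint_vweight|exact: intgZ].
  have h3 := dE t0 t0ab.
  have h4 : d t0 = S * W t0 by rewrite /S divfK// gt_eqF.
  have h5 : S * W t0 <= 2 * c by rewrite -h4; lra.
  by apply: le_trans h5; rewrite ler_peMr.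
move=> t tab; have /andP[_ W2] := vweight_ge1 fwd (ltW L'0) tab.
apply: (le_trans (dS _ tab)).
apply: (@le_trans _ _ (2 * c * W t)); first by rewrite ler_wpM2r// ltW.
by rewrite ler_wpM2l// mulr_ge0.
Qed.

(** The intervals with centre [u k] and radius [2 * K * 2^-1 ^+ k] are nested, and the supremum of
    their left ends lies in all of them. This yields the limit together with the rate. *)
Lemma geo_limit (u : nat -> R) (K : R) : 0 <= K ->
  (forall k, `|u k.+1 - u k| <= K * 2^-1 ^+ k) ->
  exists l, forall k, `|l - u k| <= 2 * K * 2^-1 ^+ k.
Proof.
move=> K0 uK.
have p0 k : 0 <= K * 2^-1 ^+ k by rewrite mulr_ge0// exprn_ge0// invr_ge0.
have uU k j : u k - 2 * K * 2^-1 ^+ k <= u (k + j)%N - 2 * K * 2^-1 ^+ (k + j) /\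
    u (k + j)%N + 2 * K * 2^-1 ^+ (k + j) <= u k + 2 * K * 2^-1 ^+ k.
  elim: j => [|j [IH1 IH2]]; first by rewrite addn0.
  have := uK (k + j)%N; rewrite addnS exprS ler_norml => /andP[h1 h2].
  have e : 2 * K * (2^-1 * 2^-1 ^+ (k + j)) = K * 2^-1 ^+ (k + j) by field.
  by split; rewrite e; lra.
have lu k j : u k - 2 * K * 2^-1 ^+ k <= u j + 2 * K * 2^-1 ^+ j.
  have [[h _] [_ h']] := (uU k j, uU j k).
  apply: (le_trans h); rewrite addnC; apply: le_trans h'.
  by have := p0 (j + k)%N; lra.
pose E := range (fun k => u k - 2 * K * 2^-1 ^+ k).
have hE : has_ubound E by exists (u 0 + 2 * K * 2^-1 ^+ 0%N) => _ [k _ <-].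
exists (sup E) => k; rewrite ler_distl; apply/andP; split.
  by apply: ub_le_sup => //; exists k.
apply: ge_sup; first by exists (u 0 - 2 * K * 2^-1 ^+ 0%N); exists 0%N.
by move=> _ [j _ <-].
Qed.

Lemma le0_geo (x K : R) : (forall k, x <= K * 2^-1 ^+ k) -> x <= 0.
Proof.
move=> xK; have : (fun k => K * 2^-1 ^+ k : R) @ \oo --> (0 : R).
  rewrite -[X in _ --> X](mulr0 K); apply: cvgMr.
  by apply: cvg_expr; rewrite ger0_norm// invf_lt1// ltr1n.
by move=> h; rewrite -(cvg_lim _ h)//; apply: limr_ge; [apply/cvg_ex; exists 0|near=> k; exact: xK].
Unshelve. all: by end_near. Qed.

(** [Phi] halves distances in the weighted norm, so the iterates converge geometrically at every
    time, uniformly on the interval. [F] acts on whole functions and its image is only integrable in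
    time, which covers both the truncated state equation and the adjoint equation along a given
    trajectory. *)
Lemma picard fwd n (a b L : R) (h : R -> 'cV[R]_n)
    (F : (R -> 'cV[R]_n) -> R -> 'cV[R]_n) : a <= b -> 0 <= L ->
  ctn a b h ->
  (forall y, ctn a b y -> forall i, intg a b (fun t => F y t i ord0)) ->
  (forall y z, ctn a b y -> ctn a b z -> {in `]a, b[, forall t,
     l1 (F y t - F z t) <= L * l1 (y t - z t)}) ->
  exists2 y, ctn a b y & {in `[a, b], forall t,
     y t = h t + \col_i vint fwd a b (fun s => F y s i ord0) t}.
Proof.
move=> ab L0 ch Fi FL.
pose L' := L + 1; have L'0 : 0 < L' by rewrite ltr_wpDl.
pose W := vweight fwd a b L'.
have W0 t : 0 < W t by exact: expR_gt0.
have cW : {within `[a, b], continuous W} by apply: continuous_subspaceT; exact: vweight_cont.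
have iW : intg a b W by exact: within_intg.
pose B := expR (2 * L' * (b - a)).
have WB t : t \in `[a, b] -> W t <= B by move=> tab; have /andP[] := vweight_ge1 fwd (ltW L'0) tab.
have W1 t : t \in `[a, b] -> 1 <= W t by move=> tab; have /andP[] := vweight_ge1 fwd (ltW L'0) tab.
pose Phi y t : 'cV[R]_n := h t + \col_i vint fwd a b (fun s => F y s i ord0) t.
have cPhi y : ctn a b y -> ctn a b (Phi y).
  move=> cy i; apply: (@eq_wc _ _ _ (fun t => h t i ord0 + vint fwd a b (fun s => F y s i ord0) t)).
    by move=> t _; rewrite !mxE.
  by apply: wcD => //; apply: within_vint => //; exact: Fi.
have cl1 (y z : R -> 'cV[R]_n) : ctn a b y -> ctn a b z -> {within `[a, b], continuous (fun t => l1 (y t - z t))}.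
  move=> cy cz; apply: (@eq_wc _ _ _ (fun t => \sum_i `|y t i ord0 - z t i ord0|)).
    by move=> t _; apply: eq_bigr => i _; rewrite !mxE.
  by apply: wc_sum => i; apply: wc_norm; exact: wcB.
have PhiL y z c : 0 <= c -> ctn a b y -> ctn a b z ->
    {in `[a, b], forall t, l1 (y t - z t) <= c * W t} ->
    {in `[a, b], forall t, l1 (Phi y t - Phi z t) <= c / 2 * W t}.
  move=> c0 cy cz yz t tab.
  have -> : l1 (Phi y t - Phi z t) =
      \sum_i `|vint fwd a b (fun s => F y s i ord0 - F z s i ord0) t|.
    apply: eq_bigr => i _; rewrite vintB//; [|exact: Fi|exact: Fi].
    by congr (`|_|); rewrite !mxE; ring.
  have iF i : intg a b (fun s => F y s i ord0 - F z s i ord0) by apply: intgB; exact: Fi.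
  apply: (@le_trans _ _ (\sum_i vint fwd a b (fun s => `|F y s i ord0 - F z s i ord0|) t)).
    apply: ler_sum => i _; apply: norm_vint_le => //; first exact: intg_norm.
    exact: aeE.
  rewrite -vint_sum//; last by move=> i; exact: intg_norm.
  apply: (@le_trans _ _ (vint fwd a b (fun s => c * (L' * W s)) t)).
    apply: le_vint => //.
    - by apply: intg_sum => i; exact: intg_norm.
    - by do 2 apply: intgZ.
    apply: aeE => s sab.
    have := FL y z cy cz s sab.
    rewrite /l1; under eq_bigr do rewrite !mxE.
    move=> /le_trans; apply.
    rewrite mulrCA; have sab' := subset_itv_oo_cc sab.
    apply: (@le_trans _ _ (L * (c * W s))); first by rewrite ler_wpM2l// yz.
    by rewrite ler_wpM2r ?lerDl// mulr_ge0// ltW.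
  rewrite vintZ//; last exact: intgZ.
  rewrite -mulrA ler_wpM2l// mulrC; exact: vint_vweight.
pose yk k := iter k Phi h.
have cyk k : ctn a b (yk k) by elim: k => [//|k IH]; exact: cPhi.
have [C C0 hC] : exists2 C : R, 0 <= C & {in `[a, b], forall t, l1 (yk 1%N t - yk 0%N t) <= C}.
  have [C hC] := within_bounded (cl1 _ _ (cyk 1%N) (cyk 0%N)).
  exists `|C| => // t tab; apply: (le_trans (ler_norm _)).
  by apply: (le_trans (hC _ tab)); exact: ler_norm.
have ykC k : {in `[a, b], forall t, l1 (yk k.+1 t - yk k t) <= C * 2^-1 ^+ k * W t}.
  elim: k => [|k IH].
    move=> t tab; rewrite expr0 mulr1.
    by apply: (le_trans (hC _ tab)); rewrite ler_peMr ?W1.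
  have -> : C * 2^-1 ^+ k.+1 = C * 2^-1 ^+ k / 2 by rewrite exprS; field.
  apply: (PhiL (yk k.+1) (yk k) _ _ (cyk _) (cyk _) IH).
  by rewrite mulr_ge0// exprn_ge0// invr_ge0.
have [y yE] : exists y : R -> 'cV[R]_n, {in `[a, b], forall t, forall i k,
    `|y t i ord0 - yk k t i ord0| <= 2 * (C * B) * 2^-1 ^+ k}.
  have H (ti : R * 'I_n) : exists l, ti.1 \in `[a, b] -> forall k,
      `|l - yk k ti.1 ti.2 ord0| <= 2 * (C * B) * 2^-1 ^+ k.
    case: (boolP (ti.1 \in `[a, b])) => tab; last by exists 0.
    have [||l lE] := @geo_limit (fun k => yk k ti.1 ti.2 ord0) (C * B).
    - by rewrite mulr_ge0// expR_ge0.
    - move=> k; have := ykC k ti.1 tab; have := l1_coord (yk k.+1 ti.1 - yk k ti.1) ti.2.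
      rewrite !mxE => h1 h2; apply: (le_trans h1); apply: (le_trans h2).
      by rewrite -mulrA (mulrC (_ ^+ k)) mulrA ler_wpM2r ?exprn_ge0 ?invr_ge0// ler_wpM2l// WB.
    by exists l.
  have [l lE] := choice H.
  exists (fun t => \col_i l (t, i)) => t tab i k; rewrite mxE; exact: (lE (t, i)).
have e0 (k : nat) : 0 <= 2^-1 ^+ k :> R by rewrite exprn_ge0// invr_ge0.
have cy : ctn a b y.
  move=> i; apply: wc_uniform => e ep.
  have [k kE] : exists k, 2 * (C * B) * 2^-1 ^+ k <= e.
    apply: contrapT => /forallNP H.
    suff : e <= 0 by rewrite leNgt ep.
    apply: (@le0_geo _ (2 * (C * B))) => k.
    by have := H k; move/negP; rewrite -ltNge => /ltW.
  exists (fun t => yk k t i ord0); first exact: cyk.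
  by move=> t tab; apply: le_trans kE; exact: yE.
(* The limit is a fixed point because [yk k.+1] equals [Phi (yk k)] and is geometrically close both
   to [y] and to [Phi y]. *)
exists y => // t tab; apply/eqP; rewrite -subr_eq0; apply/eqP/l1_eq0.
apply: (@le0_geo _ (2 * (n%:R * (2 * (C * B)) * B))) => k.
have ly j : {in `[a, b], forall s, l1 (y s - yk j s) <= n%:R * (2 * (C * B)) * 2^-1 ^+ j}.
  move=> s sab; rewrite -mulrA mulr_natl -[n in _ *+ n]card_ord -sumr_const ler_sum// => i _.
  by rewrite !mxE yE.
set D := n%:R * (2 * (C * B)) in ly *.
have D0 : 0 <= D by rewrite !mulr_ge0// ?expR_ge0.
clearbody D.
apply: (le_trans (ler_l1_distD (yk k.+1 t) _ _)).
have B1 : 1 <= B by rewrite (le_trans (W1 _ tab))// WB.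
have h1 : l1 (y t - yk k.+1 t) <= D * B * 2^-1 ^+ k.
  apply: (le_trans (ly _ _ tab)).
  rewrite exprS; have := e0 k; move: (2^-1 ^+ k) => x x0.
  rewrite -[D * B * x]mulrA ler_wpM2l// ler_wpM2r// (le_trans _ B1)// invf_le1 ?ler1n//.
have h2 : l1 (Phi (yk k) t - Phi y t) <= D * B * 2^-1 ^+ k.
  have := @PhiL (yk k) y (D * 2^-1 ^+ k) (mulr_ge0 D0 (e0 k)) (cyk k) cy.
  have H : {in `[a, b], forall t, l1 (yk k t - y t) <= D * 2^-1 ^+ k * W t}.
    move=> s sab; rewrite l1BC (le_trans (ly _ _ sab))// ler_peMr ?W1//.
    by rewrite mulr_ge0.
  move=> /(_ H t tab) /le_trans; apply.
  have := WB t tab; have := W0 t; have := e0 k; move: (2^-1 ^+ k) (W t) => x w x0 w0 wB.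
  have -> : D * x / 2 * w = D * x * (w / 2) by field.
  by rewrite [leRHS]mulrAC ler_wpM2l ?mulr_ge0//; lra.
have -> : 2 * (D * B) * 2^-1 ^+ k = D * B * 2^-1 ^+ k + D * B * 2^-1 ^+ k by ring.
exact: (lerD h1 h2).
Qed.

End volterra.

(** * Sobolev functions *)

Section sobolev.
Context {R : realType}.
Local Notation mu := (@lebesgue_measure R).
Implicit Types (a b : R) (p : nat).

Definition mf_vec p a b (v : R -> 'cV[R]_p) : Prop :=
  forall i, measurable_fun (`]a, b[ : set (measurableTypeR R)) (fun t => v t i ord0).

Definition sqL2 p a b (v : R -> 'cV[R]_p) : R := \int[mu]_(t in `]a, b[) enorm (v t) ^+ 2.

Lemma mf_enorm2 p a b (v : R -> 'cV[R]_p) : mf_vec a b v ->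
  measurable_fun (`]a, b[ : set (measurableTypeR R)) (fun t => enorm (v t) ^+ 2).
Proof.
move=> mv; rewrite (_ : (fun t => _) = (fun t => \sum_i (v t i ord0 * v t i ord0))).
  by apply: measurable_sum => i; apply: measurable_funM; exact: mv.
by apply/funext => t; rewrite sqr_enorm.
Qed.

Lemma mf_vecS p a b c d (v : R -> 'cV[R]_p) : a <= c -> d <= b -> mf_vec a b v -> mf_vec c d v.
Proof.
move=> ac db mv i; apply: measurable_funS (mv i) => //.
by apply: subset_itv; rewrite bnd_simp.
Qed.

Lemma ctn_mf p a b (v : R -> 'cV[R]_p) : ctn a b v -> mf_vec a b v.
Proof. by move=> cv i; exact: within_measurable. Qed.

Lemma L2P p a b (v : R -> 'cV[R]_p) : L2 a b v <->
  mf_vec a b v /\ intg a b (fun t => enorm (v t) ^+ 2).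
Proof.
split=> -[mv].
  move=> iv; split => //; apply/integrableP; split.
    by apply/measurable_EFinP; exact: mf_enorm2.
  by under eq_integral do rewrite /= ger0_norm ?sqr_ge0//.
move=> /integrableP[_ iv]; split => //.
by under eq_integral do rewrite -[X in X%:E]ger0_norm ?sqr_ge0//.
Qed.

Lemma L2_intg p a b (v : R -> 'cV[R]_p) i : L2 a b v -> intg a b (fun t => v t i ord0).
Proof.
move=> /L2P[mv iv]; apply: (@intg_dom _ _ _ _ (fun t => 1 + enorm (v t) ^+ 2)) => //.
  move=> t _; have := enorm_coord (v t) i; have := enorm_ge0 (v t).
  by move: (enorm _) `|_| => e x; nra.
by apply: intgD => //; exact: intg_cst.
Qed.

Lemma L2_dom p q a b (v : R -> 'cV[R]_p) (w : R -> 'cV[R]_q) (A B : R) :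
  mf_vec a b v -> L2 a b w -> 
  {in `]a, b[, forall t, enorm (v t) ^+ 2 <= A + B * enorm (w t) ^+ 2} -> L2 a b v.
Proof.
move=> mv /L2P[mw iw] vw; apply/L2P; split => //.
apply: (@intg_dom _ _ _ _ (fun t => A + B * enorm (w t) ^+ 2)).
- exact: mf_enorm2.
- by move=> t tab; rewrite ger0_norm ?sqr_ge0// vw.
- by apply: intgD; [exact: intg_cst|exact: intgZ].
Qed.

Lemma L2_bounded p a b (v : R -> 'cV[R]_p) C : mf_vec a b v ->
  {in `]a, b[, forall t, l1 (v t) <= C} -> L2 a b v.
Proof.
move=> mv vC; apply/L2P; split => //; apply: (@intg_bounded _ _ _ _ (C ^+ 2)).
  exact: mf_enorm2.
move=> t tab; have C0 : 0 <= C by rewrite (le_trans (l1_ge0 (v t)))// vC.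
rewrite ger0_norm ?sqr_ge0// ler_pXn2r ?nnegrE ?enorm_ge0//.
by rewrite (le_trans (enorm_le_l1 _))// vC.
Qed.

Lemma ctn_l1 p a b (v : R -> 'cV[R]_p) : ctn a b v ->
  {within `[a, b], continuous (fun t => l1 (v t))}.
Proof. by move=> cv; apply: wc_sum => i; exact: wc_norm. Qed.

Lemma ctnB p a b (v w : R -> 'cV[R]_p) : ctn a b v -> ctn a b w -> ctn a b (fun t => v t - w t).
Proof.
move=> cv cw i; apply: (@eq_wc _ _ _ (fun t => v t i ord0 - w t i ord0)).
  by move=> t _; rewrite !mxE.
exact: wcB.
Qed.

Lemma ctn_bounded p a b (v : R -> 'cV[R]_p) : ctn a b v ->
  exists2 C, 0 <= C & {in `[a, b], forall t, l1 (v t) <= C}.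
Proof.
move=> /ctn_l1/within_bounded[C vC]; exists `|C| => // t tab.
by rewrite (le_trans (ler_norm _))// (le_trans (vC _ tab))// ler_norm.
Qed.

Lemma ctn_L2 p a b (v : R -> 'cV[R]_p) : ctn a b v -> L2 a b v.
Proof.
move=> cv; have [C _ vC] := ctn_bounded cv; apply: (@L2_bounded _ _ _ _ C).
  exact: ctn_mf.
by move=> t /subset_itv_oo_cc; exact: vC.
Qed.

Lemma mf_vecB p a b (v w : R -> 'cV[R]_p) : mf_vec a b v -> mf_vec a b w ->
  mf_vec a b (fun t => v t - w t).
Proof.
move=> mv mw i.
have -> : (fun t => (v t - w t) i ord0) = (fun t => v t i ord0 - w t i ord0).
  by apply/funext => t; rewrite !mxE.
by apply: measurable_funB; [exact: mv|exact: mw].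
Qed.

Lemma sqr_enormD_le p (u v : 'cV[R]_p) : enorm (u + v) ^+ 2 <= 2 * enorm u ^+ 2 + 2 * enorm v ^+ 2.
Proof.
have := ler_enormD u v; have := enorm_ge0 u; have := enorm_ge0 v.
move=> v0 u0 uv; apply: (@le_trans _ _ ((enorm u + enorm v) ^+ 2)).
  by rewrite ler_pXn2r ?nnegrE ?addr_ge0 ?enorm_ge0.
by have := sqr_ge0 (enorm u - enorm v); rewrite sqrrB sqrrD; lra.
Qed.

Lemma L2B p a b (v w : R -> 'cV[R]_p) : L2 a b v -> L2 a b w -> L2 a b (fun t => v t - w t).
Proof.
move=> /L2P[mv iv] /L2P[mw iw]; apply/L2P; split; first exact: mf_vecB.
apply: (@intg_dom _ _ _ _ (fun t => 2 * enorm (v t) ^+ 2 + 2 * enorm (w t) ^+ 2)).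
- by apply: mf_enorm2; exact: mf_vecB.
- move=> t _; rewrite ger0_norm ?sqr_ge0//.
  by rewrite -(enormN (w t)) sqr_enormD_le.
- by apply: intgD; exact: intgZ.
Qed.

Lemma L2Z p a b k (v : R -> 'cV[R]_p) : L2 a b v -> L2 a b (fun t => k *: v t).
Proof.
move=> /L2P[mv iv]; apply/L2P; split.
  move=> i; have -> : (fun t => (k *: v t) i ord0) = (fun t => k * v t i ord0).
    by apply/funext => t; rewrite !mxE.
  exact: measurable_funM.
apply: (@eq_intg _ _ _ (fun t => k ^+ 2 * enorm (v t) ^+ 2)); last exact: intgZ.
by move=> t _; rewrite enormZ exprMn real_normK ?num_real.
Qed.

Lemma L2S p a b c d (v : R -> 'cV[R]_p) : a <= c -> d <= b -> L2 a b v -> L2 c d v.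
Proof.
move=> ac db /L2P[mv iv]; apply/L2P; split; [exact: mf_vecS mv|exact: intgS iv].
Qed.

Lemma sqL2_ge0 p a b (v : R -> 'cV[R]_p) : 0 <= sqL2 a b v.
Proof. by apply: Int_ge0 => t _; rewrite sqr_ge0. Qed.

Lemma L2norm_sqr p a b (v : R -> 'cV[R]_p) : L2norm a b v ^+ 2 = sqL2 a b v.
Proof. by rewrite sqr_sqrtr// sqL2_ge0. Qed.

Lemma eq_sqL2_ae p a b (v w : R -> 'cV[R]_p) : L2 a b v -> L2 a b w ->
  {ae mu, forall t, t \in `]a, b[ -> v t = w t} -> sqL2 a b v = sqL2 a b w.
Proof.
move=> /L2P[mv iv] /L2P[mw iw] vw; apply: eq_Int_ae => //; first exact: mf_enorm2.
by apply: aeS vw => t h tab; rewrite h.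
Qed.

Lemma wd_sub p a b (y v : R -> 'cV[R]_p) s t i : is_weak_deriv a b y v ->
  a <= s -> s <= t -> t <= b ->
  y t i ord0 - y s i ord0 = \int[mu]_(x in `]s, t[) v x i ord0.
Proof.
move=> [Lv yE] as_ st tb.
rewrite (yE t) ?in_itv/= ?(le_trans as_ st)// (yE s) ?in_itv/= ?as_ ?(le_trans st tb)// !mxE.
rewrite (@Int_chasles _ a t s) ?as_//; first by ring.
apply: (@intgS _ a b) => //; exact: L2_intg.
Qed.

Lemma wdE p a b (y v : R -> 'cV[R]_p) i : is_weak_deriv a b y v ->
  {in `[a, b], forall t, y t i ord0 = y a i ord0 + \int[mu]_(x in `]a, t[) v x i ord0}.
Proof. by move=> [_ yE] t tab; rewrite (yE t tab) !mxE. Qed.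

Lemma wd_ctn p a b (y v : R -> 'cV[R]_p) : a <= b -> is_weak_deriv a b y v -> ctn a b y.
Proof.
move=> ab yv i; apply: (@eq_wc _ _ _ (fun t => y a i ord0 + \int[mu]_(x in `]a, t[) v x i ord0)).
  by move=> t tab; rewrite [RHS](wdE i yv).
apply: wcD; first exact: wc_cst.
by apply: within_Int => //; apply: L2_intg; case: yv.
Qed.

Lemma H1_ctn p a b (y : R -> 'cV[R]_p) : a <= b -> H1 a b y -> ctn a b y.
Proof. by move=> ab [v /wd_ctn]; exact. Qed.

Lemma dot_wd p a b (y : R -> 'cV[R]_p) : H1 a b y -> is_weak_deriv a b y (dot a b y).
Proof. by move=> [v yv]; apply: (@getPex _ [set v | is_weak_deriv a b y v]); exists v. Qed.

(** [dot] picks an arbitrary weak derivative. Uniqueness up to a null set is what allows an explicit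
    one to be used in its place. *)
Lemma wd_uniq p a b (y z v w : R -> 'cV[R]_p) :
  is_weak_deriv a b y v -> is_weak_deriv a b z w -> {in `[a, b], y =1 z} ->
  {ae mu, forall t, t \in `]a, b[ -> v t = w t}.
Proof.
move=> yv zw yz.
have H i : {ae mu, forall t, t \in `]a, b[ -> v t i ord0 - w t i ord0 = 0}.
  have iv : intg a b (fun t => v t i ord0) by apply: L2_intg; case: yv.
  have iw : intg a b (fun t => w t i ord0) by apply: L2_intg; case: zw.
  apply: Int_eq0_ae; first exact: intgB.
  move=> t /[dup] tab; rewrite in_itv/= => /andP[at_ tb].
  rewrite IntB; [|exact: intgS iv|exact: intgS iw].
  rewrite -(wd_sub i yv)// -(wd_sub i zw)// !yz ?subrr//.
  by rewrite in_itv/= lexx (le_trans at_).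
have := aeall H.
apply: aeS => t h tab; apply/matrixP => i j; rewrite ord1.
by apply/eqP; rewrite -subr_eq0 h.
Qed.

Lemma wd_H1 p a b (y v : R -> 'cV[R]_p) : is_weak_deriv a b y v -> H1 a b y.
Proof. by exists v. Qed.

Lemma dot_ae p a b (y v : R -> 'cV[R]_p) : is_weak_deriv a b y v ->
  {ae mu, forall t, t \in `]a, b[ -> dot a b y t = v t}.
Proof. by move=> yv; apply: (wd_uniq (dot_wd (wd_H1 yv)) yv). Qed.

Lemma H1norm_wd p a b (y v : R -> 'cV[R]_p) : is_weak_deriv a b y v ->
  H1norm a b y = Num.sqrt (sqL2 a b v + sqL2 a b y).
Proof.
move=> yv; have [Ld _] := dot_wd (wd_H1 yv).
have E : sqL2 a b (dot a b y) = sqL2 a b v.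
  by apply: eq_sqL2_ae => //; [case: yv|exact: dot_ae].
by rewrite /H1norm !L2norm_sqr E.
Qed.

Lemma H1norm_ge0 p a b (y : R -> 'cV[R]_p) : 0 <= H1norm a b y.
Proof. exact: sqrtr_ge0. Qed.

Lemma sqr_H1norm p a b (y v : R -> 'cV[R]_p) : is_weak_deriv a b y v ->
  H1norm a b y ^+ 2 = sqL2 a b v + sqL2 a b y.
Proof. by move=> yv; rewrite (H1norm_wd yv) sqr_sqrtr// addr_ge0 ?sqL2_ge0. Qed.

Lemma wdB p a b (y v z w : R -> 'cV[R]_p) : is_weak_deriv a b y v -> is_weak_deriv a b z w ->
  is_weak_deriv a b (fun t => y t - z t) (fun t => v t - w t).
Proof.
move=> yv zw; have Lv : L2 a b v by case: yv.
have Lw : L2 a b w by case: zw.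
split; first exact: L2B.
move=> t /[dup] tab; rewrite in_itv/= => /andP[at_ tb]; apply/matrixP => i j; rewrite ord1 !mxE.
rewrite (wdE i yv tab) (wdE i zw tab).
under [in RHS]eq_Rintegral do rewrite !mxE.
rewrite IntB; first by ring.
  by apply: (@intgS _ a b) => //; exact: L2_intg.
by apply: (@intgS _ a b) => //; exact: L2_intg.
Qed.

Lemma wdZ p a b k (y v : R -> 'cV[R]_p) : is_weak_deriv a b y v ->
  is_weak_deriv a b (fun t => k *: y t) (fun t => k *: v t).
Proof.
move=> yv; have Lv : L2 a b v by case: yv.
split; first exact: L2Z.
move=> t /[dup] tab; rewrite in_itv/= => /andP[at_ tb]; apply/matrixP => i j; rewrite ord1 !mxE.
rewrite (wdE i yv tab).
under [in RHS]eq_Rintegral do rewrite !mxE.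
rewrite IntZ; first by ring.
by apply: (@intgS _ a b) => //; exact: L2_intg.
Qed.

Lemma wd_restrict p a b c d (y v : R -> 'cV[R]_p) : a <= c -> d <= b ->
  is_weak_deriv a b y v -> is_weak_deriv c d y v.
Proof.
move=> ac db yv; split; first by apply: (L2S ac db); case: yv.
move=> t; rewrite in_itv/= => /andP[ct td]; apply/matrixP => i j; rewrite ord1 !mxE.
by rewrite -(wd_sub i yv)//; [rewrite addrC subrK|exact: le_trans db].
Qed.

Lemma sqL2Z p a b k (v : R -> 'cV[R]_p) : L2 a b v ->
  sqL2 a b (fun t => k *: v t) = k ^+ 2 * sqL2 a b v.
Proof.
move=> /L2P[mv iv]; rewrite /sqL2 -IntZ//.
by apply: eq_Int => t _; rewrite enormZ exprMn real_normK ?num_real.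
Qed.

Lemma H1normZ p a b k (y : R -> 'cV[R]_p) : a <= b -> H1 a b y ->
  H1norm a b (fun t => k *: y t) = `|k| * H1norm a b y.
Proof.
move=> ab Hy; have [v yv] := Hy.
rewrite (H1norm_wd yv) (H1norm_wd (wdZ k yv)) !sqL2Z.
- by rewrite -mulrDr sqrtrM ?sqr_ge0// sqrtr_sqr.
- exact/ctn_L2/(wd_ctn ab yv).
- by case: yv.
Qed.

Lemma sqL2_le p a b (v : R -> 'cV[R]_p) C : a <= b -> L2 a b v -> 0 <= C ->
  {ae mu, forall t, t \in `]a, b[ -> l1 (v t) <= C} -> sqL2 a b v <= C ^+ 2 * (b - a).
Proof.
move=> ab /L2P[mv iv] C0 vC; rewrite /sqL2 -Int_cst//; apply: le_Int_ae => //.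
  exact: intg_cst.
apply: aeS vC => t h tab; rewrite ler_pXn2r ?nnegrE ?enorm_ge0//.
exact: le_trans (enorm_le_l1 _) (h tab).
Qed.

Lemma H1norm_le p a b (y v : R -> 'cV[R]_p) C : a <= b -> is_weak_deriv a b y v -> 0 <= C ->
  {in `]a, b[, forall t, l1 (y t) <= C} ->
  {ae mu, forall t, t \in `]a, b[ -> l1 (v t) <= C} ->
  H1norm a b y <= C * Num.sqrt (2 * (b - a)).
Proof.
move=> ab yv C0 yC vC.
rewrite (H1norm_wd yv) -[X in X * _]ger0_norm// -sqrtr_sqr -sqrtrM ?sqr_ge0//.
have h1 : sqL2 a b v <= C ^+ 2 * (b - a) by apply: sqL2_le => //; case: yv.
have h2 : sqL2 a b y <= C ^+ 2 * (b - a).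
  by apply: sqL2_le => //; [exact/ctn_L2/(wd_ctn ab yv)|exact: aeE].
by apply: ler_wsqrtr; rewrite mulrCA mulr_natl mulr2n lerD.
Qed.

Section embedding.
Context (p : nat) (T : R) (T0 : 0 < T).
Implicit Types y : R -> 'cV[R]_p.

(** Average over [s] the inequality between the value at [t] and the value at [s] plus the integral
    of the derivative; each of the two integrals is at most [T + 1], because a number is at most one
    plus its square. The bound shows that the suprema in [embedding_norm] are taken over bounded
    sets and are therefore genuine. *)
Lemma sup_bound_unit y : H1 0 T y -> H1norm 0 T y <= 1 ->
  {in `[0, T], forall t, l1 (y t) <= p%:R * ((T + 1) ^+ 2 / T)}.
Proof.
move=> Hy y1 t tT; have [v yv] := Hy.
have Lv : L2 0 T v by case: yv.
have Ly : L2 0 T y by apply: ctn_L2; exact: wd_ctn (ltW T0) yv.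
have [vy1 v1 yy1] : [/\ sqL2 0 T v + sqL2 0 T y <= 1, sqL2 0 T v <= 1 & sqL2 0 T y <= 1].
  have : sqL2 0 T v + sqL2 0 T y <= 1.
    rewrite -(sqr_H1norm yv) expr_le1// ?H1norm_ge0//.
  by have := sqL2_ge0 0 T v; have := sqL2_ge0 0 T y; split; lra.
have bd (w : R -> 'cV[R]_p) i : L2 0 T w -> sqL2 0 T w <= 1 ->
    \int[mu]_(x in `]0, T[) `|w x i ord0| <= T + 1.
  move=> Lw w1; have [mw iw] := (L2P _ _ _).1 Lw.
  apply: (@le_trans _ _ (\int[mu]_(x in `]0, T[) (1 + enorm (w x) ^+ 2))).
    apply: le_Int.
    - by apply: intg_norm; exact: L2_intg.
    - by apply: intgD => //; exact: intg_cst.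
    - move=> x _; have := enorm_coord (w x) i; have := enorm_ge0 (w x).
      by move: (enorm _) `|_| => e z; nra.
  rewrite IntD//; last exact: intg_cst.
  by rewrite Int_cst ?(ltW T0)// mul1r subr0 lerD2l.
rewrite mulr_natl -[p in _ *+ p]card_ord -sumr_const ler_sum// => i _.
rewrite ler_pdivlMr//.
have ivi : intg 0 T (fun x => `|v x i ord0|) by apply: intg_norm; exact: L2_intg.
have iyi : intg 0 T (fun x => `|y x i ord0|) by apply: intg_norm; exact: L2_intg.
set I := \int[mu]_(x in `]0, T[) `|v x i ord0|.
have pt s : s \in `]0, T[ -> `|y t i ord0| <= `|y s i ord0| + I.
  rewrite in_itv/= => /andP[s0 sT]; move: tT; rewrite in_itv/= => /andP[t0 tT].
  have sub a b : 0 <= a -> a <= b -> b <= T ->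
      `|\int[mu]_(x in `]a, b[) v x i ord0| <= I.
    move=> a0 ab bT; apply: (@le_trans _ _ (\int[mu]_(x in `]a, b[) `|v x i ord0|)).
      apply: norm_Int_le => //; last exact: intgS ivi.
      by apply: (@intgS _ 0 T) => //; exact: L2_intg.
    rewrite /I (@Int_chasles _ 0 T a) ?a0 ?(le_trans ab)// (@Int_chasles _ a T b) ?ab//.
      have := @Int_ge0 _ 0 a (fun x => `|v x i ord0|) (fun _ _ => normr_ge0 _).
      have := @Int_ge0 _ b T (fun x => `|v x i ord0|) (fun _ _ => normr_ge0 _).
      lra.
    exact: intgS ivi.
  have [st|/ltW ts] := leP s t.
    have -> : y t i ord0 = y s i ord0 + (y t i ord0 - y s i ord0) by ring.
    rewrite (wd_sub i yv)//; last exact: ltW.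
    by apply: (le_trans (ler_normD _ _)); rewrite lerD2l sub// ltW.
  have -> : y t i ord0 = y s i ord0 - (y s i ord0 - y t i ord0) by ring.
  rewrite (wd_sub i yv)//; last exact: ltW.
  by apply: (le_trans (ler_normB _ _)); rewrite lerD2l sub// ltW.
have : \int[mu]_(s in `]0, T[) `|y t i ord0| <= \int[mu]_(s in `]0, T[) (`|y s i ord0| + I).
  apply: le_Int => //; first exact: intg_cst.
  by apply: intgD => //; exact: intg_cst.
rewrite IntD//; last exact: intg_cst.
rewrite !Int_cst ?(ltW T0)// !subr0.
have := bd v i Lv v1; have := bd y i Ly yy1; rewrite -/I => h1 h2 h3.
apply: (le_trans h3); apply: (@le_trans _ _ ((T + 1) + (T + 1) * T)); last by rewrite le_eqVlt; apply/orP; left; apply/eqP; ring.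
by rewrite lerD// ler_wpM2r// ltW.
Qed.

Lemma has_sup_trace y : H1 0 T y -> H1norm 0 T y <= 1 ->
  has_ubound [set enorm (y t) | t in `[0, T]].
Proof.
move=> Hy y1; exists (p%:R * ((T + 1) ^+ 2 / T)) => _ [t tT <-].
by apply: le_trans (enorm_le_l1 _) _; exact: sup_bound_unit.
Qed.

Lemma embedding_unit y : H1 0 T y -> H1norm 0 T y <= 1 ->
  {in `[0, T], forall t, enorm (y t) <= @embedding_norm R p T}.
Proof.
move=> Hy y1 t tT; apply: (@le_trans _ _ (sup [set enorm (y t) | t in `[0, T]])).
  by apply: ub_le_sup; [exact: has_sup_trace|exists t].
apply: ub_le_sup; last by exists y.
exists (p%:R * ((T + 1) ^+ 2 / T)) => _ [z [Hz z1] <-].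
apply: ge_sup; first by exists (enorm (z 0)); exists 0 => //=; rewrite in_itv/= lexx ltW.
by move=> _ [s sT <-]; apply: le_trans (enorm_le_l1 _) _; exact: sup_bound_unit.
Qed.

Lemma embedding_le y : H1 0 T y ->
  {in `[0, T], forall t, enorm (y t) <= @embedding_norm R p T * H1norm 0 T y}.
Proof.
move=> Hy t tT; set E := @embedding_norm R p T.
have key k : 0 < k -> k * H1norm 0 T y <= 1 -> k * enorm (y t) <= E.
  move=> k0 kN; have := @embedding_unit (fun t => k *: y t) _ _ t tT.
  rewrite enormZ gtr0_norm//; apply.
    by have [v yv] := Hy; exists (fun t => k *: v t); exact: wdZ.
  by rewrite H1normZ ?(ltW T0)// gtr0_norm.
(* If the norm vanishes, all multiples of [y] lie in the unit ball, and a nonzero value could be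
   scaled beyond [E]. Otherwise [y] is normalized. *)
have := H1norm_ge0 0 T y; rewrite le_eqVlt => /predU1P[N0|N0].
  rewrite -N0 mulr0 leNgt; apply/negP => e0.
  have E0 : 0 <= E.
    by apply: le_trans (key 1 _ _); rewrite ?mul1r ?enorm_ge0 -?N0.
  have := key ((E + 1) / enorm (y t)) _ _.
  rewrite divfK ?gt_eqF// -N0 mulr0 => /(_ _ ler01) H.
  have : E + 1 <= E by apply: H; rewrite divr_gt0// ltr_wpDl.
  lra.
have := key (H1norm 0 T y)^-1; rewrite invr_gt0 mulVf ?gt_eqF// => /(_ N0 (lexx _)).
by rewrite mulrC ler_pdivrMr.
Qed.

(** A unit vector divided by the square root of [T], as a constant function, lies in the unit ball.
    Positivity is needed because [Mhat] will serve as a truncation radius. *)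
Lemma embedding_gt0 : (0 < p)%N -> 0 < @embedding_norm R p T.
Proof.
move=> p0; pose i0 := Ordinal p0.
pose c := (Num.sqrt T)^-1.
have c0 : 0 < c by rewrite invr_gt0 sqrtr_gt0.
pose y : R -> 'cV[R]_p := fun=> c *: delta_mx i0 ord0.
have yv : is_weak_deriv 0 T y (fun=> 0).
  split.
    by apply: (@L2_bounded _ _ _ _ 0) => [i|t _]; [exact: measurable_cst|rewrite l10].
  move=> t tT; rewrite (_ : \col_i _ = 0) ?addr0//; apply/matrixP => i j.
  rewrite mxE [RHS]mxE; transitivity (\int[mu]_(x in `]0, t[) (0 : R)).
    by apply: eq_Int => s _; rewrite mxE.
  by move: tT; rewrite in_itv/= => /andP[t0 _]; rewrite Int_cst// mul0r.
have ny : enorm (delta_mx i0 ord0 : 'cV[R]_p) = 1.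
  apply/eqP; rewrite -(@eqrXn2 _ 2)// ?enorm_ge0// sqr_enorm /dotv (bigD1 i0)//= big1 ?addr0.
    by rewrite !mxE eqxx/= mulr1 expr1n.
  by move=> i /negbTE ii0; rewrite !mxE ii0 mul0r.
have yc t : enorm (y t) = c by rewrite enormZ ny mulr1 gtr0_norm.
have y1 : H1norm 0 T y <= 1.
  rewrite (H1norm_wd yv) -[leRHS]sqrtr1; apply: ler_wsqrtr.
  have -> : sqL2 0 T y = 1.
    rewrite /sqL2; under eq_Rintegral do rewrite yc.
    by rewrite Int_cst ?(ltW T0)// subr0 /c exprVn sqr_sqrtr ?mulVf ?gt_eqF// ltW.
  have : sqL2 0 T (fun=> 0 : 'cV[R]_p) <= 0 ^+ 2 * (T - 0).
    apply: sqL2_le => //; [exact: ltW|by case: yv|].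
    by apply: aeE => t _; rewrite l10.
  by rewrite expr0n/= mul0r; lra.
have t0T : 0 \in `[0, T] by rewrite in_itv/= lexx ltW.
have := embedding_unit (wd_H1 yv) y1 t0T.
by rewrite yc; exact: lt_le_trans.
Qed.

End embedding.
End sobolev.

(** * Differentiability on sets and Nemytskii kernels *)

Section relative_differentials.
Context {R : realType}.
Implicit Types U V W : normedModType R.

(** A differential along a filter is an expansion about the limit of that filter, so this identifies
    the base point of the relative differentials. *)
Lemma lim_within U (A : set U) (x : U) : A x -> lim (within A (nbhs x)) = x.
Proof.
move=> Ax; have PF : ProperFilter (within A (nbhs x)).
  by apply: within_nbhs_proper; exact: subset_closure.
apply: (@cvg_lim _ _ _ (within A (nbhs x)) PF id x); [exact: norm_hausdorff|exact: cvg_within].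
Qed.

Lemma diff_within_expansion U W (h : U -> W) (A : set U) (x : U) : A x ->
  differentiable h (within A (nbhs x)) -> forall e : R, 0 < e ->
  \forall u \near within A (nbhs x),
    `|h u - h x - 'd h (within A (nbhs x)) (u - x)| <= e * `|u - x|.
Proof.
move=> Ax [[_ hE]] e e0; move: hE; rewrite (lim_within Ax) => /eqaddoP /(_ e e0) /=.
by apply: filterS => u; rewrite /= opprD addrA.
Qed.

Lemma diff_nbhs_expansion V W (h : V -> W) (x : V) : differentiable h x ->
  forall e : R, 0 < e -> \forall u \near x, `|h u - h x - 'd h x (u - x)| <= e * `|u - x|.
Proof.
move=> [[_ /eqaddoP hE]] e e0; move: (hE e e0); rewrite lim_id; last exact: norm_hausdorff.
by apply: filterS => u; rewrite /= opprD addrA.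
Qed.

Lemma diff_ball_expansion V W (h : V -> W) (x : V) : differentiable h x ->
  forall e : R, 0 < e -> exists2 r : R, 0 < r & forall u, `|u - x| < r ->
    `|h u - h x - 'd h x (u - x)| <= e * `|u - x|.
Proof.
move=> dh e e0; have /nbhs_ballP[r /= r0 hr] := diff_nbhs_expansion dh e0.
exists r => // u ur; apply: (hr u).
by rewrite -ball_normE /ball_/= distrC.
Qed.

Lemma diff_expansion V W (h : V -> W) (x : V) (df : {linear V -> W}) : continuous df ->
  (forall e : R, 0 < e -> \forall u \near x, `|h u - h x - df (u - x)| <= e * `|u - x|) ->
  differentiable h x /\ 'd h x =1 df.
Proof.
move=> cdf hE.
have E : h \o shift x = cst (h x) + df +o_ 0 id.
  apply/eqaddoP => e e0.
  have := hE e e0; rewrite (near_shift 0) subr0; apply: filterS => u /=.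
  rewrite opprD addrA; congr (_ <= _); last by rewrite addrK.
  by congr (`|_ - df _|); rewrite addrK.
have dE := diff_unique cdf E.
split; last by move=> v; rewrite dE.
by apply/diff_locallyP; rewrite dE; split.
Qed.

(** The remainder of [h] is small compared with [L (z - y)], hence with [z - y]. Only the slice has
    to remain in [A] near [y], so differentiability in the state becomes the ordinary one even at
    the end points of the time interval. *)
Lemma diff_slice U V W (h : U -> W) (A : set U) (x : U) (y : V) (L : {linear V -> U}) :
  A x -> continuous L -> (\forall z \near y, A (x + L (z - y))) ->
  differentiable h (within A (nbhs x)) ->
  differentiable (fun z => h (x + L (z - y))) y /\
  forall v, 'd (fun z => h (x + L (z - y))) y v = 'd h (within A (nbhs x)) (L v).
Proof.
move=> Ax cL nA dh.
have [k k0 Lk] := linear_lipschitz cL.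
have [cd _] := (diffP _ _).1 dh.
apply: (@diff_expansion V W _ y ('d h (within A (nbhs x)) \o L : {linear V -> W})).
  by move=> v; apply: continuous_comp; [exact: cL|exact: cd].
move=> e e0.
have ek0 : 0 < e / k by rewrite divr_gt0.
have H := diff_within_expansion Ax dh ek0.
have cg : (fun z => x + L (z - y)) z @[z --> y] --> x.
  rewrite -[X in _ --> X]addr0 -(linear0 L) -(subrr y).
  apply: cvgD; first exact: cvg_cst.
  apply: continuous_cvg; first exact: cL.
  by apply: cvgB; [exact: cvg_id|exact: cvg_cst].
have {}H := cg _ H.
apply: filterS2 nA H => z /= Az /(_ Az).
rewrite subrr linear0 addr0 [x + _ - x]addrC addKr => /le_trans; apply.
by rewrite -mulrA ler_wpM2l ?(ltW e0)// mulrC ler_pdivrMr// mulrC.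
Qed.

Definition lsnd U V (v : V) : U * V := (0, v).
Arguments lsnd U {V} v.

Fact lsnd_linear U V : linear (@lsnd U V).
Proof. by move=> k u v; rewrite /lsnd -[RHS]/(_, _) /= scaler0 addr0. Qed.

HB.instance Definition _ U V :=
  GRing.isLinear.Build R V (U * V)%type _ (@lsnd U V) (@lsnd_linear U V).

Lemma lsnd_continuous U V : continuous (@lsnd U V).
Proof. by move=> v; apply: cvg_pair; [exact: cvg_cst|exact: cvg_id]. Qed.

Lemma diff_lincomp V W (c : {linear W -> R}) (h : V -> W) (x : V) : continuous c ->
  differentiable h x ->
  differentiable (fun z => c (h z)) x /\ forall v, 'd (fun z => c (h z)) x v = c ('d h x v).
Proof.
move=> cc dh.
have [cd _] := (diffP _ _).1 dh.
have [k k0 ck] := linear_lipschitz cc.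
apply: (@diff_expansion V R _ x (c \o 'd h x : {linear V -> R})).
  by move=> v; apply: continuous_comp; [exact: cd|exact: cc].
move=> e e0; have ek0 : 0 < e / k by rewrite divr_gt0.
have := diff_nbhs_expansion dh ek0; apply: filterS => u.
rewrite -!linearB /= => H; apply: (le_trans (ck _)).
by rewrite mulrC -ler_pdivlMr// mulrAC.
Qed.

Definition coordl p q (i : 'I_p) (j : 'I_q) (M : 'M[R]_(p, q)) : R := M i j.

Fact coordl_linear p q (i : 'I_p) (j : 'I_q) : linear (coordl i j).
Proof. by move=> k u v; rewrite /coordl !mxE. Qed.

HB.instance Definition _ p q (i : 'I_p) (j : 'I_q) :=
  GRing.isLinear.Build R 'M[R]_(p, q) R _ (coordl i j) (coordl_linear i j).

Lemma coordl_continuous p q (i : 'I_p) (j : 'I_q) : continuous (coordl i j).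
Proof. exact: coord_continuous. Qed.

Lemma slice_pair U V W (g : U * V -> W) (A : set (U * V)) (u : U) (y : V) :
  (\forall z \near y, A (u, z)) -> differentiable g (within A (nbhs (u, y))) ->
  differentiable (fun z => g (u, z)) y /\
  forall v, 'd (fun z => g (u, z)) y v = 'd g (within A (nbhs (u, y))) (lsnd U v).
Proof.
move=> nA dg.
have E z : (u, y) + lsnd U (z - y) = (u, z).
  by congr (_, _) => /=; rewrite ?addr0// addrC subrK.
have := @diff_slice _ _ _ g A (u, y) y (lsnd U : {linear V -> _}).
have -> : (fun z => g ((u, y) + lsnd U (z - y))) = (fun z => g (u, z)).
  by apply/funext => z; rewrite E.
apply => //; first exact: nbhs_singleton nA.
  exact: lsnd_continuous.
by apply: filterS nA => z; rewrite E.
Qed.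

Lemma slice_pairT U V W (g : U * V -> W) (A : set (U * V)) (u : U) (y : V) :
  (forall z, A (u, z)) -> differentiable g (within A (nbhs (u, y))) ->
  differentiable (fun z => g (u, z)) y /\
  forall v, 'd (fun z => g (u, z)) y v = 'd g (within A (nbhs (u, y))) (lsnd U v).
Proof. by move=> nA; apply: slice_pair; apply: nearW. Qed.

(** ['d] takes a filter packed with its proofs. By proof irrelevance equal filters give equal
    packages, and this turns [within A (nbhs x)] into [nbhs x] at interior points. *)
Lemma eq_filter_on T (F G : filter_on T) : F = G :> set_system T -> F = G.
Proof. by case: F G => F cF [G cG] /= FG; subst G; congr FilterType; exact: Prop_irrelevance. Qed.

Lemma eq_diff V W (F G : filter_on V) (h : V -> W) : F = G :> set_system V ->
  ('d h F = 'd h G) * (differentiable h F <-> differentiable h G).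
Proof. by move=> /eq_filter_on ->. Qed.

Lemma diff_interior V W (A : set V) (h : V -> W) (x : V) : A° x ->
  ('d h (within A (nbhs x)) = 'd h x) *
  (differentiable h (within A (nbhs x)) <-> differentiable h x).
Proof. by move=> Ax; apply: eq_diff; exact: within_interior. Qed.

Lemma interiorT_in (T : topologicalType) (x : T) : (@setT T)° x.
Proof. by rewrite interiorT. Qed.

Lemma partial_interior n W (A : set 'cV[R]_n) (h : 'cV[R]_n -> W) x k : A° x ->
  partial A h x k = 'd h x (delta_mx k ord0).
Proof. by move=> Ax; rewrite /partial (diff_interior h Ax). Qed.

Lemma partialT n W (h : 'cV[R]_n -> W) x k :
  partial setT h x k = 'd h x (delta_mx k ord0).
Proof. by apply: partial_interior; exact: interiorT_in. Qed.

Lemma partial_coord n p q (h : 'cV[R]_n -> 'M[R]_(p, q)) (x : 'cV[R]_n) k i j :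
  differentiable h x ->
  partial setT (fun z => h z i j : R) x k = partial setT h x k i j.
Proof.
by move=> dh; rewrite !partialT (diff_lincomp (@coordl_continuous _ _ i j) dh).2.
Qed.

Lemma diff_partials n (h : 'cV[R]_n -> R) (x v : 'cV[R]_n) : differentiable h x ->
  'd h x v = \sum_k v k ord0 * 'd h x (delta_mx k ord0).
Proof.
move=> dh; have -> : v = \sum_k v k ord0 *: (delta_mx k ord0 : 'cV[R]_n).
  apply/matrixP => i j; rewrite ord1 summxE (bigD1 i)//= big1 ?addr0.
    by rewrite !mxE !eqxx mulr1.
  by move=> k /negbTE ki; rewrite !mxE eq_sym ki mulr0.
rewrite linear_sum; apply: eq_bigr => k _; rewrite linearZ summxE (bigD1 k)//= big1 ?addr0.
  by rewrite !mxE !eqxx mulr1.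
by move=> l /negbTE lk; rewrite !mxE eq_sym lk mulr0.
Qed.

Lemma mvt_segment n (h : 'cV[R]_n -> R) (y z : 'cV[R]_n) :
  (forall s : R, 0 <= s <= 1 -> differentiable h (z + s *: (y - z))) ->
  exists2 s : R, 0 <= s <= 1 & h y - h z =
    \sum_k (y - z) k ord0 * 'd h (z + s *: (y - z)) (delta_mx k ord0).
Proof.
move=> dh.
pose g (s : R) : 'cV[R]_n := z + s *: (y - z).
pose phi s := h (g s).
have dg (s : R) : is_diff s g (fun t => t *: (y - z)).
  rewrite /g; apply: is_diff_eq.
  by apply/funext => t /=; rewrite add0r.
have dphi (s : R) : 0 <= s <= 1 -> is_derive s (1 : R) phi ('d h (g s) (y - z)).
  move=> s01.
  have dhs : differentiable h (g s) by exact: dh.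
  have dgs : differentiable g s by [].
  have dc : differentiable phi s by apply: differentiable_comp.
  apply: DeriveDef; first exact/derivable1_diffP.
  have -> : 'D_1 phi s = 'd phi s 1 by rewrite deriveE.
  have -> : 'd phi s = 'd h (g s) \o 'd g s :> (R -> R) by apply: diff_comp.
  by rewrite /= diff_val scale1r.
have [s s01 E] : exists2 s : R, s \in `]0, 1[ & phi 1 - phi 0 = 'd h (g s) (y - z) * (1 - 0).
  apply: (@MVT R phi (fun s => 'd h (g s) (y - z)) 0 1) => //.
    by move=> x; rewrite in_itv/= => /andP[x0 x1]; apply: dphi; rewrite !ltW.
  apply: derivable_within_continuous => x; rewrite in_itv/= => x01.
  by have [] := dphi x x01.
have s01' : 0 <= s <= 1 by move: s01; rewrite in_itv/= => /andP[? ?]; rewrite !ltW.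
exists s => //; rewrite -diff_partials; last exact: dh.
move: E; rewrite subr0 mulr1 /phi /g scale1r scale0r addr0 [z + _]addrC subrK.
exact.
Qed.

Lemma lip_continuous V W (f : V -> W) (k : R) : 
  (forall x y, `|f x - f y| <= k * `|x - y|) -> continuous f.
Proof.
move=> fk x; apply/cvgrPdist_le => e e0.
have k0 : 0 < `|k| + 1 by rewrite ltr_wpDl.
near=> y; apply: (le_trans (fk _ _)).
apply: (@le_trans _ _ ((`|k| + 1) * `|x - y|)).
  by rewrite ler_wpM2r// (le_trans (ler_norm k))// lerDl.
rewrite mulrC -ler_pdivlMr//.
by near: y; apply: cvgr_dist_le; [exact: cvg_id|rewrite divr_gt0].
Unshelve. all: by end_near. Qed.

End relative_differentials.

Lemma wc_comp (T U V : topologicalType) (A : set T) (f : T -> U) (g : U -> V) :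
  {within A, continuous f} -> continuous g -> {within A, continuous (fun x => g (f x))}.
Proof. by move=> cf cg x; apply: continuous_comp; [exact: cf|exact: cg]. Qed.

Section tame_functions.
Context {R : realType} (n : nat) (T : R).
Implicit Types (h : R -> 'cV[R]_n -> R) (y z : 'cV[R]_n).

(** The properties of a superposition kernel that survive sums and products and suffice for all
    estimates below: continuity along continuous trajectories, and a bound and Lipschitz constant in
    the state on every [l1] ball, uniform in time. *)
Definition tame h : Prop :=
  (forall y : R -> 'cV[R]_n, ctn 0 T y -> {within `[0, T], continuous (fun t => h t (y t))}) /\
  (forall r : R, exists2 C : R, 0 <= C & forall t, t \in `[0, T] -> forall y, l1 y <= r ->
     `|h t y| <= C /\ forall z, l1 z <= r -> `|h t y - h t z| <= C * l1 (y - z)).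

Lemma tame_cst (k : R) : tame (fun _ _ => k).
Proof.
split=> [y _|r]; first exact: wc_cst.
by exists `|k| => // t _ y _; split => // z _; rewrite subrr normr0 mulr_ge0// l1_ge0.
Qed.

Lemma tameD h k : tame h -> tame k -> tame (fun t y => h t y + k t y).
Proof.
move=> [ch bh] [ck bk]; split=> [y cy|r].
  by apply: wcD; [exact: ch|exact: ck].
have [C C0 hC] := bh r; have [D D0 hD] := bk r; exists (C + D); first exact: addr_ge0.
move=> t tT y yr; have [h1 h2] := hC t tT y yr; have [k1 k2] := hD t tT y yr; split.
  by rewrite (le_trans (ler_normD _ _))// lerD.
move=> z zr; rewrite opprD addrACA (le_trans (ler_normD _ _))// mulrDl lerD//.
  exact: h2.
exact: k2.
Qed.

Lemma tameM h k : tame h -> tame k -> tame (fun t y => h t y * k t y).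
Proof.
move=> [ch bh] [ck bk]; split=> [y cy|r].
  by apply: wcM; [exact: ch|exact: ck].
have [C C0 hC] := bh r; have [D D0 hD] := bk r; exists (C * D + (C * D + C * D)).
  by rewrite !addr_ge0// mulr_ge0.
move=> t tT y yr; have [h1 h2] := hC t tT y yr; have [k1 k2] := hD t tT y yr; split.
  rewrite normrM (@le_trans _ _ (C * D))// ?ler_pM// lerDl addr_ge0// mulr_ge0//.
move=> z zr; have [h3 _] := hC t tT z zr.
have -> : h t y * k t y - h t z * k t z =
  (h t y - h t z) * k t y + h t z * (k t y - k t z) by ring.
rewrite (le_trans (ler_normD _ _))// !normrM (@le_trans _ _ (C * l1 (y - z) * D + C * (D * l1 (y - z))))//.
  by rewrite lerD// ler_pM// ?h2// ?k2.
have := l1_ge0 (y - z); have := mulr_ge0 C0 D0.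
set l := l1 _; move=> CD l0.
have -> : C * l * D + C * (D * l) = (C * D + C * D) * l by ring.
by rewrite ler_wpM2r// lerDr.
Qed.

Lemma tame_sum (I : finType) (h : I -> R -> 'cV[R]_n -> R) :
  (forall i, tame (h i)) -> tame (fun t y => \sum_i h i t y).
Proof.
move=> th; elim: (index_enum I) => [|i s IH].
  by under eq_fun do under eq_fun do rewrite big_nil; exact: tame_cst.
by under eq_fun do under eq_fun do rewrite big_cons; exact: tameD.
Qed.

Lemma tame_bounds (I : finType) (h : I -> R -> 'cV[R]_n -> R) :
  (forall i, tame (h i)) -> forall r : R, exists2 C : R, 0 <= C & forall i t, t \in `[0, T] ->
    forall y, l1 y <= r ->
     `|h i t y| <= C /\ forall z, l1 z <= r -> `|h i t y - h i t z| <= C * l1 (y - z).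
Proof.
move=> th r.
have /choice[C hC] i : exists C : R, 0 <= C /\ forall t, t \in `[0, T] -> forall y, l1 y <= r ->
     `|h i t y| <= C /\ forall z, l1 z <= r -> `|h i t y - h i t z| <= C * l1 (y - z).
  by have [_ /(_ r)[C C0 hC]] := th i; exists C.
exists (\sum_i C i); first by apply: sumr_ge0 => i _; have [] := hC i.
have Ci i : C i <= \sum_i C i.
  by rewrite (bigD1 i)//= lerDl; apply: sumr_ge0 => j _; have [] := hC j.
move=> i t tT y yr; have [_ /(_ t tT y yr)[h1 h2]] := hC i; split.
  exact: le_trans (Ci i).
by move=> z zr; rewrite (le_trans (h2 z zr))// ler_wpM2r// l1_ge0.
Qed.

Lemma l1_segment y z (s r : R) : 0 <= s <= 1 -> l1 y <= r -> l1 z <= r ->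
  l1 (z + s *: (y - z)) <= r.
Proof.
move=> /andP[s0 s1] yr zr.
have -> : z + s *: (y - z) = s *: y + (1 - s) *: z.
  by rewrite scalerBr scalerBl scale1r addrCA.
apply: (le_trans (ler_l1D _ _)); rewrite !l1Z !ger0_norm//; last by rewrite subr_ge0.
have -> : r = s * r + (1 - s) * r by ring.
by rewrite lerD// ler_wpM2l// subr_ge0.
Qed.

Lemma lipschitz_of_partials (h : 'cV[R]_n -> R) (K : set 'cV[R]_n) (C : R) :
  (forall y z (s : R), 0 <= s <= 1 -> K y -> K z -> K (z + s *: (y - z))) ->
  (forall y, K y -> differentiable h y) ->
  (forall y k, K y -> `|'d h y (delta_mx k ord0)| <= C) ->
  forall y z, K y -> K z -> `|h y - h z| <= C * l1 (y - z).
Proof.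
move=> cK dh hC y z Ky Kz.
have [s s01 ->] := @mvt_segment _ _ h y z (fun s s01 => dh _ (cK _ _ _ s01 Ky Kz)).
rewrite (le_trans (ler_norm_sum _ _ _))// mulr_sumr ler_sum// => k _.
by rewrite normrM mulrC ler_wpM2r// hC//; exact: cK.
Qed.

Lemma trmx_continuous p q : continuous (@trmx R p q : 'M[R]_(p, q) -> 'M[R]_(q, p)).
Proof.
apply: (@lip_continuous _ 'M[R]_(p, q) 'M[R]_(q, p) _ 1) => A B.
rewrite mul1r; apply: norm_mx_le => // i j.
by rewrite (le_trans _ (norm_mx_coord (A - B) j i))// !mxE.
Qed.

Lemma l1_continuous : continuous (@l1 R n).
Proof.
apply/continuous_subspace_setT; apply: wc_sum => i; apply: wc_norm.
by apply: continuous_subspaceT => v; exact: coord_continuous.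
Qed.

Lemma l1_ball_compact (r : R) : compact [set y : 'cV[R]_n | l1 y <= r].
Proof.
pose B := [set v : 'rV[R]_n | forall i, `[- r, r]%classic (v ord0 i)].
have cB : compact B.
  by apply: (@rV_compact _ _ (fun=> `[- r, r]%classic)) => _; exact: segment_compact.
have cK : compact (trmx @` B).
  by apply: continuous_compact cB; apply: continuous_subspaceT; exact: trmx_continuous.
apply: subclosed_compact cK _.
  rewrite (_ : [set _ | _] = (@l1 R n) @^-1` [set x | x <= r])//.
  apply: closed_comp; last exact: closed_le.
  by move=> y _; exact: l1_continuous.
move=> y /= yr; exists y^T; last by rewrite trmxK.
by move=> i; rewrite /= in_itv/= mxE -ler_norml (le_trans (l1_coord _ _)).
Qed.

Lemma ctn_vec a b (y : R -> 'cV[R]_n) : ctn a b y -> {within `[a, b], continuous y}.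
Proof.
move=> cy; apply/subspace_continuousP => t tab; apply/cvgrPdist_le => e e0.
have H i : \forall s \near within `[a, b] (nbhs t), `|y t i ord0 - y s i ord0| <= e.
  have /subspace_continuousP/(_ t tab)/cvgrPdist_le/(_ e e0) := cy i.
  exact.
apply: (@filterS _ (within `[a, b] (nbhs t)) _ _ _ _ (@filter_forall _ _ _ _ _ H)) => s Hs.
by apply: norm_mx_le => [|i j]; [exact: ltW|rewrite ord1 !mxE; exact: Hs].
Qed.

Lemma joint_ctn (g : R * 'cV[R]_n -> R) (y : R -> 'cV[R]_n) :
  {within `[0, T] `*` setT, continuous g} -> ctn 0 T y ->
  {within `[0, T], continuous (fun t => g (t, y t))}.
Proof.
move=> /subspace_continuousP cg /ctn_vec/subspace_continuousP cy.
apply/subspace_continuousP => t tT.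
have c1 : (s, y s) @[s --> within `[0, T] (nbhs t)] --> (t, y t).
  apply: (@cvg_pair _ _ _ (within `[0, T] (nbhs t)) (nbhs t) (nbhs (y t)) _ _ _ id y).
    exact: cvg_within.
  exact: cy.
have := cg (t, y t) (conj tT Logic.I) => /(_ _ _)cgt.
apply: cvg_trans cgt => B HB.
have := c1 _ HB; rewrite /nbhs/= /within/= => H.
by apply: filterS H => s H sT; apply: (H sT).
Qed.

Lemma joint_bounded (g : R * 'cV[R]_n -> R) (r : R) :
  {within `[0, T] `*` setT, continuous g} ->
  exists2 C : R, 0 <= C & forall t, t \in `[0, T] -> forall y, l1 y <= r -> `|g (t, y)| <= C.
Proof.
move=> cg.
have cK := compact_setX (@segment_compact R 0 T) (@l1_ball_compact r).
have cg' : {within `[0, T] `*` [set y | l1 y <= r], continuous g}.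
  by apply: continuous_subspaceW cg => -[t y] [].
have /compact_bounded [M [_ H]] := continuous_compact cg' cK.
exists (`|M| + 1); first by rewrite addr_ge0.
move=> t tT y yr; apply: (H (`|M| + 1)); last by exists (t, y).
by rewrite (le_lt_trans (ler_norm M))// ltrDl.
Qed.

(** By compactness of the time interval times an [l1] ball, the function and its partial derivatives
    are bounded there; the ball is convex, so bounded partial derivatives give a Lipschitz
    constant. *)
Lemma tame_C1 (g : R * 'cV[R]_n -> R) : {within `[0, T] `*` setT, continuous g} ->
  (forall t y, t \in `[0, T] -> differentiable (fun z : 'cV[R]_n => g (t, z)) y) ->
  (forall k, {within `[0, T] `*` setT, continuous
     (fun x : R * 'cV[R]_n => 'd (fun z : 'cV[R]_n => g (x.1, z)) (x.2 : 'cV[R]_n) (delta_mx k ord0) : R)}) ->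
  tame (fun t y => g (t, y)).
Proof.
move=> cg dg cdg; split=> [y|r]; first exact: joint_ctn.
have [C C0 hC] := joint_bounded r cg.
have /choice[D hD] k : exists D : R, forall t, t \in `[0, T] -> forall y, l1 y <= r ->
    `|'d (fun z : 'cV[R]_n => g (t, z)) y (delta_mx k ord0)| <= D.
  by have [D _ hD] := joint_bounded r (cdg k); exists D.
exists (C + \sum_k `|D k|); first by rewrite addr_ge0// sumr_ge0.
move=> t tT y yr; split; first by rewrite (le_trans (hC _ tT _ yr))// lerDl sumr_ge0.
move=> z zr.
apply: (@lipschitz_of_partials (fun z => g (t, z)) [set y | l1 y <= r]) => //.
- by move=> u v s s01 ur vr; exact: l1_segment.
- by move=> u _; exact: dg.
move=> u k ur; apply: (le_trans (hD k t tT u ur)).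
rewrite (le_trans (ler_norm _))// (bigD1 k)//= addrCA lerDl addr_ge0// sumr_ge0//.
Qed.

Lemma eq_tame (h k : R -> 'cV[R]_n -> R) : (forall t y, t \in `[0, T] -> h t y = k t y) ->
  tame h -> tame k.
Proof.
move=> hk [ch bh]; split=> [y cy|r].
  by apply: (@eq_wc _ _ _ (fun t => h t (y t))); [move=> t tT; exact: hk|exact: ch].
have [C C0 hC] := bh r; exists C => // t tT y yr; have [h1 h2] := hC t tT y yr.
by rewrite -hk//; split => // z zr; rewrite -hk//; exact: h2.
Qed.

Section slices.
Context (U : normedModType R) (u : R -> U) (A : set (U * 'cV[R]_n)%type).
Context (cu : continuous u) (uA : forall t y, t \in `[0, T] -> A (u t, y)).

(** [U] and [u] cover two uses: [u] is the identity for the data, which are smooth on the closed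
    time interval only, and [u t] is the pair of a frozen parameter and [t] for the networks. *)
Lemma wc_slice (g : U * 'cV[R]_n -> R) : {within A, continuous g} ->
  {within `[0, T] `*` setT, continuous (fun x : R * 'cV[R]_n => g (u x.1, x.2))}.
Proof.
move=> /subspace_continuousP cg; apply/subspace_continuousP => -[t y] [/= tT _].
have c1 : (u x.1, x.2) @[x --> (t, y)] --> (u t, y).
  apply: (@cvg_pair _ _ _ (nbhs (t, y)) (nbhs (u t)) (nbhs y) _ _ _ (fun x => u x.1) snd).
    by apply: (@cvg_comp _ _ _ fst u _ (nbhs t)); [exact: cvg_fst|exact: cu].
  exact: cvg_snd.
have cgt := cg (u t, y) (uA y tT).
apply: cvg_trans cgt => B HB.
have := HB; rewrite /= => HB'.
have := c1 _ HB'; rewrite /nbhs/= => H.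
apply: filterS H => -[s z] /= H [sT _]; apply: H; exact: uA.
Qed.

Lemma slice_diff (W : normedModType R) (g : U * 'cV[R]_n -> W) t y :
  t \in `[0, T] -> Ck_on 1 A g ->
  differentiable (fun z : 'cV[R]_n => g (u t, z)) y /\
  forall v, 'd (fun z => g (u t, z)) y v = 'd g (within A (nbhs (u t, y))) (lsnd U v).
Proof.
by move=> tT [_ dg _]; apply: slice_pairT; [move=> z; exact: uA|apply: dg; exact: uA].
Qed.

Lemma tame_Ck1 (W : normedModType R) (c : {linear W -> R}) (g : U * 'cV[R]_n -> W) :
  continuous c -> Ck_on 1 A g -> tame (fun t y => c (g (u t, y))).
Proof.
move=> cc Cg; have sl t y tT := slice_diff (t := t) y tT Cg; have [cg _ cdg] := Cg.
have wcc (G : U * 'cV[R]_n -> W) : {within A, continuous G} ->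
    {within A, continuous (fun x => c (G x))}.
  by move=> cG x; apply: continuous_comp; [exact: cG|exact: cc].
apply: (@tame_C1 (fun x => c (g (u x.1, x.2)))).
- by apply: (@wc_slice (fun x => c (g x))); exact: wcc.
- by move=> t y tT; have [] := diff_lincomp cc (sl t y tT).1.
move=> k; apply: (@eq_wc _ _ _ (fun x : R * 'cV[R]_n =>
    c ('d g (within A (nbhs (u x.1, x.2))) (lsnd U (delta_mx k ord0))))).
  move=> [t y] [/= tT _].
  by rewrite (diff_lincomp cc (sl t y tT).1).2 (sl t y tT).2.
apply: (@wc_slice (fun x => c ('d g (within A (nbhs x)) (lsnd U (delta_mx k ord0))))).
by apply: wcc; exact: cdg.
Qed.

Lemma tame_Ck2 (W : normedModType R) (c : {linear W -> R}) (g : U * 'cV[R]_n -> W) k :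
  continuous c -> Ck_on 2 A g ->
  tame (fun t y => c ('d (fun z : 'cV[R]_n => g (u t, z)) y (delta_mx k ord0))).
Proof.
move=> cc Cg; have Cg1 : Ck_on 1 A g by have [? ? C1] := Cg; split => // v; have [] := C1 v.
apply: (@eq_tame (fun t y => c ('d g (within A (nbhs (u t, y))) (lsnd U (delta_mx k ord0))))).
  by move=> t y tT; rewrite (slice_diff y tT Cg1).2.
have [_ _ /(_ (lsnd U (delta_mx k ord0)))] := Cg.
by move=> /(tame_Ck1 cc).
Qed.

End slices.

End tame_functions.

(** * Truncated differential equations *)

Section radial_truncation.
Context {R : realType} (n : nat).
Implicit Types (r : R) (y z : 'cV[R]_n).

(** Radial projection onto the Euclidean ball of radius [r], in a form without case distinction
    whose denominator is positive for positive [r]. *)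
Definition rtrunc r y : 'cV[R]_n := (r / Num.max r (enorm y)) *: y.

Lemma rtrunc_id r y : 0 < r -> enorm y <= r -> rtrunc r y = y.
Proof. by move=> r0 yr; rewrite /rtrunc max_l// divff ?scale1r// gt_eqF. Qed.

Lemma enorm_rtrunc r y : 0 < r -> enorm (rtrunc r y) <= r.
Proof.
move=> r0; have m0 : 0 < Num.max r (enorm y) by rewrite lt_max r0.
rewrite /rtrunc enormZ ger0_norm ?divr_ge0 ?(ltW r0) ?(ltW m0)//.
by rewrite -mulrA ler_piMr ?(ltW r0)// mulrC ler_pdivrMr// mul1r le_max lexx orbT.
Qed.

(** The difference splits into the scaled [y - z] and the change of the scaling factor applied to
    [z]. The second is controlled because [Num.max r (enorm y)] is 1-Lipschitz in [y] and bounds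
    [enorm y]; each part contributes one to the constant. *)
Lemma enorm_rtruncB r y z : 0 < r -> enorm (rtrunc r y - rtrunc r z) <= 2 * enorm (y - z).
Proof.
move=> r0; rewrite /rtrunc.
have my0 : 0 < Num.max r (enorm y) by rewrite lt_max r0.
have mz0 : 0 < Num.max r (enorm z) by rewrite lt_max r0.
set a := Num.max r (enorm y) in my0 *; set b := Num.max r (enorm z) in mz0 *.
have ra : r <= a by rewrite le_max lexx.
have zb : enorm z <= b by rewrite le_max lexx orbT.
have ab : `|b - a| <= enorm (y - z).
  have h := ler_dist_enorm y z; have := h; rewrite ler_norml => /andP[h1 h2].
  have e0 := enorm_ge0 (y - z).
  rewrite /a /b; case: (leP r (enorm y)) => c1; case: (leP r (enorm z)) => c2;
    rewrite ler_norml; apply/andP; split; lra.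
have -> : (r / a) *: y - (r / b) *: z = (r / a) *: (y - z) + (r / a - r / b) *: z.
  by rewrite scalerBr scalerBl addrA subrK.
apply: (le_trans (ler_enormD _ _)); rewrite !enormZ.
have ra0 : 0 <= r / a by rewrite divr_ge0 ?ltW.
have ra1 : r / a <= 1 by rewrite ler_pdivrMr// mul1r.
have -> : r / a - r / b = (r / a) * ((b - a) / b).
  by field; rewrite !gt_eqF.
rewrite (normrM (r / a)) (ger0_norm ra0) [`|(b - a) / b|]normrM normfV (gtr0_norm mz0).
have h1 : r / a * enorm (y - z) <= enorm (y - z) by rewrite ler_piMl// enorm_ge0.
have h2 : r / a * (`|b - a| / b) * enorm z <= enorm (y - z).
  apply: (@le_trans _ _ (1 * `|b - a|)); last by rewrite mul1r.
  rewrite -mulrA ler_pM// ?mulr_ge0// ?invr_ge0 ?enorm_ge0 ?(ltW mz0)//.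
  by rewrite -mulrA ler_piMr// mulrC ler_pdivrMr// mul1r.
lra.
Qed.

Lemma l1_rtruncB r y z : 0 < r -> l1 (rtrunc r y - rtrunc r z) <= 2 * n%:R * l1 (y - z).
Proof.
move=> r0; apply: (le_trans (l1_le_enorm _)).
have -> : 2 * n%:R * l1 (y - z) = n%:R * (2 * l1 (y - z)) by ring.
rewrite ler_wpM2l// (le_trans (enorm_rtruncB _ _ r0))//.
by rewrite ler_wpM2l// enorm_le_l1.
Qed.

Lemma ctn_rtrunc r (a b : R) (y : R -> 'cV[R]_n) : 0 < r -> ctn a b y ->
  ctn a b (fun t => rtrunc r (y t)).
Proof.
move=> r0 cy i.
have cV := ctn_vec cy.
have lc : continuous (fun v : 'cV[R]_n => rtrunc r v i ord0 : R).
  apply: (@lip_continuous _ 'cV[R]_n R _ (2 * n%:R * n%:R)) => u v.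
  apply: (@le_trans _ _ (l1 (rtrunc r u - rtrunc r v))).
    by apply: le_trans (l1_coord _ i); rewrite !mxE.
  apply: (le_trans (l1_rtruncB _ _ r0)).
  rewrite -[leRHS]mulrA ler_wpM2l ?mulr_ge0//; exact: l1_le_norm.
exact: (@wc_comp R 'cV[R]_n R _ y (fun v => rtrunc r v i ord0) cV lc).
Qed.

End radial_truncation.

(** Forward Gronwall for [l1 (y t - x t)], the forcing being the initial gap [k0] plus the integral
    of the defect [k]. It compares two primitives rather than two solutions, so their derivatives
    may come from different fields. *)
Lemma ac_compare {R : realType} n (a b L k0 k : R) (y w x v : R -> 'cV[R]_n) : a <= b ->
  0 <= L -> 0 <= k0 -> 0 <= k -> ctn a b y -> ctn a b x ->
  (forall i, intg a b (fun s => w s i ord0)) -> (forall i, intg a b (fun s => v s i ord0)) ->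
  {in `[a, b], forall t, y t = y a + \col_i \int[lebesgue_measure]_(s in `]a, t[) w s i ord0} ->
  {in `[a, b], forall t, x t = x a + \col_i \int[lebesgue_measure]_(s in `]a, t[) v s i ord0} ->
  l1 (y a - x a) <= k0 ->
  {ae lebesgue_measure, forall t, t \in `]a, b[ -> l1 (w t - v t) <= k + L * l1 (y t - x t)} ->
  {in `[a, b], forall t, l1 (y t - x t) <= 2 * (k0 + k * (b - a)) * expR (2 * (L + 1) * (b - a))}.
Proof.
move=> ab L0 k00 k_0 cy cx iw iv yE xE ya wv.
have cd : {within `[a, b], continuous (fun t => l1 (y t - x t))} by apply: ctn_l1; exact: ctnB.
have id : intg a b (fun s => l1 (y s - x s)) by exact: within_intg.
apply: (@gronwall _ true) => //.
  by rewrite addr_ge0// mulr_ge0// subr_ge0.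
move=> t tab; have := tab; rewrite in_itv/= => /andP[at_ tb].
have E i : (y t - x t) i ord0 = (y a - x a) i ord0 +
    vint true a b (fun s => w s i ord0 - v s i ord0) t.
  rewrite vintB// /vint (xE t tab) (yE t tab) !mxE; ring.
apply: (@le_trans _ _ (k0 + vint true a b (fun s => k + L * l1 (y s - x s)) t)); last first.
  rewrite -addrA lerD2l vintD//; [|exact: intg_cst|exact: intgZ].
  by rewrite lerD2r; exact: vint_cst_le.
apply: (@le_trans _ _ (l1 (y a - x a) +
    \sum_i `|vint true a b (fun s => w s i ord0 - v s i ord0) t|)).
  by rewrite -big_split ler_sum// => i _; rewrite E ler_normD.
apply: lerD => //.
have ii i : intg a b (fun s => `|w s i ord0 - v s i ord0|).
  by apply: intg_norm; exact: intgB.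
apply: (@le_trans _ _ (\sum_i vint true a b (fun s => `|w s i ord0 - v s i ord0|) t)).
  apply: ler_sum => i _; apply: norm_vint_le => //; first exact: intgB.
  exact: aeE.
rewrite -vint_sum//; apply: le_vint => //.
- exact: intg_sum.
- by apply: intgD; [exact: intg_cst|exact: intgZ].
apply: aeS wv => s wv sab.
have -> : \sum_i `|w s i ord0 - v s i ord0| = l1 (w s - v s).
  by apply: eq_bigr => i _; rewrite !mxE.
exact: wv.
Qed.

Section truncated_ode.
Context {R : realType} (n : nat) (a b r L : R) (G : R -> 'cV[R]_n -> 'cV[R]_n).
Local Notation mu := (@lebesgue_measure R).
Context (ab : a <= b) (r0 : 0 < r) (L0 : 0 <= L).
Context (iG : forall y, ctn a b y -> forall i, intg a b (fun t => G t (y t) i ord0)).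
Context (GL : forall t, t \in `]a, b[ -> forall y z, enorm y <= r -> enorm z <= r ->
  l1 (G t y - G t z) <= L * l1 (y - z)).

(** The factor [2 * n%:R] is the Lipschitz constant of the radial truncation with respect to
    [l1]. *)
Let L' := L * (2 * n%:R).

Lemma trunc_field_lip t y z : t \in `]a, b[ ->
  l1 (G t (rtrunc r y) - G t (rtrunc r z)) <= L' * l1 (y - z).
Proof.
move=> tab; apply: (le_trans (GL tab (enorm_rtrunc y r0) (enorm_rtrunc z r0))).
by rewrite /L' -mulrA ler_wpM2l// l1_rtruncB.
Qed.

Lemma trunc_ode_exists (y0 : 'cV[R]_n) : exists2 y, ctn a b y & {in `[a, b], forall t,
  y t = y0 + \col_i \int[mu]_(s in `]a, t[) G s (rtrunc r (y s)) i ord0}.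
Proof.
have [|i|y cy|y z _ _ t tab|y cy yE] :=
  @picard _ true n a b L' (fun=> y0) (fun y t => G t (rtrunc r (y t))) ab.
- by rewrite /L' !mulr_ge0.
- exact: wc_cst.
- by apply: iG; exact: ctn_rtrunc.
- exact: trunc_field_lip.
- by exists y.
Qed.

Lemma trunc_ode_compare (y x v : R -> 'cV[R]_n) (k0 k : R) :
  0 <= k0 -> 0 <= k -> ctn a b y ->
  {in `[a, b], forall t, y t = y a + \col_i \int[mu]_(s in `]a, t[) G s (rtrunc r (y s)) i ord0} ->
  is_weak_deriv a b x v ->
  l1 (y a - x a) <= k0 ->
  {ae mu, forall t, t \in `]a, b[ -> l1 (G t (rtrunc r (x t)) - v t) <= k} ->
  {in `[a, b], forall t, l1 (y t - x t) <= 2 * (k0 + k * (b - a)) * expR (2 * (L' + 1) * (b - a))}.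
Proof.
move=> k00 k_0 cy yE xv ya xk.
have cx := wd_ctn ab xv.
have [Lv xE] := xv.
have L'0 : 0 <= L' by rewrite /L' !mulr_ge0.
apply: (ac_compare ab L'0 k00 k_0 cy cx _ _ yE xE ya).
- by move=> i; exact: (iG (ctn_rtrunc r0 cy)).
- by move=> i; exact: L2_intg.
apply: aeS xk => s xk sab.
apply: (le_trans (ler_l1_distD (G s (rtrunc r (x s))) _ _)).
by rewrite addrC lerD ?xk// trunc_field_lip.
Qed.

Lemma untruncated_wd (y : R -> 'cV[R]_n) C : ctn a b y ->
  {in `[a, b], forall t, y t = y a + \col_i \int[mu]_(s in `]a, t[) G s (rtrunc r (y s)) i ord0} ->
  {in `[a, b], forall t, enorm (y t) <= r} ->
  {in `]a, b[, forall t, forall z, enorm z <= r -> l1 (G t z) <= C} ->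
  is_weak_deriv a b y (fun t => G t (y t)).
Proof.
move=> cy yE yr GC; split.
  apply: (@L2_bounded _ _ _ _ _ C).
    by move=> i; apply: intg_measurable; exact: iG.
  by move=> t tab; apply: GC => //; apply: yr; exact: subset_itv_oo_cc.
move=> t tab; rewrite (yE t tab); congr (_ + _); apply/matrixP => i j; rewrite !mxE.
apply: eq_Int => s; rewrite in_itv/= => /andP[as_ st].
rewrite rtrunc_id//; apply: yr.
by move: tab; rewrite !in_itv/= (ltW as_) => /andP[_ tb]; exact: le_trans (ltW st) tb.
Qed.

End truncated_ode.

(** * Cost, dynamics and adjoint state *)

Section running_cost.
Context {R : realType} (n m : nat) (P : ocp R n m) (HP : standing P).
Local Notation mu := (@lebesgue_measure R).
Local Notation T := (horizon P).
Implicit Types (y : R -> 'cV[R]_n) (u : R -> 'cV[R]_m).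

Lemma horizon_gt0 : 0 < T. Proof. by case: HP. Qed.

Let T0 : 0 <= T. Proof. exact/ltW/horizon_gt0. Qed.

Lemma beta_gt0 : 0 < beta P. Proof. by case: HP. Qed.

Lemma yd_L2 : L2 0 T (yd P). Proof. by case: HP. Qed.

Definition running y u (s : R) : R :=
  enorm (Q1 P *m (y s - yd P s)) ^+ 2 + beta P * enorm (u s) ^+ 2.

Lemma mf_mulmx p q (Q : 'M[R]_(p, q)) (a b : R) (v : R -> 'cV[R]_q) : mf_vec a b v ->
  mf_vec a b (fun t => Q *m v t).
Proof.
move=> mv i; have -> : (fun t => (Q *m v t) i ord0) = (fun t => \sum_j Q i j * v t j ord0).
  by apply/funext => t; rewrite mxE.
by apply: measurable_sum => j; apply: measurable_funM => //; exact: mv.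
Qed.

Lemma enorm_mulmx p q (Q : 'M[R]_(p, q)) (v : 'cV[R]_q) :
  enorm (Q *m v) <= mx1 Q * q%:R * enorm v.
Proof.
apply: (le_trans (enorm_le_l1 _)); apply: (le_trans (l1_mulmx _ _)).
by rewrite -mulrA ler_wpM2l ?mx1_ge0// l1_le_enorm.
Qed.

Lemma L2_mulmx p q (Q : 'M[R]_(p, q)) (a b : R) (v : R -> 'cV[R]_q) : L2 a b v ->
  L2 a b (fun t => Q *m v t).
Proof.
move=> Lv; apply: (@L2_dom _ _ _ _ _ _ v 0 ((mx1 Q * q%:R) ^+ 2)) => //.
  by apply: mf_mulmx; case: ((L2P _ _ _).1 Lv).
move=> t _; rewrite add0r -exprMn ler_pXn2r ?nnegrE ?enorm_ge0 ?mulr_ge0 ?mx1_ge0 ?enorm_ge0//.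
exact: enorm_mulmx.
Qed.

Lemma running_intg_sub (a b : R) y u : 0 <= a -> b <= T ->
  L2 a b y -> L2 a b u -> intg a b (running y u).
Proof.
move=> a0 bT Ly Lu; apply: intgD.
  by have /L2P[] := L2_mulmx (Q1 P) (L2B Ly (L2S a0 bT yd_L2)).
by apply: intgZ; have /L2P[] := Lu.
Qed.

Lemma running_intg y u : L2 0 T y -> L2 0 T u -> intg 0 T (running y u).
Proof. exact: running_intg_sub. Qed.

Lemma costE t y u : cost P t y u =
  1 / 2 * \int[mu]_(s in `]t, T[) running y u s + terminal_cost P (y T).
Proof. by []. Qed.

Lemma cost_tail_continuous y u : L2 0 T y -> L2 0 T u ->
  {within `[0, T], continuous (fun t => cost P t y u)}.
Proof.
move=> Ly Lu; apply: wcD; last exact: wc_cst.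
by apply: wcZ; apply: within_Int_tail => //; exact: running_intg.
Qed.

(** A difference of squares is the gap times at most twice the smaller argument plus the gap, and
    the gap itself is at most [mx1 Q * (r + r)]. The constant is kept affine in [enorm w] because
    [w] will be [yd s], whose norm is integrable but not bounded. *)
Lemma sqr_enorm_shift_lip p q (Q : 'M[R]_(p, q)) (x x' w : 'cV[R]_q) (r e : R) :
  l1 x <= r -> l1 x' <= r -> l1 (x - x') <= e ->
  `|enorm (Q *m (x - w)) ^+ 2 - enorm (Q *m (x' - w)) ^+ 2| <=
  (mx1 Q ^+ 2 * (4 * r + 2 * q%:R * enorm w)) * e.
Proof.
move=> xr x'r xe; apply: (le_trans (ler_sqr_enormB _ _)).
set M := mx1 Q; have M0 : 0 <= M := mx1_ge0 Q.
have -> : Q *m (x - w) - Q *m (x' - w) = Q *m (x - x').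
  by rewrite -mulmxBr opprB addrA subrK.
have h1 : enorm (Q *m (x - x')) <= M * l1 (x - x').
  exact: le_trans (enorm_le_l1 _) (l1_mulmx _ _).
have h2 : enorm (Q *m (x' - w)) <= M * (r + q%:R * enorm w).
  apply: (le_trans (enorm_le_l1 _)); apply: (le_trans (l1_mulmx _ _)); rewrite ler_wpM2l//.
  by rewrite (le_trans (ler_l1B _ _))// lerD// l1_le_enorm.
have h3 : l1 (x - x') <= r + r by rewrite (le_trans (ler_l1B _ _))// lerD.
have e0 : 0 <= e := le_trans (l1_ge0 _) xe.
have -> : M ^+ 2 * (4 * r + 2 * q%:R * enorm w) * e =
  (2 * (M * (r + q%:R * enorm w)) + M * (r + r)) * (M * e) by ring.
apply: ler_pM; rewrite ?addr_ge0 ?mulr_ge0 ?enorm_ge0//.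
  by rewrite lerD ?ler_wpM2l// (le_trans h1)// ler_wpM2l.
by rewrite (le_trans h1)// ler_wpM2l.
Qed.

Definition bounded_by (r : R) p (v : R -> 'cV[R]_p) : Prop := {in `[0, T], forall t, l1 (v t) <= r}.

Definition close_by (e : R) p (v w : R -> 'cV[R]_p) : Prop :=
  {in `[0, T], forall t, l1 (v t - w t) <= e}.

Lemma bounded_L2 (r : R) p (v : R -> 'cV[R]_p) : mf_vec 0 T v -> bounded_by r v -> L2 0 T v.
Proof. by move=> mv vr; apply: (@L2_bounded _ _ _ _ _ r) => // t /subset_itv_oo_cc; exact: vr. Qed.

Lemma sub_tail (f : R -> R) t : t \in `[0, T] -> intg 0 T f -> {in `]0, T[, forall s, 0 <= f s} ->
  \int[mu]_(s in `]t, T[) f s <= \int[mu]_(s in `]0, T[) f s.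
Proof. by move=> tT fi f0; apply: (@vint_sub _ false) => //. Qed.

Lemma cost_lip (r : R) : 0 <= r -> exists2 C : R, 0 <= C & forall e y y' u u', 0 <= e ->
  mf_vec 0 T y -> mf_vec 0 T y' -> mf_vec 0 T u -> mf_vec 0 T u' ->
  bounded_by r y -> bounded_by r y' -> bounded_by r u -> bounded_by r u' ->
  close_by e y y' -> close_by e u u' ->
  {in `[0, T], forall t, `|cost P t y u - cost P t y' u'| <= C * e}.
Proof.
move=> r0.
(* The control term is treated by the same estimate as the tracking term, with the identity matrix
   and zero shift; hence the constant [B]. *)
pose A := mx1 (Q1 P) ^+ 2; pose B := mx1 (1%:M : 'M[R]_m) ^+ 2.
pose g s : R := A * (4 * r + 2 * n%:R * enorm (yd P s)) + beta P * (B * (4 * r)).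
have b0 := ltW beta_gt0.
have A0 : 0 <= A by exact: sqr_ge0.
have B0 : 0 <= B by exact: sqr_ge0.
have g0 s : 0 <= g s.
  rewrite /g; apply: addr_ge0; last by apply: mulr_ge0 => //; apply: mulr_ge0 => //; exact: mulr_ge0.
  apply: mulr_ge0 => //; apply: addr_ge0; first exact: mulr_ge0.
  by apply: mulr_ge0; [exact: mulr_ge0|exact: enorm_ge0].
have /L2P[myd iyd] := yd_L2.
have myd' : measurable_fun (`]0, T[ : set (measurableTypeR R)) (fun s => enorm (yd P s)).
  have -> : (fun s => enorm (yd P s)) = (fun s => Num.sqrt (enorm (yd P s) ^+ 2)).
    by apply/funext => s; rewrite sqrtr_sqr ger0_norm// enorm_ge0.
  by apply: measurableT_comp; [apply: continuous_measurable_fun; exact: sqrt_continuous|exact: mf_enorm2].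
have ig : intg 0 T g.
  apply: intgD; last exact: intg_cst.
  apply: intgZ; apply: intgD; first exact: intg_cst.
  apply: intgZ.
  apply: (@intg_dom _ _ _ _ (fun t => 1 + enorm (yd P t) ^+ 2)) => //.
    by move=> t _; rewrite ger0_norm ?enorm_ge0//; have := enorm_ge0 (yd P t); nra.
  by apply: intgD => //; exact: intg_cst.
have [Ig Ig0 IgE] : exists2 I : R, 0 <= I & \int[mu]_(s in `]0, T[) g s <= I.
  by exists (\int[mu]_(s in `]0, T[) g s) => //; exact: Int_ge0.
pose D := mx1 (Q2 P) ^+ 2 * (4 * r + 2 * n%:R * enorm (ydT P)).
have D0 : 0 <= D.
  apply: mulr_ge0; first exact: sqr_ge0.
  by apply: addr_ge0; apply: mulr_ge0 => //; exact: enorm_ge0.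
exists (1 / 2 * Ig + 1 / 2 * D); first by lra.
move=> e y y' u u' e0 my my' mu1 mu1' yr y'r ur u'r ye ue t tT.
have TT : T \in `[0, T] by rewrite in_itv/= lexx T0.
have [t0 tT'] : 0 <= t /\ t <= T by move: tT; rewrite in_itv/= => /andP[].
have i1 : intg 0 T (running y u) by apply: running_intg; apply: bounded_L2; eassumption.
have i2 : intg 0 T (running y' u') by apply: running_intg; apply: bounded_L2; eassumption.
rewrite !costE /terminal_cost.
have -> : forall a b c d : R, 1 / 2 * a + 1 / 2 * b - (1 / 2 * c + 1 / 2 * d) = 1 / 2 * (a - c) + 1 / 2 * (b - d).
  by move=> *; ring.
have n2 : `|1 / 2 : R| = 1 / 2 by rewrite ger0_norm// divr_ge0.
rewrite (le_trans (ler_normD _ _))// !(normrM (1 / 2)) n2.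
rewrite mulrDl -(mulrA (1 / 2) Ig) -(mulrA (1 / 2) D) lerD// ler_wpM2l ?divr_ge0//.
  rewrite -IntB; [|exact: intgS i1|exact: intgS i2].
  apply: (@le_trans _ _ (\int[mu]_(s in `]t, T[) (e * g s))).
    apply: norm_Int_le.
    - by apply: (@intgS _ 0 T) => //; exact: intgB.
    - by apply: intgZ; exact: intgS ig.
    move=> s; rewrite in_itv/= => /andP[ts sT].
    have sT' : s \in `[0, T] by rewrite in_itv/= (ltW sT) (le_trans t0)// ltW.
    rewrite /running.
    have -> : forall a b c d : R, a + beta P * b - (c + beta P * d) = (a - c) + beta P * (b - d).
      by move=> *; ring.
    rewrite (le_trans (ler_normD _ _))// [e * g s]mulrC /g mulrDl lerD//.
      by apply: sqr_enorm_shift_lip; [exact: yr|exact: y'r|exact: ye].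
    rewrite normrM (ger0_norm b0) -mulrA ler_wpM2l//.
    have := @sqr_enorm_shift_lip _ _ (1%:M : 'M[R]_m) (u s) (u' s) 0 r e (ur _ sT') (u'r _ sT') (ue _ sT').
    rewrite !subr0 !mul1mx => /le_trans; apply.
    have -> : enorm (0 : 'cV[R]_m) = 0.
      by apply/eqP; rewrite -sqrf_eq0 sqr_enorm /dotv big1// => i _; rewrite mxE mul0r.
    by rewrite mulr0 addr0 -/B.
  rewrite IntZ; last exact: intgS ig.
  by rewrite mulrC ler_wpM2r//; apply: le_trans IgE; apply: sub_tail.
by apply: sqr_enorm_shift_lip; [exact: yr|exact: y'r|exact: ye].
Qed.

(** Compare with the zero state and zero control, whose cost to go is continuous in time and hence
    bounded. *)
Lemma cost_bound (r : R) : 0 <= r -> exists2 C : R, 0 <= C & forall y u,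
  mf_vec 0 T y -> mf_vec 0 T u -> bounded_by r y -> bounded_by r u ->
  {in `[0, T], forall t, `|cost P t y u| <= C}.
Proof.
move=> r0; have [C C0 hC] := cost_lip r0.
have z0 p : bounded_by r (fun=> 0 : 'cV[R]_p) by move=> t _; rewrite l10.
have mz p : mf_vec 0 T (fun=> 0 : 'cV[R]_p) by move=> i; exact: measurable_cst.
have Lz p : L2 0 T (fun=> 0 : 'cV[R]_p) by exact: bounded_L2 (mz p) (z0 p).
have [K KC] := within_bounded (cost_tail_continuous (Lz n) (Lz m)).
exists (C * r + `|K|); first by rewrite addr_ge0// mulr_ge0.
move=> y u my mu1 yr ur t tT.
have := hC r y (fun=> 0) u (fun=> 0) r0 my (mz n) mu1 (mz m) yr (z0 n) ur (z0 m) _ _ t tT.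
have h1 : close_by r y (fun=> 0) by move=> s sT; rewrite subr0; exact: yr.
have h2 : close_by r u (fun=> 0) by move=> s sT; rewrite subr0; exact: ur.
move=> /(_ h1 h2) h.
rewrite -[cost P t y u](subrK (cost P t (fun=> 0) (fun=> 0))) (le_trans (ler_normD _ _))// lerD//.
by rewrite (le_trans (KC _ tT))// ler_norm.
Qed.

End running_cost.

Section affine_fields.
Context {R : realType} (n m : nat) (T : R).
Implicit Types (al : R -> 'cV[R]_n -> R) (be : 'I_m -> R -> 'cV[R]_n -> R).

(** Common shape of the components of the controlled field (affine in the control), of the feedback
    law (linear in the costate) and of the adjoint matrix (affine in the control). The last argument
    is kept apart because it is only measurable in time. *)
Definition affine al be t (y : 'cV[R]_n) (u : 'cV[R]_m) : R :=
  al t y + \sum_j be j t y * u j ord0.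

Definition lip_on_balls p (a : R -> 'cV[R]_n -> 'cV[R]_m -> 'cV[R]_p) : Prop :=
  forall r : R, exists2 C : R, 0 <= C & forall t, t \in `[0, T] -> forall y u, l1 y <= r -> l1 u <= r ->
    l1 (a t y u) <= C /\ forall z w, l1 z <= r -> l1 w <= r ->
    l1 (a t y u - a t z w) <= C * (l1 (y - z) + l1 (u - w)).

Lemma affine_bounds al be : tame T al -> (forall j, tame T (be j)) -> forall r : R, 0 <= r ->
  exists2 C : R, 0 <= C & forall t, t \in `[0, T] -> forall y u, l1 y <= r -> l1 u <= r ->
    `|affine al be t y u| <= C /\ forall z w, l1 z <= r -> l1 w <= r ->
    `|affine al be t y u - affine al be t z w| <= C * (l1 (y - z) + l1 (u - w)).
Proof.
move=> ta tb r r0; have [A A0 hA] := ta.2 r; have [B B0 hB] := tame_bounds tb r.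
have mB0 : 0 <= m%:R * (B * r) by rewrite !mulr_ge0.
exists (A + m%:R * (B * r) + B); first by rewrite !addr_ge0.
move=> t tT y u yr ur; have [hA1 hA2] := hA t tT y yr; split.
  rewrite (le_trans (ler_normD _ _))// -addrA lerD//.
  rewrite (le_trans (ler_norm_sum _ _ _))// (@le_trans _ _ (m%:R * (B * r)))//; last by rewrite lerDl.
  rewrite mulr_natl -[m in _ *+ m]card_ord -sumr_const ler_sum// => j _.
  rewrite normrM ler_pM//; first by have [] := hB j t tT y yr.
  exact: le_trans (l1_coord u j) ur.
move=> z w zr wr.
have -> : affine al be t y u - affine al be t z w = (al t y - al t z) +
   (\sum_j (be j t y - be j t z) * u j ord0 + \sum_j be j t z * (u j ord0 - w j ord0)).
  rewrite -big_split /= /affine opprD addrACA -sumrB; congr (_ + _).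
  by apply: eq_bigr => j _; ring.
apply: (le_trans (ler_normD _ _)).
have l0 := l1_ge0 (y - z); have l0' := l1_ge0 (u - w).
apply: (@le_trans _ _ (A * l1 (y - z) + (m%:R * (B * r) * l1 (y - z) + B * l1 (u - w)))).
  apply: lerD; first exact: hA2.
  apply: (le_trans (ler_normD _ _)); apply: lerD.
    rewrite (le_trans (ler_norm_sum _ _ _))// -mulrA mulr_natl -[m in _ *+ m]card_ord -sumr_const.
    apply: ler_sum => j _; rewrite normrM mulrAC.
    apply: ler_pM => //; first by have [_ h] := hB j t tT y yr; exact: h.
    exact: le_trans (l1_coord u j) ur.
  rewrite (le_trans (ler_norm_sum _ _ _))// /l1 mulr_sumr; apply: ler_sum => j _.
  rewrite normrM !mxE; apply: ler_pM => //.
  by have [] := hB j t tT z zr.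
rewrite mulrDr !mulrDl; set x := A * _; set y' := m%:R * _ * _.
have : 0 <= A * l1 (u - w) by exact: mulr_ge0.
have : 0 <= m%:R * (B * r) * l1 (u - w) by exact: mulr_ge0.
have : 0 <= B * l1 (y - z) by exact: mulr_ge0.
lra.
Qed.

Lemma affine_vec_bounds p (al : 'I_p -> R -> 'cV[R]_n -> R) (be : 'I_p -> 'I_m -> R -> 'cV[R]_n -> R) :
  (forall i, tame T (al i)) -> (forall i j, tame T (be i j)) ->
  lip_on_balls (fun t y u => \col_i affine (al i) (be i) t y u).
Proof.
move=> ta tb r; have [r0|r0] := ltP r 0.
  by exists 0 => // t _ y u yr; have := le_trans (l1_ge0 _) yr; rewrite leNgt r0.
have /choice[C hC] i : exists C : R, 0 <= C /\ forall t, t \in `[0, T] -> forall y u, l1 y <= r -> l1 u <= r ->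
    `|affine (al i) (be i) t y u| <= C /\ forall z w, l1 z <= r -> l1 w <= r ->
    `|affine (al i) (be i) t y u - affine (al i) (be i) t z w| <= C * (l1 (y - z) + l1 (u - w)).
  by have [C C0 h] := affine_bounds (ta i) (tb i) r0; exists C.
exists (\sum_i C i); first by apply: sumr_ge0 => i _; have [] := hC i.
move=> t tT y u yr ur; split.
  by apply: ler_sum => i _; rewrite mxE; have [_ /(_ t tT y u yr ur)[]] := hC i.
move=> z w zr wr; rewrite mulr_suml; apply: ler_sum => i _; rewrite !mxE.
have [_ /(_ t tT y u yr ur)[_]] := hC i; exact.
Qed.

Lemma affine_measurable al be (y : R -> 'cV[R]_n) (u : R -> 'cV[R]_m) :
  tame T al -> (forall j, tame T (be j)) -> ctn 0 T y -> mf_vec 0 T u ->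
  measurable_fun (`]0, T[ : set (measurableTypeR R)) (fun t => affine al be t (y t) (u t)).
Proof.
move=> ta tb cy mu; apply: measurable_funD; first by apply: within_measurable; exact: ta.1.
apply: measurable_sum => j; apply: measurable_funM; last exact: mu.
by apply: within_measurable; exact: (tb j).1.
Qed.

Definition tameC1 (h : R -> 'cV[R]_n -> R) : Prop :=
  [/\ tame T h, forall t y, t \in `[0, T] -> differentiable (h t) y &
      forall k, tame T (fun t y => 'd (h t) y (delta_mx k ord0))].

(** The mean value theorem gives the derivative at an intermediate point; Lipschitz partial
    derivatives move it to [z] at the price of a second factor [l1 (y - z)]. *)
Lemma taylor1 h : tameC1 h -> forall r : R, exists2 C : R, 0 <= C &
  forall t, t \in `[0, T] -> forall y z, l1 y <= r -> l1 z <= r ->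
  `|h t y - h t z - \sum_k (y - z) k ord0 * 'd (h t) z (delta_mx k ord0)| <= C * l1 (y - z) ^+ 2.
Proof.
move=> [_ dh th] r; have [C C0 hC] := tame_bounds th r; exists C => // t tT y z yr zr.
have [s s01 ->] := @mvt_segment _ _ (h t) y z (fun s _ => dh t _ tT).
rewrite -sumrB (le_trans (ler_norm_sum _ _ _))//.
rewrite expr2 mulrA mulrC [l1 (y - z) in leRHS]/l1 mulr_suml.
apply: ler_sum => k _; rewrite -mulrBr normrM ler_wpM2l//.
have xr := l1_segment s01 yr zr.
have [_ /(_ z zr) hk] := hC k t tT _ xr; apply: (le_trans hk).
rewrite ler_wpM2l// [z + _]addrC addrK l1Z.
move: s01 => /andP[s0 s1].
by rewrite ger0_norm// ler_piMl// l1_ge0.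
Qed.

End affine_fields.

Section dynamics.
Context {R : realType} (n m : nat) (P : ocp R n m) (HP : standing P).
Local Notation mu := (@lebesgue_measure R).
Local Notation T := (horizon P).

Let T0 : 0 <= T. Proof. exact/ltW/(horizon_gt0 HP). Qed.

Lemma Ck2_Ck1 (V W : normedModType R) (A : set V) (h : V -> W) : Ck_on 2 A h -> Ck_on 1 A h.
Proof. by move=> [ch dh C1]; split => // v; have [] := C1 v. Qed.

Lemma Ck4_Ck2 (V W : normedModType R) (A : set V) (h : V -> W) : Ck_on 4 A h -> Ck_on 2 A h.
Proof.
move=> [ch dh C3]; split => // v; have [c3 d3 C2] := C3 v; split => // w.
by have [] := C2 w.
Qed.

Definition smooth_data : Prop :=
  (forall i, tameC1 T (fun t y => dyn P t y i ord0)) /\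
  (forall i j, tameC1 T (fun t y => ctl P t y i j)).

Lemma tameC1_coord p q (h : R -> 'cV[R]_n -> 'M[R]_(p, q)) i j :
  Ck_on 2 (`[0, T] `*` setT) (fun x : R * 'cV[R]_n => h x.1 x.2) ->
  tameC1 T (fun t y => h t y i j).
Proof.
move=> C2; have C1 := Ck2_Ck1 C2.
have uA t (y : 'cV[R]_n) : t \in `[0, T] -> (`[0, T]%classic `*` setT) (id t, y) by [].
have cid : continuous (id : R -> R) by move=> x; exact: cvg_id.
have cc := @coordl_continuous R p q i j.
have dh t (y : 'cV[R]_n) : t \in `[0, T] -> differentiable (h t) y.
  by move=> tT; have [] := slice_diff uA y tT C1.
split.
- exact: (tame_Ck1 cid uA cc C1).
- by move=> t y tT; have [] := diff_lincomp cc (dh t y tT).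
move=> k; apply: eq_tame (tame_Ck2 cid uA k cc C2) => t y tT.
by rewrite (diff_lincomp cc (dh t y tT)).2.
Qed.

Lemma smooth_of_regularity1 : regularity1 P -> smooth_data.
Proof. by move=> [Cf Cg _]; split=> *; exact: tameC1_coord. Qed.

Context (HS : smooth_data).

Definition field t (y : 'cV[R]_n) (u : 'cV[R]_m) : 'cV[R]_n := dyn P t y + ctl P t y *m u.

Lemma fieldE t (y : 'cV[R]_n) (u : 'cV[R]_m) : field t y u =
  \col_i affine (fun t y => dyn P t y i ord0) (fun j t y => ctl P t y i j) t y u.
Proof. by apply/matrixP => i k; rewrite ord1 !mxE. Qed.

Lemma tdyn i : tame T (fun t y => dyn P t y i ord0).
Proof. by have [/(_ i)[]] := HS. Qed.

Lemma tctl i j : tame T (fun t y => ctl P t y i j).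
Proof. by have [_ /(_ i j)[]] := HS. Qed.

Lemma field_lip : lip_on_balls T field.
Proof.
have -> : field = fun t y u =>
  \col_i affine (fun t y => dyn P t y i ord0) (fun j t y => ctl P t y i j) t y u.
  by do 3 apply/funext => ?; exact: fieldE.
apply: affine_vec_bounds => [i|i j]; [exact: tdyn|exact: tctl].
Qed.

Lemma field_mf (y : R -> 'cV[R]_n) (u : R -> 'cV[R]_m) : ctn 0 T y -> mf_vec 0 T u -> mf_vec 0 T (fun t => field t (y t) (u t)).
Proof.
move=> cy mu i; have -> : (fun t => field t (y t) (u t) i ord0) = fun t =>
  affine (fun t y => dyn P t y i ord0) (fun j t y => ctl P t y i j) t (y t) (u t).
  by apply/funext => t; rewrite fieldE mxE.
by apply: affine_measurable => // [|j]; [exact: tdyn|exact: tctl].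
Qed.

(** The feedback law with the gradient replaced by a free vector [q], so that the feedbacks of the
    value function and of a network can be compared through their gradients alone. *)
Definition fbk t (y : 'cV[R]_n) (q : 'cV[R]_n) : 'cV[R]_m := - (beta P)^-1 *: ((ctl P t y)^T *m q).

Lemma fbkE t (y q : 'cV[R]_n) : fbk t y q =
  \col_j affine (fun _ _ => 0) (fun i t y => - (beta P)^-1 * ctl P t y i j) t y q.
Proof.
apply/matrixP => j k; rewrite ord1 !mxE /affine add0r mulr_sumr; apply: eq_bigr => i _.
by rewrite !mxE; ring.
Qed.

Lemma tame_fbk_coef i j : tame T (fun t y => - (beta P)^-1 * ctl P t y i j).
Proof.
apply: (@tameM _ _ _ (fun _ _ => - (beta P)^-1) (fun t y => ctl P t y i j)).
  exact: tame_cst.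
exact: tctl.
Qed.

Lemma fbk_lip : lip_on_balls T fbk.
Proof.
have -> : fbk = fun t y q =>
  \col_j affine (fun _ _ => 0) (fun i t y => - (beta P)^-1 * ctl P t y i j) t y q.
  by do 3 apply/funext => ?; exact: fbkE.
apply: affine_vec_bounds => [i|i j]; [exact: tame_cst|exact: tame_fbk_coef].
Qed.

(* The matrix of the linear map [p |-> D f(y)^T p + [D g(y)^T u] p]. *)
Definition adjmx t (y : 'cV[R]_n) (u : 'cV[R]_m) : 'M[R]_n := \matrix_(k, i)
  affine (fun t y => 'd (fun z => dyn P t z i ord0 : R) y (delta_mx k ord0))
    (fun j t y => 'd (fun z => ctl P t z i j : R) y (delta_mx k ord0)) t y u.

Definition adjsrc (y : R -> 'cV[R]_n) t : 'cV[R]_n := (Q1 P)^T *m Q1 P *m (y t - yd P t).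

Lemma adjmxE (y p : R -> 'cV[R]_n) (u : R -> 'cV[R]_m) t : t \in `[0, T] ->
  (forall y, differentiable (dyn P t) y) -> (forall y, differentiable (ctl P t) y) ->
  (Jac (dyn P t) (y t))^T *m p t + ctl_adjoint P y u p t = adjmx t (y t) (u t) *m p t.
Proof.
move=> tT df dg; apply/matrixP => k l; rewrite ord1 !mxE -big_split; apply: eq_bigr => i _ /=.
rewrite !mxE /affine mulrDl; congr (_ + _).
  by rewrite -(partial_coord k i ord0 (df (y t))) partialT.
rewrite mulr_suml; apply: eq_bigr => j _; congr (_ * _ * _).
by rewrite -(partial_coord k i j (dg (y t))) partialT.
Qed.

Lemma adjmx_entry_bounds k i : forall r : R, 0 <= r -> exists2 C : R, 0 <= C &
  forall t, t \in `[0, T] -> forall y u, l1 y <= r -> l1 u <= r ->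
    `|adjmx t y u k i| <= C /\ forall z w, l1 z <= r -> l1 w <= r ->
    `|adjmx t y u k i - adjmx t z w k i| <= C * (l1 (y - z) + l1 (u - w)).
Proof.
have [Hf Hg] := HS; move=> r r0.
have [_ _ tf] := Hf i.
have tg j : tame T (fun t y => 'd (fun z => ctl P t z i j : R) y (delta_mx k ord0)).
  by have [_ _] := Hg i j.
have [C C0 hC] := affine_bounds (tf k) tg r0; exists C => // t tT y u yr ur.
have [h1 h2] := hC t tT y u yr ur; rewrite mxE; split => // z w zr wr.
by rewrite mxE; exact: h2.
Qed.

Lemma adjmx_bounds : forall r : R, 0 <= r -> exists2 C : R, 0 <= C &
  forall t, t \in `[0, T] -> forall y u, l1 y <= r -> l1 u <= r ->
    mx1 (adjmx t y u) <= C /\ forall z w, l1 z <= r -> l1 w <= r ->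
    mx1 (adjmx t y u - adjmx t z w) <= C * (l1 (y - z) + l1 (u - w)).
Proof.
move=> r r0.
have /choice[C hC] (ki : 'I_n * 'I_n) : exists C : R, 0 <= C /\
  forall t, t \in `[0, T] -> forall y u, l1 y <= r -> l1 u <= r ->
    `|adjmx t y u ki.1 ki.2| <= C /\ forall z w, l1 z <= r -> l1 w <= r ->
    `|adjmx t y u ki.1 ki.2 - adjmx t z w ki.1 ki.2| <= C * (l1 (y - z) + l1 (u - w)).
  by have [C C0 h] := adjmx_entry_bounds ki.1 ki.2 r0; exists C.
exists (\sum_k \sum_i C (k, i)).
  by apply: sumr_ge0 => k _; apply: sumr_ge0 => i _; have [] := hC (k, i).
move=> t tT y u yr ur; split.
  apply: ler_sum => k _; apply: ler_sum => i _.
  by have [_ /(_ t tT y u yr ur)[]] := hC (k, i).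
move=> z w zr wr; rewrite mulr_suml; apply: ler_sum => k _; rewrite mulr_suml; apply: ler_sum => i _.
rewrite !mxE; have [_ /(_ t tT y u yr ur)[_ /(_ z w zr wr)]] := hC (k, i).
by rewrite /= !mxE.
Qed.

Lemma adjmx_mf (y : R -> 'cV[R]_n) (u : R -> 'cV[R]_m) k i : ctn 0 T y -> mf_vec 0 T u ->
  measurable_fun (`]0, T[ : set (measurableTypeR R)) (fun t => adjmx t (y t) (u t) k i).
Proof.
have [Hf Hg] := HS; have [_ _ tf] := Hf i; move=> cy mu.
have -> : (fun t => adjmx t (y t) (u t) k i) = fun t =>
   affine (fun t y => 'd (fun z => dyn P t z i ord0 : R) y (delta_mx k ord0))
    (fun j t y => 'd (fun z => ctl P t z i j : R) y (delta_mx k ord0)) t (y t) (u t).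
  by apply/funext => t; rewrite mxE.
have tg j : tame T (fun t y => 'd (fun z => ctl P t z i j : R) y (delta_mx k ord0)).
  by have [_ _] := Hg i j.
exact: affine_measurable (tf k) tg cy mu.
Qed.

End dynamics.

Section adjoint_state.
Context {R : realType} (n m : nat) (P : ocp R n m) (HP : standing P).
Context (HS : smooth_data P).
Local Notation mu := (@lebesgue_measure R).
Local Notation T := (horizon P).

Let T0 : 0 <= T. Proof. exact/ltW/(horizon_gt0 HP). Qed.

Definition adjfield (y : R -> 'cV[R]_n) (u : R -> 'cV[R]_m) (p : R -> 'cV[R]_n) t : 'cV[R]_n :=
  adjmx P t (y t) (u t) *m p t + adjsrc P y t.

Definition adjterm (x : 'cV[R]_n) : 'cV[R]_n := (Q2 P)^T *m Q2 P *m (x - ydT P).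

(** The adjoint equation integrated backward from the horizon. It holds at every time, which
    backward Gronwall and the pointwise comparison with the gradient of the value function
    require. *)
Definition is_adjoint (y : R -> 'cV[R]_n) (u : R -> 'cV[R]_m) (p : R -> 'cV[R]_n) : Prop :=
  ctn 0 T p /\ {in `[0, T], forall t, p t = adjterm (y T) +
    \col_i vint false 0 T (fun s => adjfield y u p s i ord0) t}.

Lemma adjsrc_L2 y : ctn 0 T y -> L2 0 T (adjsrc P y).
Proof. by move=> cy; apply: L2_mulmx; apply: L2B; [exact: ctn_L2|exact: yd_L2]. Qed.

Section given_trajectory.
Context (y : R -> 'cV[R]_n) (u : R -> 'cV[R]_m) (r : R) (r0 : 0 <= r).
Context (cy : ctn 0 T y) (mfu : mf_vec 0 T u).
Context (yr : bounded_by P r y) (ur : bounded_by P r u).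

Lemma adjmx_mul_L2 p : ctn 0 T p -> L2 0 T (fun t => adjmx P t (y t) (u t) *m p t).
Proof.
move=> cp; have [C C0 hC] := adjmx_bounds HS r0; have [D D0 pD] := ctn_bounded cp.
apply: (@L2_bounded _ _ _ _ _ (C * D)).
  move=> i; have -> : (fun t => (adjmx P t (y t) (u t) *m p t) i ord0) =
      fun t => \sum_k adjmx P t (y t) (u t) i k * p t k ord0 by apply/funext => t; rewrite mxE.
  apply: measurable_sum => k; apply: measurable_funM; first exact: adjmx_mf.
  exact: ctn_mf.
move=> t /subset_itv_oo_cc tT; apply: (le_trans (l1_mulmx _ _)).
rewrite ler_pM ?mx1_ge0 ?l1_ge0// ?pD//.
by have [] := hC t tT (y t) (u t) (yr tT) (ur tT).
Qed.

Lemma adjfield_L2 p : ctn 0 T p -> L2 0 T (adjfield y u p).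
Proof.
move=> cp; have L1 := adjmx_mul_L2 cp; have L2' := adjsrc_L2 cy.
have := L2B L1 (L2Z (-1) L2').
by congr (L2 _ _ _); apply/funext => t; rewrite scaleN1r opprK.
Qed.

Lemma adjoint_exists : exists p, is_adjoint y u p.
Proof.
have [C C0 hC] := adjmx_bounds HS r0.
have [|p cp i|p q cp cq t tT|p cp pE] :=
    @picard _ false n 0 T C (fun=> adjterm (y T)) (adjfield y u) T0 C0.
- by move=> i; exact: wc_cst.
- by apply: L2_intg; exact: adjfield_L2.
- rewrite /adjfield opprD addrACA subrr addr0 -mulmxBr.
  apply: (le_trans (l1_mulmx _ _)); rewrite ler_wpM2r ?l1_ge0//.
  have tT' := subset_itv_oo_cc tT.
  by have [] := hC t tT' (y t) (u t) (yr tT') (ur tT').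
- by exists p.
Qed.

Lemma adjoint_wd p : is_adjoint y u p -> is_weak_deriv 0 T p (fun t => - adjfield y u p t).
Proof.
move=> [cp pE]; have La := adjfield_L2 cp.
have Lna : L2 0 T (fun t => - adjfield y u p t).
  have := L2Z (-1) La.
  by congr (L2 _ _ _); apply/funext => t; rewrite scaleN1r.
split => // t tT; have t0T : 0 \in `[0, T] by rewrite in_itv/= lexx T0.
have ia i : intg 0 T (fun s => adjfield y u p s i ord0) by exact: L2_intg.
rewrite (pE _ tT) (pE _ t0T); apply/matrixP => i j; rewrite ord1 !mxE /vint.
move: tT; rewrite in_itv/= => /andP[t0 tT].
rewrite (@Int_chasles _ 0 T t) ?t0//.
have -> : \int[mu]_(s in `]0, t[) (- adjfield y u p s) i ord0 = - \int[mu]_(s in `]0, t[) adjfield y u p s i ord0.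
  by rewrite -IntN; [apply: eq_Int => s _; rewrite mxE|exact: intgS (ia i)].
ring.
Qed.

Lemma adjoint_adjoint_eq p : is_adjoint y u p ->
  (forall t y, t \in `[0, T] -> differentiable (dyn P t) y) ->
  (forall t y, t \in `[0, T] -> differentiable (ctl P t) y) ->
  adjoint_eq P y u p.
Proof.
move=> ap df dg; have pw := adjoint_wd ap; split; last first.
  have [_ pE] := ap; rewrite (pE T); last by rewrite in_itv/= lexx T0.
  rewrite (_ : \col_i _ = 0) ?addr0//; apply/matrixP => i j.
  by rewrite !mxE /vint Int_empty.
apply: aeS (dot_ae pw) => t h tT; rewrite h// opprK.
have tT' := subset_itv_oo_cc tT.
by rewrite (@adjmxE _ _ _ P y p u t tT')// => z; [exact: df|exact: dg].
Qed.

End given_trajectory.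

(** The source contains [yd], so it is bounded in the mean rather than pointwise. The bound depends
    on [y] only through [r]. *)
Lemma adjsrc_intg_bound (r : R) : 0 <= r -> exists2 C : R, 0 <= C & forall y, ctn 0 T y ->
  bounded_by P r y -> \int[mu]_(t in `]0, T[) l1 (adjsrc P y t) <= C.
Proof.
move=> r0; have /L2P[myd iyd] := yd_L2 HP.
pose M := mx1 ((Q1 P)^T *m Q1 P); have M0 : 0 <= M := mx1_ge0 _.
pose g t := M * (r + n%:R * (1 + enorm (yd P t) ^+ 2)).
have ig : intg 0 T g.
  apply: intgZ; apply: intgD; first exact: intg_cst.
  by apply: intgZ; apply: intgD => //; exact: intg_cst.
exists (\int[mu]_(t in `]0, T[) g t).
  apply: Int_ge0 => t _; rewrite /g mulr_ge0// addr_ge0// mulr_ge0// addr_ge0// sqr_ge0//.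
move=> y cy yr; apply: le_Int => //.
  apply: intg_sum => i; apply: intg_norm; apply: L2_intg; exact: adjsrc_L2.
move=> t /subset_itv_oo_cc tT; apply: (le_trans (l1_mulmx _ _)); rewrite ler_wpM2l//.
apply: (le_trans (ler_l1B _ _)); rewrite lerD//; first exact: yr.
apply: (le_trans (l1_le_enorm _)); rewrite ler_wpM2l//.
by have := enorm_ge0 (yd P t); move: (enorm _) => e; nra.
Qed.

Lemma l1_vint_le (a b : R) k (h : R -> 'cV[R]_k) (g : R -> R) t : t \in `[a, b] ->
  (forall i, intg a b (fun s => h s i ord0)) -> intg a b g ->
  {in `]a, b[, forall s, l1 (h s) <= g s} ->
  l1 (\col_i vint false a b (fun s => h s i ord0) t) <= vint false a b g t.
Proof.
move=> tab ih ig hg.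
apply: (@le_trans _ _ (\sum_i vint false a b (fun s => `|h s i ord0|) t)).
  apply: ler_sum => i _; rewrite mxE; apply: norm_vint_le => //; first exact: intg_norm.
  exact: aeE.
rewrite -vint_sum//; last by move=> i; exact: intg_norm.
apply: le_vint => //; last by apply: aeE => s; exact: hg.
by apply: intg_sum => i; exact: intg_norm.
Qed.

Lemma adjoint_bounded (r : R) : 0 <= r -> exists2 C : R, 0 <= C & forall y u p,
  ctn 0 T y -> mf_vec 0 T u -> bounded_by P r y -> bounded_by P r u -> is_adjoint y u p ->
  bounded_by P C p.
Proof.
move=> r0; have [A A0 hA] := adjmx_bounds HS r0; have [B B0 hB] := adjsrc_intg_bound r0.
pose M := mx1 ((Q2 P)^T *m Q2 P); have M0 : 0 <= M := mx1_ge0 _.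
pose K := M * (r + l1 (ydT P)) + B; have K0 : 0 <= K by rewrite !(addr_ge0, mulr_ge0)// l1_ge0.
exists (2 * K * expR (2 * (A + 1) * (T - 0))); first by rewrite !mulr_ge0// expR_ge0.
move=> y u p cy mfu yr ur ap; have [cp pE] := ap.
have TT : T \in `[0, T] by rewrite in_itv/= lexx T0.
have ib : intg 0 T (fun s => l1 (adjsrc P y s)).
  apply: intg_sum => i; apply: intg_norm; apply: L2_intg; exact: adjsrc_L2.
have ip : intg 0 T (fun s => l1 (p s)) by apply: within_intg; exact: ctn_l1.
apply: (@gronwall _ false) => //; first exact: ctn_l1.
move=> t tT; rewrite {1}(pE t tT); apply: (le_trans (ler_l1D _ _)).
rewrite -addrA; apply: lerD.
  apply: (le_trans (l1_mulmx _ _)); rewrite ler_wpM2l// (le_trans (ler_l1B _ _))// lerD//.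
  exact: yr.
apply: (@le_trans _ _ (vint false 0 T (fun s => l1 (adjsrc P y s) + A * l1 (p s)) t)).
  apply: l1_vint_le => //.
  - by move=> i; apply: L2_intg; exact: (@adjfield_L2 y u r).
  - by apply: intgD => //; exact: intgZ.
  move=> s /subset_itv_oo_cc sT; rewrite addrC; apply: (le_trans (ler_l1D _ _)); rewrite lerD2r.
  apply: (le_trans (l1_mulmx _ _)); rewrite ler_wpM2r ?l1_ge0//.
  by have [] := hA s sT (y s) (u s) (yr _ sT) (ur _ sT).
rewrite vintD//; last exact: intgZ.
rewrite lerD2r; apply: le_trans (hB y cy yr).
by apply: vint_sub => // s _; exact: l1_ge0.
Qed.

(** [yd] cancels in the difference of two adjoint fields, which is therefore pointwise at most a
    multiple of [e] plus a multiple of [l1 (p - q)]; backward Gronwall closes the estimate. The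
    second conclusion controls the derivatives, as needed for continuity in the H1 norm. *)
Lemma adjoint_compare (r : R) : 0 <= r -> exists2 C : R, 0 <= C & forall e y u p z w q,
  0 <= e -> ctn 0 T y -> mf_vec 0 T u -> bounded_by P r y -> bounded_by P r u -> is_adjoint y u p ->
  ctn 0 T z -> mf_vec 0 T w -> bounded_by P r z -> bounded_by P r w -> is_adjoint z w q ->
  close_by P e y z -> close_by P e u w -> close_by P (C * e) p q /\
  {in `[0, T], forall t, l1 (adjfield y u p t - adjfield z w q t) <= C * e}.
Proof.
move=> r0; have [A A0 hA] := adjmx_bounds HS r0; have [B B0 hB] := adjoint_bounded r0.
pose M := mx1 ((Q2 P)^T *m Q2 P); have M0 : 0 <= M := mx1_ge0 _.
pose N := mx1 ((Q1 P)^T *m Q1 P); have N0 : 0 <= N := mx1_ge0 _.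
pose K := M + (A * 2 * B + N) * T; have K0 : 0 <= K by rewrite !(addr_ge0, mulr_ge0).
pose D := 2 * K * expR (2 * (A + 1) * (T - 0)).
have D0 : 0 <= D by rewrite !mulr_ge0// expR_ge0.
pose F := A * 2 * B + N; have F0 : 0 <= F by rewrite !(addr_ge0, mulr_ge0).
exists (D + (F + A * D)); first by rewrite !(addr_ge0, mulr_ge0).
move=> e y u p z w q e0 cy mfu yr ur ap cz mfw zr wr aq yz uw; have [cp pE] := ap; have [cq qE] := aq.
have qB := hB z w q cz mfw zr wr aq.
have TT : T \in `[0, T] by rewrite in_itv/= lexx T0.
have afd : {in `[0, T], forall s, l1 (adjfield y u p s - adjfield z w q s) <= F * e + A * l1 (p s - q s)}.
  move=> s sT.
  have [h1 h2] := hA s sT (y s) (u s) (yr _ sT) (ur _ sT).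
  have -> : adjfield y u p s - adjfield z w q s =
    adjmx P s (y s) (u s) *m (p s - q s) + ((adjmx P s (y s) (u s) - adjmx P s (z s) (w s)) *m q s
      + (Q1 P)^T *m Q1 P *m (y s - z s)).
    rewrite /adjfield /adjsrc mulmxBl !mulmxBr -!addrA.
    set a := _ *m p s; set b := _ *m q s; set c := _ *m q s; set d := _ *m y s; set f := _ *m yd P s; set g := _ *m z s.
    by clearbody a b c d f g; apply/matrixP => i j; rewrite !mxE; ring.
  apply: (le_trans (ler_l1D _ _)); rewrite addrC; apply: lerD; last first.
    by apply: (le_trans (l1_mulmx _ _)); rewrite ler_wpM2r ?l1_ge0.
  rewrite /F mulrDl; apply: (le_trans (ler_l1D _ _)); apply: lerD; apply: (le_trans (l1_mulmx _ _)).
    have -> : A * 2 * B * e = (A * (e + e)) * B by ring.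
    apply: ler_pM; rewrite ?mx1_ge0 ?l1_ge0//; last exact: qB.
    apply: (le_trans (h2 _ _ (zr _ sT) (wr _ sT))); rewrite ler_wpM2l// lerD//; [exact: yz|exact: uw].
  by rewrite ler_wpM2l//; exact: yz.
have pq : close_by P (D * e) p q; last first.
  split=> t tT; first by rewrite (le_trans (pq _ tT))// ler_wpM2r// lerDl addr_ge0// mulr_ge0.
  apply: (le_trans (afd _ tT)).
  have -> : (D + (F + A * D)) * e = F * e + (A * D * e + D * e) by ring.
  rewrite lerD2l; apply: (@le_trans _ _ (A * D * e)); last by rewrite lerDl mulr_ge0.
  by rewrite -mulrA ler_wpM2l//; exact: pq.
have ip : intg 0 T (fun s => l1 (p s - q s)) by apply: within_intg; apply: ctn_l1; exact: ctnB.
have -> : D * e = 2 * (K * e) * expR (2 * (A + 1) * (T - 0)) by rewrite /D; ring.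
apply: (@gronwall _ false) => //; first exact: mulr_ge0.
  by apply: ctn_l1; exact: ctnB.
have i1 i : intg 0 T (fun s => adjfield y u p s i ord0) by apply: L2_intg; exact: (@adjfield_L2 y u r).
have i2 i : intg 0 T (fun s => adjfield z w q s i ord0) by apply: L2_intg; exact: (@adjfield_L2 z w r).
move=> t tT.
have -> : p t - q t = (adjterm (y T) - adjterm (z T)) +
    \col_i vint false 0 T (fun s => (adjfield y u p s - adjfield z w q s) i ord0) t.
  rewrite (pE t tT) (qE t tT) opprD addrACA; congr (_ + _); apply/matrixP => i j; rewrite ord1 !mxE.
  by rewrite -vintB//; congr vint; apply/funext => s; rewrite !mxE.
apply: (le_trans (ler_l1D _ _)).
have i3 i : intg 0 T (fun s => (adjfield y u p s - adjfield z w q s) i ord0).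
  by apply: (eq_intg _ (intgB (i1 i) (i2 i))) => s _; rewrite !mxE.
apply: (@le_trans _ _ (M * e + vint false 0 T (fun s => F * e + A * l1 (p s - q s)) t)).
  apply: lerD.
    rewrite /adjterm -mulmxBr opprB addrA subrK.
    by apply: (le_trans (l1_mulmx _ _)); rewrite ler_wpM2l//; exact: yz.
  apply: l1_vint_le => //.
    by apply: intgD; [exact: intg_cst|exact: intgZ].
  by move=> s /subset_itv_oo_cc sT; exact: afd.
rewrite vintD//; [|exact: intg_cst|exact: intgZ].
rewrite addrA lerD2r /K [leRHS]mulrDl lerD2l.
have -> : (A * 2 * B + N) * T * e = F * e * (T - 0) by rewrite /F; ring.
by apply: vint_cst_le => //; rewrite !(addr_ge0, mulr_ge0).
Qed.

End adjoint_state.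

(** * Dynamic programming and the gradient of the value function *)

Section gluing.
Context {R : realType}.
Local Notation mu := (@lebesgue_measure R).

Definition glue A (s : R) (f g : R -> A) (t : R) : A := if t <= s then f t else g t.

Lemma intg_glue_cat (a c b : R) (h : R -> R) : a <= c -> c <= b ->
  intg a c h -> intg c b h -> intg a b h.
Proof.
move=> ac cb /integrableP[m1 l1'] /integrableP[m2 l2'].
have E : (`]a, b[%classic : set R) `<=` `]a, c] `|` `]c, b[.
  move=> x /=; rewrite !in_itv/= => /andP[ax xb]; case: (leP x c) => xc; [left|right].
    by rewrite ax.
  by rewrite xb.
have m1' : measurable_fun `]a, c] (EFin \o h) by apply/emeasurable_fun_itv_bndo_bndcP.
have mU : measurable_fun (`]a, c] `|` `]c, b[) (EFin \o h).
  by apply/measurable_funU => //; split.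
suff iU : mu.-integrable (`]a, c] `|` `]c, b[) (EFin \o h).
  by apply: integrableS iU => //; exact: measurableU.
apply/integrableP; split => //.
rewrite ge0_integral_setU//.
- rewrite lte_add_pinfty//.
  rewrite -integral_itv_bndo_bndc//.
  exact: measurableT_comp.
- exact: measurableT_comp.
- apply/disj_setPS => x [] /=; rewrite !in_itv/= => /andP[_ xc] /andP[cx _]; lra.
Qed.

Lemma glue_l A (s : R) (f g : R -> A) t : t <= s -> glue s f g t = f t.
Proof. by rewrite /glue => ->. Qed.

Lemma glue_r A (s : R) (f g : R -> A) t : s < t -> glue s f g t = g t.
Proof. by rewrite /glue leNgt => ->. Qed.

Lemma L2_glue p (a c b : R) (v w : R -> 'cV[R]_p) : a <= c -> c <= b ->
  L2 a c v -> L2 c b w -> L2 a b (glue c v w).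
Proof.
move=> ac cb Lv Lw; have /L2P[mv iv] := Lv; have /L2P[mw iw] := Lw.
have cat (h f g : R -> R) : intg a c f -> intg c b g ->
    {in `]a, c[, f =1 h} -> {in `]c, b[, g =1 h} -> intg a b h.
  move=> fi gi fh gh; apply: (@intg_glue_cat _ c) => //.
    exact: eq_intg fh fi.
  exact: eq_intg gh gi.
have lt_le x y z : x \in `]y, z[ -> (y < x) * (x <= z) :> Prop.
  by rewrite in_itv/= => /andP[? ?]; split => //; exact: ltW.
apply/L2P; split.
  move=> i; apply: intg_measurable.
  apply: (cat _ (fun t => v t i ord0) (fun t => w t i ord0)); [exact: L2_intg|exact: L2_intg| |].
    by move=> x /lt_le[_ xc]; rewrite glue_l.
  by move=> x /lt_le[cx _]; rewrite glue_r.
apply: (cat _ (fun t => enorm (v t) ^+ 2) (fun t => enorm (w t) ^+ 2)) => //.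
  by move=> x /lt_le[_ xc]; rewrite glue_l.
by move=> x /lt_le[cx _]; rewrite glue_r.
Qed.

Lemma wd_glue p (a c b : R) (y v z w : R -> 'cV[R]_p) : a <= c -> c <= b ->
  is_weak_deriv a c y v -> is_weak_deriv c b z w -> y c = z c ->
  is_weak_deriv a b (glue c y z) (glue c v w).
Proof.
move=> ac cb yv zw yz; have [Lv _] := yv; have [Lw _] := zw.
have Lg := L2_glue ac cb Lv Lw.
split => // t; rewrite in_itv/= => /andP[at_ tb]; apply/matrixP => i j; rewrite ord1 !mxE.
rewrite (@glue_l _ c y z a)//.
have vE x : a <= x -> x <= c -> \int[mu]_(s in `]a, x[) glue c v w s i ord0 = y x i ord0 - y a i ord0.
  move=> ax xc; rewrite (wd_sub i yv)//; apply: eq_Int => s; rewrite in_itv/= => /andP[_ sx].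
  by rewrite glue_l// (le_trans (ltW sx)).
case: (leP t c) => tc.
  by rewrite glue_l// vE// addrC subrK.
rewrite glue_r// (@Int_chasles _ a t c) ?ac ?(ltW tc)//; last first.
  by apply: (@intgS _ a b) => //; exact: L2_intg.
rewrite vE// (_ : \int[mu]_(s in `]c, t[) _ = z t i ord0 - z c i ord0); first by rewrite yz; ring.
rewrite (wd_sub i zw)//; last exact: ltW.
by apply: eq_Int => s; rewrite in_itv/= => /andP[cs _]; rewrite glue_r.
Qed.

Lemma wd_ae p (a b : R) (y v w : R -> 'cV[R]_p) : is_weak_deriv a b y v -> L2 a b w ->
  {ae mu, forall t, t \in `]a, b[ -> v t = w t} -> is_weak_deriv a b y w.
Proof.
move=> yv Lw vw; split => // t tab; rewrite (yv.2 t tab); congr (_ + _).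
apply/matrixP => i j; rewrite !mxE.
move: tab; rewrite in_itv/= => /andP[at_ tb]; apply: eq_Int_ae.
- by apply: (@intgS _ a b) => //; apply: L2_intg; case: yv.
- by apply: intg_measurable; apply: (@intgS _ a b) => //; exact: L2_intg.
- apply: aeS vw => s h; rewrite in_itv/= => /andP[as_ st]; rewrite h// in_itv/= as_.
  exact: lt_le_trans tb.
Qed.

(** Freezing [y] at its value at [s] extends it continuously to earlier times, so that facts about
    trajectories on the whole horizon apply to those that start at [s]. *)
Lemma ctn_max p (s T : R) (y : R -> 'cV[R]_p) : s <= T -> ctn s T y -> forall a, a <= s ->
  ctn a T (fun t => y (Num.max s t)).
Proof.
move=> sT cy a as_ i.
have /subspace_continuousP c := cy i.
apply/subspace_continuousP => t; rewrite /= in_itv/= => /andP[at_ tT].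
have mt : Num.max s t \in `[s, T] by rewrite in_itv/= le_max lexx/= ge_max sT.
have := c (Num.max s t) mt.
have cm : (fun x : R => Num.max s x) x @[x --> t] --> Num.max s t.
  apply: (@lip_continuous _ R R _ 1) => v w; rewrite mul1r.
  have := ler_norm (v - w); have := ler_norm (w - v); rewrite distrC.
  by case: (leP s v) => sv; case: (leP s w) => sw; rewrite ler_norml => *; apply/andP; split; lra.
move=> H B HB; have := cm _ (H B HB); rewrite /nbhs/= /within/= => HH.
apply: (@filterS _ (nbhs t) _ _ _ _ HH) => x {}HH; rewrite /= in_itv/= => /andP[ax xT].
by apply: HH; rewrite in_itv/= le_max lexx/= ge_max sT.
Qed.

End gluing.

Section dynamic_programming.
Context {R : realType} (n m : nat) (P : ocp R n m) (HP : standing P).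
Local Notation mu := (@lebesgue_measure R).
Local Notation T := (horizon P).

Let T0 : 0 <= T. Proof. exact/ltW/(horizon_gt0 HP). Qed.

Lemma admissible_tail (y0 : 'cV[R]_n) y u (s : R) : 0 <= s -> s <= T ->
  admissible P 0 y0 y u -> admissible P s (y s) y u.
Proof.
move=> s0 sT [Hy Lu st _]; have yv := wd_restrict s0 (lexx T) (dot_wd Hy); split => //.
- exact: wd_H1 yv.
- exact: L2S Lu.
apply: aeS (aeI (dot_ae yv) st) => t [h1 h2] tT; rewrite h1// h2//.
by move: tT; rewrite !in_itv/= => /andP[st' ->]; rewrite (le_lt_trans s0).
Qed.

Lemma admissible_glue (y0 : 'cV[R]_n) y u (s : R) z w : 0 <= s -> s < T ->
  admissible P 0 y0 y u -> admissible P s (y s) z w ->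
  admissible P 0 y0 (glue s y z) (glue s u w).
Proof.
move=> s0 sT [Hy Lu st yy0] [Hz Lw stz zs].
have yv := wd_restrict (lexx 0) (ltW sT) (dot_wd Hy).
have gv := wd_glue s0 (ltW sT) yv (dot_wd Hz) (esym zs).
split.
- exact: wd_H1 gv.
- by apply: L2_glue => //; [exact: ltW|apply: L2S Lu => //; exact: ltW].
- apply: aeS (aeI (dot_ae gv) (aeI st stz)) => t [h1 [h2 h3]] tT; rewrite h1//.
  move: (tT); rewrite in_itv/= => /andP[t0 tT'].
  case: (leP t s) => ts; first by rewrite !glue_l// h2.
  by rewrite !glue_r// h3// in_itv/= ts.
- by rewrite glue_l.
Qed.

Lemma cost_split y u (s : R) : L2 0 T y -> L2 0 T u -> 0 <= s -> s <= T ->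
  cost P 0 y u = 1 / 2 * \int[mu]_(t in `]0, s[) running P y u t + cost P s y u.
Proof.
move=> Ly Lu s0 sT; rewrite !costE (@Int_chasles _ 0 T s) ?s0//; first by ring.
exact: running_intg.
Qed.

Lemma cost_glue y u z w (s : R) : L2 0 T y -> L2 0 T u -> L2 s T z -> L2 s T w ->
  0 <= s -> s < T ->
  cost P 0 (glue s y z) (glue s u w) =
  1 / 2 * \int[mu]_(t in `]0, s[) running P y u t + cost P s z w.
Proof.
move=> Ly Lu Lz Lw s0 sT; have sT' := ltW sT.
have Lyz := L2_glue s0 sT' (L2S (lexx 0) sT' Ly) Lz.
have Luw := L2_glue s0 sT' (L2S (lexx 0) sT' Lu) Lw.
rewrite (cost_split Lyz Luw s0 sT'); congr (_ * _ + _).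
  by apply: eq_Int => t; rewrite in_itv/= => /andP[_ ts]; rewrite /running !glue_l// ltW.
rewrite !costE glue_r//; congr (_ * _ + _).
by apply: eq_Int => t; rewrite in_itv/= => /andP[st _]; rewrite /running !glue_r.
Qed.

(** Bellman's principle: a competitor on the remaining interval, glued to the optimal pair at [s],
    is admissible on the whole horizon, and the cost before [s] is common to both. *)
Lemma value_minimizer_tail (y0 : 'cV[R]_n) y u (s : R) : 0 <= s -> s < T ->
  minimizer P y0 y u -> rvalue P s (y s) = cost P s y u.
Proof.
move=> s0 sT [ay opt]; rewrite /rvalue.
suff -> : value P s (y s) = (cost P s y u)%:E by [].
have [Hy Lu _ _] := ay.
apply/eqP; rewrite eq_le; apply/andP; split.
  apply: ereal_inf_lbound; exists y, u; split => //.
  by apply: admissible_tail ay => //; exact: ltW.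
apply: le_ereal_inf_tmp => _ [z [w [az ->]]]; rewrite lee_fin.
have [Hz Lw _ _] := az.
have := opt _ _ (admissible_glue s0 sT ay az).
have Ly : L2 0 T y by apply: ctn_L2; exact: H1_ctn.
have Lz : L2 s T z by apply: ctn_L2; apply: H1_ctn => //; exact: ltW.
rewrite (cost_glue Ly Lu Lz Lw s0 sT) (cost_split Ly Lu s0 (ltW sT)).
by rewrite lerD2l.
Qed.

Lemma rvalue_le_cost (x : 'cV[R]_n) y u (s : R) : value P s x \is a fin_num ->
  admissible P s x y u -> rvalue P s x <= cost P s y u.
Proof.
move=> fv ad; rewrite -lee_fin /rvalue fineK//.
by apply: ereal_inf_lbound; exists y, u.
Qed.

End dynamic_programming.

(** Along [x + t *: v] the quadratic term is negligible as [t] tends to zero, so the derivative of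
    [h] in direction [v] is at most that of the linear form. Both sides are linear in [v], and the
    inequality for [- v] is the reverse one. *)
Lemma touching_gradient {R : realType} n (h : 'cV[R]_n -> R) (x p : 'cV[R]_n) (C d : R) :
  differentiable h x -> 0 < d -> 0 <= C ->
  (forall z, l1 (z - x) <= d -> h z - h x <= dotv p (z - x) + C * l1 (z - x) ^+ 2) ->
  forall v, 'd h x v = dotv p v.
Proof.
move=> dh d0 C0 hC.
have half v : 'd h x v <= dotv p v.
  rewrite leNgt; apply/negP => gap.
  pose g := 'd h x v - dotv p v; have g0 : 0 < g by rewrite subr_gt0.
  have l0 := l1_ge0 v.
  have e0 : 0 < g / (4 * (l1 v + 1)) by rewrite divr_gt0// mulr_gt0// ltr_wpDl.
  have [r r0 hr] := diff_ball_expansion dh e0.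
  (* The three bounds keep the test point within the range [d] of the hypothesis, within the radius
     [r] of the expansion, and make the quadratic term at most a quarter of [t * g]. The expansion
     error is another quarter, which contradicts a gap of size [t * g]. The added ones avoid zero
     denominators. *)
  pose t := Num.min (Num.min (d / (l1 v + 1)) (r / (2 * (l1 v + 1)))) (g / (4 * (C + 1) * (l1 v + 1) ^+ 2)).
  have l1p : 0 < l1 v + 1 by rewrite ltr_wpDl.
  have t0 : 0 < t.
    rewrite !lt_min !divr_gt0// ?mulr_gt0// ?exprn_gt0// ltr_wpDl//.
  have [t1 t2 t3] : [/\ t <= d / (l1 v + 1), t <= r / (2 * (l1 v + 1)) &
      t <= g / (4 * (C + 1) * (l1 v + 1) ^+ 2)].
    by rewrite !ge_min !lexx ?orbT.
  have tv : t * l1 v <= t * (l1 v + 1) by rewrite ler_wpM2l ?(ltW t0)// lerDl.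
  have zd : l1 (x + t *: v - x) = t * l1 v by rewrite [x + _]addrC addrK l1Z gtr0_norm.
  have H1 := hC (x + t *: v).
  rewrite zd in H1.
  have {}H1 : h (x + t *: v) - h x <= dotv p (t *: v) + C * (t * l1 v) ^+ 2.
    have := H1; rewrite [x + _]addrC addrK; apply.
    by apply: (le_trans tv); rewrite -ler_pdivlMr.
  have nz : `|x + t *: v - x| <= t * l1 v by rewrite -zd norm_le_l1.
  have : `|x + t *: v - x| < r.
    rewrite (le_lt_trans nz)// (le_lt_trans tv)//.
    rewrite (@le_lt_trans _ _ (r / 2))//; last by rewrite ltr_pdivrMr// ltr_pMr// ltr1n.
    move: t2; rewrite invfM mulrA ler_pdivlMr//.
  move=> /hr /= H2.
  have {}H2 : t * 'd h x v - (h (x + t *: v) - h x) <= g / (4 * (l1 v + 1)) * (t * l1 v).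
    have E : 'd h x (x + t *: v - x) = t * 'd h x v by rewrite [x + _]addrC addrK linearZ.
    rewrite E in H2.
    apply: (@le_trans _ _ (g / (4 * (l1 v + 1)) * `|x + t *: v - x|)).
      by apply: le_trans H2; rewrite distrC ler_norm.
    by rewrite ler_wpM2l// ltW.
  have D : dotv p (t *: v) = t * dotv p v by rewrite dotvC dotvZl dotvC.
  rewrite D in H1.
  have h3 : g / (4 * (l1 v + 1)) * (t * l1 v) <= t * g / 4.
    have -> : g / (4 * (l1 v + 1)) * (t * l1 v) = (t * g / 4) * (l1 v / (l1 v + 1)) by field; rewrite gt_eqF.
    rewrite ler_piMr ?divr_ge0 ?mulr_ge0 ?(ltW t0) ?(ltW g0)//.
    by rewrite ler_pdivrMr// mul1r lerDl.
  have h4 : C * (t * l1 v) ^+ 2 <= t * g / 4.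
    have : C * (t * l1 v) ^+ 2 <= (C + 1) * (t * (l1 v + 1)) ^+ 2.
      rewrite ler_pM// ?sqr_ge0// ?lerDl// ler_pXn2r// nnegrE mulr_ge0 ?(ltW t0)// ltW//.
    move=> /le_trans; apply.
    have -> : (C + 1) * (t * (l1 v + 1)) ^+ 2 = t * (t * ((C + 1) * (l1 v + 1) ^+ 2)) by ring.
    rewrite -mulrA ler_wpM2l ?(ltW t0)//.
    move: t3; rewrite ler_pdivlMr ?mulr_gt0 ?exprn_gt0 ?ltr_wpDl// => t3.
    by rewrite ler_pdivlMr//; apply: le_trans t3; rewrite le_eqVlt; apply/orP; left; apply/eqP; ring.
  have : t * g <= t * g / 4 + t * g / 4.
    have : t * g = t * 'd h x v - t * dotv p v by rewrite /g mulrBr.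
    move: (t * g) (t * 'd h x v) (t * dotv p v) H1 H2 h3 h4 => a b c; lra.
  have : 0 < t * g by exact: mulr_gt0.
  lra.
move=> v; apply/eqP; rewrite eq_le half/=.
by have := half (- v); rewrite linearN dotvNr lerN2.
Qed.

Section value_gradient.
Context {R : realType} (n m : nat) (P : ocp R n m) (HP : standing P).
Context (HS : smooth_data P).
Local Notation mu := (@lebesgue_measure R).
Local Notation T := (horizon P).

Let T0 : 0 <= T. Proof. exact/ltW/(horizon_gt0 HP). Qed.

Context (x : R -> 'cV[R]_n) (u : R -> 'cV[R]_m) (rho r : R).
Context (rho0 : 0 < rho) (r0 : 0 <= r).
Context (mfu : mf_vec 0 T u) (ur : bounded_by P r u).
Context (xw : is_weak_deriv 0 T x (fun t => field P t (x t) (u t))).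
Context (xrho : {in `[0, T], forall t, enorm (x t) <= rho}).
Context (s : R) (s0 : 0 <= s) (sT : s < T).

Let sT' : s <= T. Proof. exact: ltW. Qed.

Let sub t : t \in `[s, T] -> t \in `[0, T].
Proof. by rewrite !in_itv/= => /andP[st ->]; rewrite (le_trans s0). Qed.

(** The control stays frozen, so only the state is perturbed and the deviation is governed by the
    initial gap alone. [K] and [d] do not depend on [z]. *)
Lemma open_loop_nearby : exists2 K : R, 0 <= K & exists2 d : R, 0 < d &
  forall z, l1 (z - x s) <= d -> exists y, [/\ is_weak_deriv s T y (fun t => field P t (y t) (u t)),
    y s = z, {in `[s, T], forall t, enorm (y t) <= rho + rho} &
    {in `[s, T], forall t, l1 (y t - x t) <= K * l1 (z - x s)}].
Proof.
pose rr := n%:R * (rho + rho) + r.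
have n0 : 0 <= n%:R * (rho + rho) by rewrite mulr_ge0// addr_ge0// ltW.
have rr0 : 0 <= rr by rewrite addr_ge0.
have r2 : 0 < rho + rho by rewrite addr_gt0.
have [C C0 hC] := field_lip HS rr.
pose G t y := field P t y (u t).
have bl (z : 'cV[R]_n) : enorm z <= rho + rho -> l1 z <= rr.
  move=> zr; apply: (le_trans (l1_le_enorm _)); rewrite (@le_trans _ _ (n%:R * (rho + rho)))//.
    by rewrite ler_wpM2l.
  by rewrite lerDl.
have ul t : t \in `[0, T] -> l1 (u t) <= rr by move=> tT; rewrite (le_trans (ur tT))// lerDr.
have iG y : ctn s T y -> forall i, intg s T (fun t => G t (y t) i ord0).
  move=> cy i; have cY := ctn_max sT' cy s0.
  have mY := field_mf HS cY mfu i.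
  have [D _ YD] := ctn_bounded cY.
  have [C' _ hC'] := field_lip HS (D + r).
  have iY : intg 0 T (fun t => field P t (y (Num.max s t)) (u t) i ord0).
    apply: (@intg_bounded _ _ _ _ C') => //.
    move=> t /subset_itv_oo_cc tT; apply: (le_trans (l1_coord _ i)).
    have YDt : l1 (y (Num.max s t)) <= D + r by rewrite (le_trans (YD _ tT))// lerDl.
    have uDt : l1 (u t) <= D + r.
      by rewrite (le_trans (ur tT))// lerDr (le_trans _ (YD _ tT))// l1_ge0.
    by have [] := hC' t tT _ (u t) YDt uDt.
  apply: (@eq_intg _ _ _ (fun t => field P t (y (Num.max s t)) (u t) i ord0)).
    by move=> t; rewrite in_itv/= => /andP[st _]; rewrite /G max_r// ltW.
  exact: (intgS s0 (lexx T) iY).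
have GL t : t \in `]s, T[ -> forall y z, enorm y <= rho + rho -> enorm z <= rho + rho ->
    l1 (G t y - G t z) <= C * l1 (y - z).
  move=> /subset_itv_oo_cc/sub tT y z /bl yr /bl zr.
  have [_ h] := hC t tT y (u t) yr (ul t tT); have := h z (u t) zr (ul t tT).
  by rewrite subrr l10 addr0.
pose K := 2 * expR (2 * (C * (2 * n%:R) + 1) * (T - s)).
have K0 : 0 < K by rewrite mulr_gt0// expR_gt0.
exists K; first exact: ltW.
(* With this radius the perturbed trajectory stays within [rho] of [x], hence in the ball of radius
   [rho + rho] where the truncation is inactive. *)
exists (rho / K); first exact: divr_gt0.
move=> z zd; have [y cy yE] := trunc_ode_exists sT' r2 C0 iG GL z.
have ss : s \in `[s, T] by rewrite in_itv/= lexx.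
have ys : y s = z.
  rewrite (yE s ss) (_ : \col_i _ = 0) ?addr0//; apply/matrixP => i j.
  by rewrite !mxE Int_empty.
have yE' : {in `[s, T], forall t, y t = y s + \col_i \int[mu]_(q in `]s, t[) G q (rtrunc (rho + rho) (y q)) i ord0}.
  by move=> t tT; rewrite ys; exact: yE.
have xws := wd_restrict s0 (lexx T) xw.
have yx : {in `[s, T], forall t, l1 (y t - x t) <= K * l1 (z - x s)}.
  move=> t tT.
  have := trunc_ode_compare sT' r2 C0 iG GL (l1_ge0 (z - x s)) (lexx 0) cy yE' xws _ _ tT.
  rewrite mul0r addr0 ys => /(_ (lexx _)) H.
  have -> : K * l1 (z - x s) = 2 * l1 (z - x s) * expR (2 * (C * (2 * n%:R) + 1) * (T - s)).
    by rewrite /K; ring.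
  apply: H; apply: aeE => q /subset_itv_oo_cc/sub qT.
  rewrite rtrunc_id//; first by rewrite subrr l10.
  by rewrite (le_trans (xrho qT))// lerDl ltW.
have yr : {in `[s, T], forall t, enorm (y t) <= rho + rho}.
  move=> t tT; apply: (le_trans (ler_enorm_sub _ (x t))); apply: lerD; first exact/xrho/sub.
  apply: (le_trans (enorm_le_l1 _)); apply: (le_trans (yx _ tT)).
  by rewrite mulrC -ler_pdivlMr.
have GC : {in `]s, T[, forall t, forall z, enorm z <= rho + rho -> l1 (G t z) <= C}.
  move=> t /subset_itv_oo_cc/sub tT q qr.
  by have [] := hC t tT q (u t) (bl _ qr) (ul _ tT).
have yw := untruncated_wd r2 iG cy yE' yr GC.
by exists y; split; [exact: yw|exact: ys|exact: yr|exact: yx].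
Qed.

(** The linear part is the transpose of [adjmx]; this duality makes the adjoint equation cancel the
    linearized dynamics. The control has no increment, and its bound [r] multiplies the remainders
    of the entries of [ctl]. *)
Lemma field_taylor (r1 : R) : 0 <= r1 -> exists2 C : R, 0 <= C &
  forall t, t \in `[0, T] -> forall y z, l1 y <= r1 -> l1 z <= r1 ->
  l1 (field P t y (u t) - field P t z (u t) - (adjmx P t z (u t))^T *m (y - z)) <= C * l1 (y - z) ^+ 2.
Proof.
move=> r10.
have [Hf Hg] := HS.
have /choice[Cf hCf] i : exists C : R, 0 <= C /\ forall t, t \in `[0, T] ->
    forall y z, l1 y <= r1 -> l1 z <= r1 ->
  `|dyn P t y i ord0 - dyn P t z i ord0 - \sum_k (y - z) k ord0 *
     'd (fun z => dyn P t z i ord0 : R) z (delta_mx k ord0)| <= C * l1 (y - z) ^+ 2.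
  by have [C C0 h] := taylor1 (Hf i) r1; exists C.
have /choice[Cg hCg] (ij : 'I_n * 'I_m) : exists C : R, 0 <= C /\ forall t, t \in `[0, T] ->
    forall y z, l1 y <= r1 -> l1 z <= r1 ->
  `|ctl P t y ij.1 ij.2 - ctl P t z ij.1 ij.2 - \sum_k (y - z) k ord0 *
     'd (fun z => ctl P t z ij.1 ij.2 : R) z (delta_mx k ord0)| <= C * l1 (y - z) ^+ 2.
  by have [C C0 h] := taylor1 (Hg ij.1 ij.2) r1; exists C.
exists (\sum_i (Cf i + \sum_j Cg (i, j) * r)).
  apply: sumr_ge0 => i _; apply: addr_ge0; first by have [] := hCf i.
  by apply: sumr_ge0 => j _; rewrite mulr_ge0//; have [] := hCg (i, j).
move=> t tT y z yr zr; rewrite mulr_suml; apply: ler_sum => i _.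
set F := dyn P t y i ord0 - dyn P t z i ord0 - \sum_k (y - z) k ord0 *
     'd (fun z => dyn P t z i ord0 : R) z (delta_mx k ord0).
pose Gj j := ctl P t y i j - ctl P t z i j - \sum_k (y - z) k ord0 *
     'd (fun z => ctl P t z i j : R) z (delta_mx k ord0).
have -> : (field P t y (u t) - field P t z (u t) - (adjmx P t z (u t))^T *m (y - z)) i ord0 =
    F + \sum_j Gj j * u t j ord0.
  have -> : \sum_j Gj j * u t j ord0 = \sum_j ctl P t y i j * u t j ord0 -
    \sum_j ctl P t z i j * u t j ord0 - \sum_k \sum_j (y - z) k ord0 *
     'd (fun z => ctl P t z i j : R) z (delta_mx k ord0) * u t j ord0.
    rewrite [in RHS]exchange_big /= -!sumrB; apply: eq_bigr => j _.
    by rewrite /Gj !mulrBl mulr_suml.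
  rewrite /F !fieldE !mxE /affine.
  have -> : \sum_k (adjmx P t z (u t))^T i k * (y - z) k ord0 =
    \sum_k (y - z) k ord0 * 'd (fun z => dyn P t z i ord0 : R) z (delta_mx k ord0) +
    \sum_k \sum_j (y - z) k ord0 *
     'd (fun z => ctl P t z i j : R) z (delta_mx k ord0) * u t j ord0.
    rewrite -big_split; apply: eq_bigr => k _ /=.
    rewrite mxE mxE /affine mulrDl [X in X + _]mulrC; congr (_ + _).
    rewrite mulr_suml; apply: eq_bigr => j _.
    by rewrite mulrC mulrA.
  set a := \sum_j _; set b := \sum_j _; set c := \sum_k _; set d := \sum_k _.
  ring.
apply: (le_trans (ler_normD _ _)); rewrite mulrDl; apply: lerD.
  by have [_ h] := hCf i; exact: h.
apply: (le_trans (ler_norm_sum _ _ _)); rewrite mulr_suml; apply: ler_sum => j _.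
rewrite normrM mulrAC; apply: ler_pM => //.
  by have [_ h] := hCg (i, j); exact: h.
exact: le_trans (l1_coord (u t) j) (ur tT).
Qed.

Lemma intgM_within (a b : R) (f g : R -> R) : intg a b f -> {within `[a, b], continuous g} ->
  intg a b (fun t => f t * g t).
Proof.
move=> fi gc; have [C gC] := within_bounded gc.
apply: (@intg_dom _ _ _ _ (fun t => C * `|f t|)).
- by apply: measurable_funM; [exact: intg_measurable fi|exact: within_measurable].
- move=> t /subset_itv_oo_cc tab; rewrite normrM mulrC ler_wpM2r//; exact: gC.
- by apply: intgZ; apply: intg_norm.
Qed.

Lemma dotv_intg (a b : R) (v w : R -> 'cV[R]_n) : L2 a b v -> ctn a b w ->
  intg a b (fun t => dotv (v t) (w t)).
Proof.
by move=> Lv cw; apply: intg_sum => i; apply: intgM_within; [exact: L2_intg|exact: cw].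
Qed.

Lemma dotv_by_parts (a b : R) (y v z w : R -> 'cV[R]_n) : a <= b ->
  is_weak_deriv a b y v -> is_weak_deriv a b z w ->
  dotv (y b) (z b) - dotv (y a) (z a) =
  \int[mu]_(t in `]a, b[) (dotv (v t) (z t) + dotv (y t) (w t)).
Proof.
move=> ab yv zw; have [Lv _] := yv; have [Lw _] := zw.
have cy := wd_ctn ab yv; have cz := wd_ctn ab zw.
transitivity (\int[mu]_(t in `]a, b[) (\sum_i (v t i ord0 * z t i ord0 + y t i ord0 * w t i ord0))).
  rewrite Int_sum; last first.
    move=> i; apply: intgD; first by apply: intgM_within; [exact: L2_intg|exact: cz].
    apply: (@eq_intg _ _ _ (fun t => w t i ord0 * y t i ord0)); first by move=> t _; rewrite mulrC.
    by apply: intgM_within; [exact: L2_intg|exact: cy].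
  rewrite /dotv -sumrB; apply: eq_bigr => i _.
  by apply: Int_by_parts => //; [exact: L2_intg|exact: L2_intg|exact: wdE yv|exact: wdE zw].
by apply: eq_Int => t _; rewrite big_split.
Qed.

Lemma sqr_enormD p (a c : 'cV[R]_p) :
  enorm (a + c) ^+ 2 = enorm a ^+ 2 + 2 * dotv a c + enorm c ^+ 2.
Proof. rewrite !sqr_enorm dotvDl !dotvDr (dotvC c a); ring. Qed.

Lemma enorm_mulmx_sqr p q (Q : 'M[R]_(p, q)) (v : 'cV[R]_q) :
  enorm (Q *m v) ^+ 2 <= mx1 Q ^+ 2 * l1 v ^+ 2.
Proof.
rewrite -exprMn ler_pXn2r ?nnegrE ?enorm_ge0 ?mulr_ge0 ?mx1_ge0 ?l1_ge0//.
exact: le_trans (enorm_le_l1 _) (l1_mulmx _ _).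
Qed.

Lemma half_sqr_mulmx p q (Q : 'M[R]_(p, q)) (v : 'cV[R]_q) (X : R) : l1 v ^+ 2 <= X ->
  1 / 2 * enorm (Q *m v) ^+ 2 <= mx1 Q ^+ 2 / 2 * X.
Proof.
move=> vX; have h1 := enorm_mulmx_sqr Q v.
have h2 : mx1 Q ^+ 2 * l1 v ^+ 2 <= mx1 Q ^+ 2 * X by rewrite ler_wpM2l// sqr_ge0.
by rewrite mulrAC; lra.
Qed.

Lemma quadratic_expansion p q (Q : 'M[R]_(p, q)) (a d : 'cV[R]_q) :
  1 / 2 * enorm (Q *m (a + d)) ^+ 2 - 1 / 2 * enorm (Q *m a) ^+ 2 - dotv (Q^T *m Q *m a) d =
  1 / 2 * enorm (Q *m d) ^+ 2.
Proof. by rewrite mulmxDr sqr_enormD -mulmxA dotv_trmx; field. Qed.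

Context (y0 : 'cV[R]_n) (xopt : minimizer P y0 x u).
Context (fv : forall z, enorm z <= rho + rho -> value P s z \is a fin_num).
Context (p : R -> 'cV[R]_n) (ap : is_adjoint P x u p).

(** Let [y] start at [z] under the control of [x]. Integrating [dotv p (y - x)] by parts and
    inserting the adjoint equation with its terminal condition removes from the cost difference
    every term linear in [y - x], except [dotv (p s) (z - x s)]. The rest is quadratic in the
    initial gap, which is the hypothesis of [touching_gradient]. *)
Lemma value_gradient : differentiable (rvalue P s) (x s) ->
  forall v, 'd (rvalue P s) (x s) v = dotv (p s) v.
Proof.
move=> dV.
have [K K0 [d d0 near_x]] := open_loop_nearby.
have cx := wd_ctn T0 xw.
have n0 : 0 <= n%:R * (rho + rho) by rewrite mulr_ge0// addr_ge0// ltW.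
have [C C0 hC] := field_taylor n0.
have [cp _] := ap.
have [B B0 pB] := ctn_bounded cp.
have bl (z : 'cV[R]_n) : enorm z <= rho + rho -> l1 z <= n%:R * (rho + rho).
  by move=> zr; apply: (le_trans (l1_le_enorm _)); rewrite ler_wpM2l.
have xl t : t \in `[0, T] -> l1 (x t) <= n%:R * (rho + rho).
  by move=> tT; apply: bl; rewrite (le_trans (xrho tT))// lerDl ltW.
have xb : bounded_by P (n%:R * (rho + rho) + r) x by move=> t tT; rewrite (le_trans (xl _ tT))// lerDl.
have ub : bounded_by P (n%:R * (rho + rho) + r) u by move=> t tT; rewrite (le_trans (ur tT))// lerDr.
have rr0 : 0 <= n%:R * (rho + rho) + r by exact: addr_ge0.
have pw := wd_restrict s0 (lexx T) (adjoint_wd HP HS rr0 cx mfu xb ub ap).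
pose q1 := mx1 (Q1 P) ^+ 2; pose q2 := mx1 (Q2 P) ^+ 2.
have q10 : 0 <= q1 by exact: sqr_ge0.
have q20 : 0 <= q2 by exact: sqr_ge0.
(* The quadratic remainders of the running cost ([q1]), of the dynamics paired with [p] ([B * C])
   and of the terminal cost ([q2]); [K ^+ 2] converts the gap at later times into the initial
   gap. *)
pose D := ((q1 / 2 + B * C) * (T - s) + q2 / 2) * K ^+ 2.
have D1 : 0 <= q1 / 2 + B * C.
  by apply: addr_ge0; [exact: divr_ge0|exact: mulr_ge0].
have D0 : 0 <= D.
  apply: mulr_ge0; last exact: sqr_ge0.
  apply: addr_ge0; last exact: divr_ge0.
  by apply: mulr_ge0 => //; rewrite subr_ge0.
(* [d] provides the nearby trajectory, and [rho] keeps [z] in the ball where the value is finite. *)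
have m0 : 0 < Num.min d rho by rewrite lt_min d0.
apply: (touching_gradient dV m0 D0) => z; rewrite le_min => /andP[zd zrho].
have [y [yw ys yr yx]] := near_x z zd.
have cy := wd_ctn sT' yw.
have zr : enorm z <= rho + rho.
  rewrite (le_trans (ler_enorm_sub _ (x s)))// lerD//.
    by apply: xrho; rewrite in_itv/= s0.
  exact: le_trans (enorm_le_l1 _) zrho.
have Lu : L2 0 T u by have [[_ Lu _ _] _] := xopt.
have Lus : L2 s T u by exact: L2S Lu.
have Ly : L2 s T y by exact: ctn_L2.
have Lx : L2 s T x by apply: (L2S s0 (lexx T)); exact: ctn_L2.
have ady : admissible P s z y u.
  split => //; first exact: wd_H1 yw.
  by apply: aeS (dot_ae yw) => t h tT; rewrite h.
have := rvalue_le_cost (fv zr) ady.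
rewrite (value_minimizer_tail HP s0 sT xopt) => Vz.
apply: (le_trans (lerB Vz (lexx _))).
rewrite -lerBlDl.
pose l := l1 (z - x s).
have l0 : 0 <= l := l1_ge0 _.
have xws := wd_restrict s0 (lexx T) xw.
have dw := wdB yw xws.
have cd := ctnB cy (wd_ctn sT' xws).
have cps := wd_ctn sT' pw.
have parts := dotv_by_parts sT' pw dw.
have TT : T \in `[s, T] by rewrite in_itv/= sT' lexx.
have pT : p T = (Q2 P)^T *m Q2 P *m (x T - ydT P).
  have [_ pE] := ap; rewrite (pE T); last by rewrite in_itv/= lexx T0.
  rewrite (_ : \col_i _ = 0) ?addr0//; apply/matrixP => i j.
  by rewrite !mxE /vint Int_empty.
have iry := running_intg_sub HP s0 (lexx T) Ly Lus.
have irx := running_intg_sub HP s0 (lexx T) Lx Lus.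
have [Lna _] := pw; have [Ldw _] := dw.
have i1 : intg s T (fun t => dotv (- adjfield P x u p t) (y t - x t)) by exact: dotv_intg.
have i2 : intg s T (fun t => dotv (p t) (field P t (y t) (u t) - field P t (x t) (u t))).
  apply: (@eq_intg _ _ _ (fun t => dotv (field P t (y t) (u t) - field P t (x t) (u t)) (p t))).
    by move=> t _; rewrite dotvC.
  exact: dotv_intg.
pose h t := 1 / 2 * (running P y u t - running P x u t) +
  (dotv (- adjfield P x u p t) (y t - x t) +
   dotv (p t) (field P t (y t) (u t) - field P t (x t) (u t))).
have ih : intg s T h by apply: intgD; [apply: intgZ; exact: intgB|exact: intgD].
(* The integration by parts is added in the form of its integrand, which is part of [h], and its two
   boundary terms: the one at [s] is the linear term on the left, the one at [T] is matched with the
   terminal cost. *)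
have E : cost P s y u - cost P s x u - dotv (p s) (z - x s) =
   \int[mu]_(t in `]s, T[) h t + (terminal_cost P (y T) - terminal_cost P (x T) - dotv (p T) (y T - x T)).
  rewrite /h IntD; [|by apply: intgZ; exact: intgB|exact: intgD].
  rewrite -parts IntZ; last exact: intgB.
  have gen (i j a b c d' : R) : 1 / 2 * i + a - (1 / 2 * j + b) - d' =
    1 / 2 * (i - j) + (c - d') + (a - b - c) by ring.
  by rewrite IntB// !costE ys; exact: gen.
rewrite E.
have kl t : t \in `[s, T] -> l1 (y t - x t) ^+ 2 <= K ^+ 2 * l ^+ 2.
  move=> tT; rewrite -exprMn ler_pXn2r ?nnegrE ?l1_ge0 ?mulr_ge0//; exact: yx.
have hT : terminal_cost P (y T) - terminal_cost P (x T) - dotv (p T) (y T - x T) <=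
    q2 / 2 * (K ^+ 2 * l ^+ 2).
  rewrite /terminal_cost pT.
  have := quadratic_expansion (Q2 P) (x T - ydT P) (y T - x T).
  have -> : x T - ydT P + (y T - x T) = y T - ydT P by rewrite addrC addrA subrK.
  by move=> ->; apply: half_sqr_mulmx; exact: kl.
have hh t : t \in `]s, T[ -> h t <= (q1 / 2 + B * C) * (K ^+ 2 * l ^+ 2).
  move=> /subset_itv_oo_cc tT; have tT' := sub tT.
  (* The source of the adjoint equation cancels the linear part of the tracking cost, its matrix
     cancels the linear part of the field, and the control costs agree. *)
  have -> : h t = 1 / 2 * enorm (Q1 P *m (y t - x t)) ^+ 2 +
      dotv (p t) (field P t (y t) (u t) - field P t (x t) (u t) - (adjmx P t (x t) (u t))^T *m (y t - x t)).
    have := quadratic_expansion (Q1 P) (x t - yd P t) (y t - x t).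
    have -> : x t - yd P t + (y t - x t) = y t - yd P t by rewrite addrC addrA subrK.
    move=> <-; rewrite /h /running /adjfield /adjsrc.
    move: (field P t (y t) (u t) - field P t (x t) (u t)) => w.
    have hA : dotv (p t) (w - (adjmx P t (x t) (u t))^T *m (y t - x t)) =
        dotv (p t) w - dotv (adjmx P t (x t) (u t) *m p t) (y t - x t).
      by rewrite dotvDr dotvNr -dotv_trmx trmxK.
    rewrite hA dotvNl [dotv (_ + _) _]dotvDl.
    have gen (i j k a b c : R) : 1 / 2 * (i + k - (j + k)) + (- (a + b) + c) =
      1 / 2 * i - 1 / 2 * j - b + (c - a) by ring.
    exact: gen.
  rewrite mulrDl; apply: lerD.
    by apply: half_sqr_mulmx; exact: kl.
  apply: (le_trans (ler_norm _)); apply: (le_trans (ler_dotv _ _)).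
  rewrite -mulrA; apply: ler_pM; rewrite ?l1_ge0//; first exact: pB.
  have yl : l1 (y t) <= n%:R * (rho + rho) by apply/bl/yr.
  apply: (le_trans (hC t tT' _ _ yl (xl _ tT'))).
  by rewrite ler_wpM2l//; exact: kl.
have : \int[mu]_(t in `]s, T[) h t <= \int[mu]_(t in `]s, T[) ((q1 / 2 + B * C) * (K ^+ 2 * l ^+ 2)).
  by apply: le_Int => //; exact: intg_cst.
rewrite Int_cst// => hI.
apply: (le_trans (lerD hI hT)).
rewrite le_eqVlt; apply/orP; left; apply/eqP; rewrite /D -/l; ring.
Qed.

End value_gradient.

(** * The value function and its approximants *)

Lemma grad_interior (R : realType) n (A : set 'cV[R]_n) (h : 'cV[R]_n -> R) (y : 'cV[R]_n) :
  A° y -> grad A h y = \col_k 'd h y (delta_mx k ord0).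
Proof. by move=> Ay; apply: eq_mx => k j; exact: partial_interior. Qed.

Section value_function.
Context {R : realType} (n m : nat) (P : ocp R n m) (HP : standing P) (n_gt0 : (0 < n)%N).
Context (M : R) (M_gt0 : 0 < M) (HS : smooth_data P) (HV : regularity2 P M).
Local Notation T := (horizon P).
Local Notation rho := (Mhat P M).
Local Notation K := (value_ball P M).

Let T0 : 0 <= T. Proof. exact/ltW/(horizon_gt0 HP). Qed.

Lemma Mhat_gt0 : 0 < rho.
Proof. by rewrite mulr_gt0// embedding_gt0// horizon_gt0. Qed.

Lemma value_ball_interior (y : 'cV[R]_n) : enorm y < 2 * rho -> K° y.
Proof.
move=> yr; apply/nbhs_ballP; pose e := (2 * rho - enorm y) / (n%:R + 1).
have n1 : 0 < n%:R + 1 :> R by rewrite ltr_wpDl.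
exists e; first by rewrite /= divr_gt0// subr_gt0.
move=> z; rewrite -ball_normE /ball_/= => yz; rewrite /value_ball /eball /=.
apply: (le_trans (ler_enorm_sub _ y)); rewrite -lerBrDl.
apply: (le_trans (enorm_le_l1 _)); apply: (le_trans (l1_le_norm _)).
rewrite distrC; apply: (@le_trans _ _ ((n%:R + 1) * e)).
  by apply: ler_pM => //; [rewrite lerDl|exact: ltW].
by rewrite mulrC divfK// gt_eqF.
Qed.

Lemma rvalue_differentiable t (y : 'cV[R]_n) : t \in `[0, T] -> enorm y < 2 * rho ->
  differentiable (rvalue P t) y.
Proof.
move=> tT yr; have [_ C2 _] := HV; have [_ dV _] := C2.
have Ky : \forall z \near y, (`[0, T]%classic `*` K) (t, z).
  by have := value_ball_interior yr; apply: filterS => z Kz; split.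
by have [] := slice_pair Ky (dV (t, y) (nbhs_singleton Ky)).
Qed.

(** The ordinary gradient. On the open ball it agrees with the gradient relative to the closed ball,
    in which the assumptions are stated. *)
Definition gradV t (y : 'cV[R]_n) : 'cV[R]_n := \col_k 'd (rvalue P t) y (delta_mx k ord0).

Lemma gradVE t (y : 'cV[R]_n) : enorm y < 2 * rho -> grad K (rvalue P t) y = gradV t y.
Proof.
by move=> yr; apply: grad_interior; exact: value_ball_interior.
Qed.

Lemma gradV_lipschitz : exists2 L : R, 0 <= L & forall t, t \in `[0, T] -> forall y z : 'cV[R]_n,
  enorm y < 2 * rho -> enorm z < 2 * rho -> l1 (gradV t y - gradV t z) <= L * l1 (y - z).
Proof.
have [_ _ [L hL]] := HV; exists (n%:R * `|L|); first by rewrite mulr_ge0.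
move=> t tT y z yr zr.
rewrite -mulrA mulr_natl -[n in _ *+ n]card_ord -sumr_const; apply: ler_sum => k _.
have [h _] := hL t tT y z (ltW yr) (ltW zr) k k.
have Ek x : gradV t x k ord0 = 'd (rvalue P t) x (delta_mx k ord0) by rewrite mxE.
have -> : (gradV t y - gradV t z) k ord0 = gradV t y k ord0 - gradV t z k ord0.
  by rewrite mxE [X in _ + X]mxE.
have Ep x : enorm x < 2 * rho -> partial K (rvalue P t) x k = gradV t x k ord0.
  by move=> xr; rewrite Ek; exact: (partial_interior (rvalue P t) k (value_ball_interior xr)).
rewrite (Ep y yr) (Ep z zr) in h.
apply: (le_trans h); apply: (@le_trans _ _ (`|L| * enorm (y - z))).
  by rewrite ler_wpM2r ?enorm_ge0// ler_norm.
by rewrite ler_wpM2l// enorm_le_l1.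
Qed.

Section approximant.
Context (eps0 : R) (eps0_gt0 : 0 < eps0) (N : R -> nat)
  (ip : forall e, 'cV[R]_(N e) -> 'cV[R]_(N e) -> R)
  (V : forall e, 'cV[R]_(N e) -> R -> 'cV[R]_n -> R) (theta : forall e, 'cV[R]_(N e))
  (HA : approximation_assumption P M eps0 ip V theta).

Lemma approximant_tameC1 e (th : 'cV[R]_(N e)) : 0 < e <= eps0 -> tameC1 T (V th).
Proof.
move=> ee; have [/(_ e ee)[_ C4 _] _] := HA.
have C2 := Ck4_Ck2 C4; have C1 := Ck2_Ck1 C2.
pose u (t : R) : 'cV[R]_(N e) * R := (th, t).
have cu : continuous u.
  by move=> t; apply: (@cvg_pair _ _ _ (nbhs t) (nbhs th) (nbhs t) _ _ _ (fun=> th) idfun);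
    [exact: cvg_cst|exact: cvg_id].
have uA t (y : 'cV[R]_n) : t \in `[0, T] -> setT (u t, y) by [].
have cid : continuous (idfun : {linear R -> R}) by move=> t; exact: cvg_id.
split.
- exact: (tame_Ck1 cu uA cid C1).
- by move=> t y tT; have [] := slice_diff uA y tT C1.
- by move=> k; exact: (tame_Ck2 cu uA k cid C2).
Qed.

Definition gradA (v : R -> 'cV[R]_n -> R) t (y : 'cV[R]_n) : 'cV[R]_n :=
  \col_k 'd (v t) y (delta_mx k ord0).

Lemma gradAE v t y : grad setT (v t) y = gradA v t y.
Proof. by apply: grad_interior; exact: interiorT_in. Qed.

Lemma approximant_close : exists2 c : R, 0 <= c & forall e, 0 < e <= eps0 ->
  forall t (y : 'cV[R]_n), t \in `[0, T] -> enorm y < 2 * rho ->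
  `|V (theta e) t y - rvalue P t y| <= c * e /\ l1 (gradA (V (theta e)) t y - gradV t y) <= c * e.
Proof.
have [_ [c [c0 hc]]] := HA; exists (c + n%:R * c); first by rewrite addr_ge0 ?mulr_ge0// ltW.
move=> e ee t y tT yr; have e0 : 0 <= e by case/andP: ee => /ltW.
have := hc e ee t y tT (ltW yr); rewrite /=.
set D := fun z => _; set g := grad _ _ _; set H := hess _ _ _ => hD.
have nc0 : 0 <= n%:R * c * e by rewrite !mulr_ge0// ltW.
have ce0 : 0 <= c * e by rewrite mulr_ge0// ltW.
have h1 : `|D y| <= c * e by have := enorm_ge0 g; have := enorm_ge0 H; lra.
have h2 : enorm g <= c * e by have := normr_ge0 (D y); have := enorm_ge0 H; lra.
rewrite mulrDl; split; first by apply: (le_trans h1); rewrite lerDl.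
have [_ dv _] := approximant_tameC1 (theta e) ee.
(* The assumption bounds the relative gradient of a difference. At interior points the relative
   differential is the ordinary one, and there both functions are differentiable, so it splits. *)
have -> : gradA (V (theta e)) t y - gradV t y = g.
  have -> : g = \col_k 'd D y (delta_mx k ord0).
    exact: (grad_interior D (value_ball_interior yr)).
  have -> : D = V (theta e) t - rvalue P t by [].
  have dB v : 'd (V (theta e) t - rvalue P t) y v =
      'd (V (theta e) t) y v - 'd (rvalue P t) y v.
    by rewrite diffB//; [exact: dv|exact: rvalue_differentiable].
  apply/matrixP => k j; rewrite mxE [X in _ + X]mxE [X in X - _]mxE [X in _ - X]mxE [RHS]mxE.
  by rewrite dB.
apply: (le_trans (l1_le_enorm _)); apply: (@le_trans _ _ (n%:R * c * e)); last by rewrite lerDr.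
by rewrite -mulrA ler_wpM2l.
Qed.

(** The single network at parameter [eps0] has a gradient bounded on the ball, uniformly in time,
    and [gradV] stays within a fixed distance of it. *)
Lemma gradV_bounded : exists2 C : R, 0 <= C & forall t (y : 'cV[R]_n), t \in `[0, T] ->
  enorm y < 2 * rho -> l1 (gradV t y) <= C.
Proof.
have [c c0 hc] := approximant_close.
have ee : 0 < eps0 <= eps0 by rewrite eps0_gt0/=.
have [_ _ td] := approximant_tameC1 (theta eps0) ee.
have r0 := ltW Mhat_gt0.
have [B B0 hB] := tame_bounds td (n%:R * (2 * rho)).
exists (n%:R * B + c * eps0); first by rewrite addr_ge0 ?mulr_ge0// ltW.
move=> t y tT yr; have [_ h] := hc eps0 ee t y tT yr.
apply: (le_trans (ler_l1_sub _ (gradA (V (theta eps0)) t y))); rewrite l1BC lerD//.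
rewrite mulr_natl -[n in _ *+ n]card_ord -sumr_const; apply: ler_sum => k _; rewrite mxE.
have yl : l1 y <= n%:R * (2 * rho) by rewrite (le_trans (l1_le_enorm _))// ler_wpM2l// ltW.
by have [] := hB k t tT y yl.
Qed.

Lemma rvalue_lipschitz : exists2 C : R, 0 <= C & forall t, t \in `[0, T] ->
  forall y z : 'cV[R]_n, enorm y < 2 * rho -> enorm z < 2 * rho ->
  `|rvalue P t y - rvalue P t z| <= C * l1 (y - z).
Proof.
have [C C0 hC] := gradV_bounded; exists C => // t tT y z.
apply: (@lipschitz_of_partials _ _ (rvalue P t) [set y | enorm y < 2 * rho]).
- move=> {}y {}z s /andP[s0 s1] /= yr zr.
  have -> : z + s *: (y - z) = s *: y + (1 - s) *: z.
    by rewrite scalerBr scalerBl scale1r addrCA.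
  apply: (le_lt_trans (ler_enormD _ _)); rewrite !enormZ !ger0_norm//; last by rewrite subr_ge0.
  (* In the convexity of the open ball strictness comes from the summand with [y] when [s] is
     positive, and from [z] when [s] is zero. *)
  move: s0; rewrite le_eqVlt => /predU1P[<-|s0]; first by rewrite mul0r add0r subr0 mul1r.
  have -> : 2 * rho = s * (2 * rho) + (1 - s) * (2 * rho) by ring.
  by apply: ltr_leD; [rewrite ltr_pM2l|rewrite ler_wpM2l ?subr_ge0// ltW].
- by move=> {}y /= yr; exact: rvalue_differentiable.
- move=> {}y k /= yr; apply: le_trans (hC t y tT yr).
  by apply: le_trans (l1_coord _ k); rewrite mxE.
Qed.

End approximant.
End value_function.

(** * Closed loops near the optimal one *)

Section closed_loops.
Context {R : realType} (n m : nat) (P : ocp R n m) (HP : standing P) (HS : smooth_data P).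
Local Notation mu := (@lebesgue_measure R).
Local Notation T := (horizon P).

Let T0 : 0 <= T. Proof. exact/ltW/(horizon_gt0 HP). Qed.

Definition tame_vec (q : R -> 'cV[R]_n -> 'cV[R]_n) : Prop :=
  forall i, tame T (fun t y => q t y i ord0).

Definition loop_ctl (q : R -> 'cV[R]_n -> 'cV[R]_n) t y : 'cV[R]_m := fbk P t y (q t y).

Definition loop (q : R -> 'cV[R]_n -> 'cV[R]_n) t y : 'cV[R]_n := field P t y (loop_ctl q t y).

Lemma tame_loop_ctl q j : tame_vec q -> tame T (fun t y => loop_ctl q t y j ord0).
Proof.
move=> tq; apply: (@eq_tame _ _ _ (fun t y => - (beta P)^-1 * \sum_k (ctl P t y k j * q t y k ord0))).
  by move=> t y _; rewrite mxE; congr (_ * _); rewrite mxE; apply: eq_bigr => k _; rewrite mxE.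
apply: (@tameM _ _ _ (fun _ _ => - (beta P)^-1)); first exact: tame_cst.
apply: tame_sum => k; apply: (@tameM _ _ _ (fun t y => ctl P t y k j)) => //; exact: tctl.
Qed.

Lemma tame_loop q : tame_vec q -> tame_vec (loop q).
Proof.
move=> tq i; apply: (@eq_tame _ _ _ (fun t y => dyn P t y i ord0 +
    \sum_j (ctl P t y i j * loop_ctl q t y j ord0))).
  by move=> t y _; rewrite mxE; congr (_ + _); rewrite mxE.
apply: (@tameD _ _ _ (fun t y => dyn P t y i ord0)); first exact: tdyn.
apply: tame_sum => j; apply: (@tameM _ _ _ (fun t y => ctl P t y i j)); first exact: tctl.
exact: tame_loop_ctl.
Qed.

Lemma tame_vec_lip (q : R -> 'cV[R]_n -> 'cV[R]_n) (r : R) : tame_vec q -> exists2 C : R, 0 <= C &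
  forall t, t \in `[0, T] -> forall y, l1 y <= r -> l1 (q t y) <= C /\
  forall z, l1 z <= r -> l1 (q t y - q t z) <= C * l1 (y - z).
Proof.
move=> tq; have [C C0 hC] := tame_bounds tq r; exists (n%:R * C); first by rewrite mulr_ge0.
move=> t tT y yr; split=> [|z zr].
  rewrite mulr_natl -[n in _ *+ n]card_ord -sumr_const; apply: ler_sum => i _.
  by have [] := hC i t tT y yr.
rewrite -mulrA mulr_natl -[n in _ *+ n]card_ord -sumr_const; apply: ler_sum => i _.
rewrite mxE [X in _ + X]mxE; have [_ h] := hC i t tT y yr; exact: h.
Qed.

(** Lipschitz dependence on the initial state, for the state and for its derivative, as the H1 norm
    requires. The constant depends on [G], hence on the network, which is harmless at fixed [e]. *)
Lemma loop_stable (G : R -> 'cV[R]_n -> 'cV[R]_n) (r : R) : tame_vec G ->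
  exists2 K : R, 0 <= K & forall y z : R -> 'cV[R]_n,
  is_weak_deriv 0 T y (fun t => G t (y t)) -> is_weak_deriv 0 T z (fun t => G t (z t)) ->
  bounded_by P r y -> bounded_by P r z ->
  {in `[0, T], forall t, l1 (y t - z t) <= K * l1 (y 0 - z 0)} /\
  {in `[0, T], forall t, l1 (G t (y t) - G t (z t)) <= K * l1 (y 0 - z 0)}.
Proof.
move=> tG; have [L L0 hL] := tame_vec_lip r tG.
pose K := 2 * expR (2 * (L + 1) * (T - 0)); have K0 : 0 <= K by rewrite mulr_ge0// expR_ge0.
exists (K + L * K); first by rewrite addr_ge0 ?mulr_ge0.
move=> y z yw zw yr zr; have [Ly yE] := yw; have [Lz zE] := zw.
have d0 := l1_ge0 (y 0 - z 0).
have h t : t \in `[0, T] -> l1 (y t - z t) <= K * l1 (y 0 - z 0).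
  move=> tT; have -> : K * l1 (y 0 - z 0) =
      2 * (l1 (y 0 - z 0) + 0 * (T - 0)) * expR (2 * (L + 1) * (T - 0)).
    by rewrite /K mul0r addr0; ring.
  apply: (ac_compare T0 L0 d0 (lexx 0) (wd_ctn T0 yw) (wd_ctn T0 zw) _ _ yE zE) => //.
  - by move=> i; exact: L2_intg.
  - by move=> i; exact: L2_intg.
  apply: aeE => s sT; rewrite add0r.
  have sT' : s \in `[0, T] by exact: subset_itv_oo_cc.
  by have [_] := hL s sT' _ (yr s sT'); apply; exact: zr.
split=> t tT; rewrite mulrDl.
  by rewrite (le_trans (h t tT))// lerDl !mulr_ge0.
have [_ /(_ _ (zr t tT)) h'] := hL t tT _ (yr t tT); apply: (le_trans h').
rewrite -mulrA (@le_trans _ _ (L * (K * l1 (y 0 - z 0))))//; first by rewrite ler_wpM2l// h.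
by rewrite lerDr mulr_ge0.
Qed.

Section nearby_feedback.
Context (rho : R) (rho0 : 0 < rho) (g : R -> 'cV[R]_n -> 'cV[R]_n) (CV LV : R).
Context (CV0 : 0 <= CV) (LV0 : 0 <= LV).
Context (gb : forall t (y : 'cV[R]_n), t \in `[0, T] -> enorm y < 2 * rho -> l1 (g t y) <= CV).
Context (gl : forall t, t \in `[0, T] -> forall y z : 'cV[R]_n,
  enorm y < 2 * rho -> enorm z < 2 * rho -> l1 (g t y - g t z) <= LV * l1 (y - z)).

(** Here [q] is a vector and only its distance to [g t y] counts; the change from [y] to [z] is made
    in [g]. Thus [C] is the same for all feedbacks near [g]. The restriction [e <= 1] keeps [q] in
    the ball of radius [CV + 1]. *)
Lemma loop_bounds : exists2 C : R, 0 <= C & forall t, t \in `[0, T] -> forall (y z q : 'cV[R]_n) (e : R),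
  enorm y < 2 * rho -> enorm z < 2 * rho -> e <= 1 -> l1 (q - g t y) <= e ->
  [/\ l1 y <= C, l1 (fbk P t y q) <= C, l1 (field P t y (fbk P t y q)) <= C,
      l1 (fbk P t y q - loop_ctl g t z) <= C * (l1 (y - z) + e) &
      l1 (field P t y (fbk P t y q) - loop g t z) <= C * (l1 (y - z) + e)].
Proof.
have r0 := ltW rho0; pose r1 := n%:R * (2 * rho) + (CV + 1).
have [C1 C10 h1] := fbk_lip HS r1; pose r2 := r1 + C1.
have [C2 C20 h2] := field_lip HS r2.
have nr0 : 0 <= n%:R * (2 * rho) by rewrite !mulr_ge0.
have r10 : 0 <= r1 by rewrite /r1 !addr_ge0.
pose D1 := C1 * (1 + LV); have D10 : 0 <= D1 by rewrite mulr_ge0// addr_ge0.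
pose D2 := C2 * (1 + D1); have D20 : 0 <= D2 by rewrite mulr_ge0// addr_ge0.
exists (r1 + C1 + C2 + D1 + D2); first by rewrite !addr_ge0.
move=> t tT y z q e yr zr e1 qe.
have e0 : 0 <= e by exact: le_trans (l1_ge0 _) qe.
have lb (x : 'cV[R]_n) : enorm x < 2 * rho -> l1 x <= r1.
  move=> xr; rewrite (le_trans (l1_le_enorm _))// /r1.
  apply: (@le_trans _ _ (n%:R * (2 * rho))); first by rewrite ler_wpM2l// ltW.
  by rewrite lerDl addr_ge0.
have gr x : enorm x < 2 * rho -> l1 (g t x) <= r1.
  by move=> xr; have := gb tT xr; rewrite /r1; lra.
have qr : l1 q <= r1.
  by have := ler_l1_sub q (g t y); have := gb tT yr; rewrite /r1; lra.
have [b1 /(_ z (g t z) (lb _ zr) (gr _ zr)) b2] := h1 t tT y q (lb _ yr) qr.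
have [b3 _] := h1 t tT z (g t z) (lb _ zr) (gr _ zr).
have d0 := l1_ge0 (y - z).
have b4 : l1 (fbk P t y q - loop_ctl g t z) <= D1 * (l1 (y - z) + e).
  apply: (le_trans b2); rewrite /D1 -mulrA ler_wpM2l//.
  have := ler_l1_distD (g t y) q (g t z); have := gl tT yr zr.
  have : 0 <= LV * e by rewrite mulr_ge0.
  by rewrite mulrDl mul1r mulrDr; lra.
have b3' : l1 (loop_ctl g t z) <= r2 by rewrite /r2; apply: (le_trans b3); rewrite lerDr.
have b1' : l1 (fbk P t y q) <= r2 by rewrite /r2; apply: (le_trans b1); rewrite lerDr.
have lb2 (x : 'cV[R]_n) : enorm x < 2 * rho -> l1 x <= r2.
  by move=> /lb h; apply: (le_trans h); rewrite lerDl.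
have [b5 /(_ z _ (lb2 _ zr) b3') b6] := h2 t tT y _ (lb2 _ yr) b1'.
have b7 : l1 (field P t y (fbk P t y q) - loop g t z) <= D2 * (l1 (y - z) + e).
  apply: (le_trans b6); rewrite /D2 -mulrA ler_wpM2l//.
  by rewrite mulrDl mul1r; lra.
have de0 : 0 <= l1 (y - z) + e by rewrite addr_ge0.
split.
- by have := lb _ yr; lra.
- lra.
- lra.
- by apply: (le_trans b4); rewrite ler_wpM2r//; lra.
- by apply: (le_trans b7); rewrite ler_wpM2r//; lra.
Qed.

(** Both [K] and [eta] are chosen before [q], from bounds on [g] and on the data, so they are
    independent of the network. Gronwall is applied to the truncated loop with defect [C * e]. *)
Lemma loop_nearby : exists2 K : R, 0 <= K & exists2 eta : R, 0 < eta &
  forall (e : R) (q : R -> 'cV[R]_n -> 'cV[R]_n) (x : R -> 'cV[R]_n), 0 <= e <= eta -> tame_vec q ->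
  (forall t (y : 'cV[R]_n), t \in `[0, T] -> enorm y < 2 * rho -> l1 (q t y - g t y) <= e) ->
  is_weak_deriv 0 T x (fun t => loop g t (x t)) -> {in `[0, T], forall t, enorm (x t) <= rho} ->
  exists y : R -> 'cV[R]_n, [/\ y 0 = x 0, is_weak_deriv 0 T y (fun t => loop q t (y t)),
    {in `[0, T], forall t, enorm (y t) <= 3 / 2 * rho} & {in `[0, T], forall t,
     [/\ l1 (y t - x t) <= K * e, l1 (loop_ctl q t (y t) - loop_ctl g t (x t)) <= K * e &
      l1 (loop q t (y t) - loop g t (x t)) <= K * e]}].
Proof.
have [C C0 hC] := loop_bounds; pose L := C * (2 * n%:R).
have L0 : 0 <= L by rewrite !mulr_ge0.
pose K1 := 2 * (C * T) * expR (2 * (L + 1) * T).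
have K10 : 0 <= K1 by rewrite !mulr_ge0// expR_ge0.
pose r := 3 / 2 * rho.
have rr : r < 2 * rho by rewrite /r; move: rho0; lra.
have r0 : 0 < r by rewrite /r; move: rho0; lra.
pose K := K1 + C * (K1 + 1).
have K0 : 0 <= K by rewrite addr_ge0// mulr_ge0// addr_ge0.
have K11 : 0 < K1 + 1 by rewrite ltr_wpDl.
(* The bound one is the range of validity of [loop_bounds]; the other gives [K1 * e <= rho / 2], so
   that a trajectory near [x] stays within [3 / 2 * rho]. *)
exists K => //; exists (Num.min 1 (rho / (2 * (K1 + 1)))).
  by rewrite lt_min ltr01 divr_gt0// mulr_gt0.
move=> e q x /andP[e0]; rewrite le_min => /andP[e1 eK] tq qe xw xrho.
have K1e : K1 * e <= rho / 2.
  move: eK; rewrite ler_pdivlMr ?mulr_gt0// => h.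
  have : 0 <= e by [].
  by nra.
have x2 t : t \in `[0, T] -> enorm (x t) < 2 * rho.
  by move=> tT; have := xrho t tT; lra.
have tl := tame_loop tq; have cx := wd_ctn T0 xw.
have iG y : ctn 0 T y -> forall i, intg 0 T (fun t => loop q t (y t) i ord0).
  by move=> cy i; apply: within_intg; exact: (tl i).1.
(* [L'] depends on [q]. It serves only for existence of the truncated solution and for square
   integrability of its derivative; the comparison with [x] uses [C] and [L]. *)
have [L' L'0 hL'] := tame_vec_lip (n%:R * r) tl.
have er (y : 'cV[R]_n) : enorm y <= r -> l1 y <= n%:R * r.
  by move=> yr; rewrite (le_trans (l1_le_enorm _))// ler_wpM2l.
have [|y cy yE] := trunc_ode_exists T0 r0 L'0 iG _ (x 0).
  move=> t tT y z yr zr; have tT' : t \in `[0, T] by exact: subset_itv_oo_cc.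
  by have [_] := hL' t tT' y (er _ yr); apply; exact: er.
have y0 : y 0 = x 0.
  rewrite (yE 0) ?in_itv/= ?lexx//; apply/matrixP => i j; rewrite mxE [X in _ + X]mxE.
  by rewrite Int_empty// addr0.
have yE' : {in `[0, T], forall t, y t = y 0 +
    \col_i \int[mu]_(s in `]0, t[) loop q s (rtrunc r (y s)) i ord0}.
  by rewrite y0.
have [Lx xE] := xw.
have cmp t : t \in `[0, T] -> l1 (loop q t (rtrunc r (y t)) - loop g t (x t)) <=
    C * e + L * l1 (y t - x t).
  move=> tT; have tr : enorm (rtrunc r (y t)) < 2 * rho.
    by rewrite (le_lt_trans (enorm_rtrunc _ r0)).
  have [_ _ _ _ h] := hC t tT _ _ (q t (rtrunc r (y t))) e tr (x2 t tT) e1 (qe t _ tT tr).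
  apply: (le_trans h); rewrite mulrDr addrC lerD2l /L -mulrA ler_wpM2l//.
  (* The truncation is inactive on [x], so the distance to [x t] is a distance between two truncated
     points. *)
  rewrite -{1}[x t](@rtrunc_id _ _ r)//; first exact: l1_rtruncB.
  by have := xrho t tT; rewrite /r; lra.
have yx t : t \in `[0, T] -> l1 (y t - x t) <= K1 * e.
  move=> tT; have -> : K1 * e = 2 * (0 + C * e * (T - 0)) * expR (2 * (L + 1) * (T - 0)).
    by rewrite /K1 subr0; ring.
  have Ce0 : 0 <= C * e by rewrite mulr_ge0.
  have yx0 : l1 (y 0 - x 0) <= 0 by rewrite y0 subrr l10.
  have iy i := iG (fun s => rtrunc r (y s)) (ctn_rtrunc r0 cy) i.
  have ix i := L2_intg i Lx.
  apply: (ac_compare T0 L0 (lexx 0) Ce0 cy cx iy ix yE' xE yx0 _ tT).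
  by apply: aeE => s sT; apply: cmp; exact: subset_itv_oo_cc.
have yr t : t \in `[0, T] -> enorm (y t) <= r.
  move=> tT; apply: (le_trans (ler_enorm_sub _ (x t))).
  have := xrho t tT; have := enorm_le_l1 (y t - x t); have := yx t tT.
  by rewrite /r; lra.
have GC : {in `]0, T[, forall t, forall z, enorm z <= r -> l1 (loop q t z) <= L'}.
  move=> t tT z zr; have tT' : t \in `[0, T] by exact: subset_itv_oo_cc.
  by have [] := hL' t tT' z (er _ zr).
exists y; split; [exact: y0|exact: (untruncated_wd r0 iG cy yE' yr GC)|exact: yr|].
move=> t tT; have y2 : enorm (y t) < 2 * rho by rewrite (le_lt_trans (yr t tT)).
have [_ _ _ h1 h2] := hC t tT _ _ (q t (y t)) e y2 (x2 t tT) e1 (qe t _ tT y2).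
have h := yx t tT.
have Ch : C * (l1 (y t - x t) + e) <= C * (K1 + 1) * e.
  by rewrite -mulrA ler_wpM2l// mulrDl mul1r lerD2r.
have Ke : 0 <= K1 * e by rewrite mulr_ge0.
have CKe : 0 <= C * (K1 + 1) * e by rewrite !mulr_ge0// ltW.
by split; rewrite /K mulrDl; lra.
Qed.

End nearby_feedback.
End closed_loops.

Lemma subrBB (U : zmodType) (a b c d : U) : (a - b) - (c - d) = (a - c) - (b - d).
Proof. by rewrite !opprB [d - c]addrC addrACA [- b + d]addrC. Qed.

(** * Cost and error terms along network loops *)

Section functionals.
Context {R : realType} (n m : nat) (P : ocp R n m) (HP : standing P) (HS : smooth_data P).
Local Notation mu := (@lebesgue_measure R).
Local Notation T := (horizon P).

Let T0 : 0 <= T. Proof. exact/ltW/(horizon_gt0 HP). Qed.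

(** [w] is only square integrable, so the factor [2 * enorm w + e] from the difference of squares is
    replaced by [enorm w ^+ 2 + 2], which is integrable. *)
Lemma sqL2_close p (a b e : R) (v w : R -> 'cV[R]_p) : a <= b -> L2 a b v -> L2 a b w ->
  0 <= e -> e <= 1 -> {in `]a, b[, forall t, l1 (v t - w t) <= e} ->
  `|sqL2 a b v - sqL2 a b w| <= (sqL2 a b w + 2 * (b - a)) * e.
Proof.
move=> ab Lv Lw e0 e1 vw; have /L2P[_ iv] := Lv; have /L2P[_ iw] := Lw.
rewrite /sqL2 -IntB//; have ic : intg a b (fun t => enorm (w t) ^+ 2 + 2).
  by apply: intgD => //; exact: intg_cst.
apply: (@le_trans _ _ (\int[mu]_(t in `]a, b[) (e * (enorm (w t) ^+ 2 + 2)))).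
  apply: norm_Int_le; [exact: intgB|exact: intgZ|].
  move=> t tab; apply: (le_trans (ler_sqr_enormB _ _)).
  have h : enorm (v t - w t) <= e by apply: (le_trans (enorm_le_l1 _)); exact: vw.
  have h0 := enorm_ge0 (v t - w t).
  apply: (@le_trans _ _ ((2 * enorm (w t) + e) * e)).
    apply: ler_pM => //; first by rewrite addr_ge0// mulr_ge0// enorm_ge0.
    by rewrite lerD2l.
  rewrite mulrC ler_wpM2l//; have := sqr_ge0 (enorm (w t) - 1).
  by rewrite sqrrB mulr1 expr1n -mulr_natl; lra.
rewrite IntZ// IntD//; last exact: intg_cst.
by rewrite Int_cst// mulrC.
Qed.

Lemma eq_L2 p (a b : R) (v w : R -> 'cV[R]_p) : {in `]a, b[, v =1 w} -> L2 a b v -> L2 a b w.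
Proof.
move=> vw /L2P[mv iv]; apply/L2P; split.
  move=> i; apply: eq_measurable_fun (mv i) => t; rewrite inE/= => tab.
  by rewrite vw.
by apply: eq_intg iv => t tab; rewrite vw.
Qed.

Lemma sum_sqr_le (a1 a2 b1 b2 c1 c2 k : R) : a1 <= 2 * b1 + 2 * c1 -> a2 <= 2 * b2 + 2 * c2 ->
  c1 + c2 <= k ^+ 2 -> b1 + b2 <= k ^+ 2 -> a1 + a2 <= (2 * k) ^+ 2.
Proof. by rewrite exprMn; lra. Qed.

(** The square of a sum is at most twice the sum of the squares, for the function and for the
    derivative. With [K] equal to [M] this gives exactly the bound [2 * M] of [state_adm]. *)
Lemma H1norm_near p (b K : R) (y v x w : R -> 'cV[R]_p) : is_weak_deriv 0 b y v ->
  is_weak_deriv 0 b x w -> 0 <= K -> H1norm 0 b x <= K ->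
  H1norm 0 b (fun t => y t - x t) <= K -> H1norm 0 b y <= 2 * K.
Proof.
move=> yw xw K0 xK dK; have dw := wdB yw xw.
have h1 := sqr_H1norm yw; have h2 := sqr_H1norm xw; have h3 := sqr_H1norm dw.
have sq q (a c : R -> 'cV[R]_q) : L2 0 b a -> L2 0 b c ->
    sqL2 0 b a <= 2 * sqL2 0 b c + 2 * sqL2 0 b (fun t => a t - c t).
  move=> La Lc; have /L2P[_ ia] := La; have /L2P[_ ic] := Lc.
  have /L2P[_ id] := L2B La Lc.
  rewrite /sqL2 -IntZ// -IntZ// -IntD; [|exact: intgZ|exact: intgZ].
  apply: le_Int => //; first by apply: intgD; exact: intgZ.
  by move=> t _; have := sqr_enormD_le (c t) (a t - c t); rewrite addrC subrK.
have [b0|b0] := leP b 0.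
  have z q (a : R -> 'cV[R]_q) : sqL2 0 b a = 0 by rewrite /sqL2 Int_empty.
  by rewrite (H1norm_wd yw) !z addr0 sqrtr0 mulr_ge0.
have cy := wd_ctn (ltW b0) yw; have cx := wd_ctn (ltW b0) xw.
have i1 := sq _ _ _ yw.1 xw.1; have i2 := sq _ _ _ (ctn_L2 cy) (ctn_L2 cx).
rewrite -(@ler_pXn2r _ 2)// ?nnegrE ?H1norm_ge0 ?mulr_ge0//.
have sK : forall z, 0 <= z -> z <= K -> z ^+ 2 <= K ^+ 2.
  by move=> z z0 zK; rewrite ler_pXn2r// nnegrE.
have eq_le (a c d : R) : a = c -> c <= d -> a <= d by move=> ->.
have x2 := sK _ (H1norm_ge0 _ _ _) xK; have d2 := sK _ (H1norm_ge0 _ _ _) dK.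
apply: (eq_le _ _ _ h1); apply: (sum_sqr_le i1 i2).
  exact: (eq_le _ _ _ (esym h3) d2).
exact: (eq_le _ _ _ (esym h2) x2).
Qed.

Lemma sqr_enorm_gap p (a b : 'cV[R]_p) (X Y Z : R) : enorm b <= X -> enorm (a - b) <= Y -> Y <= Z ->
  `|enorm a ^+ 2 - enorm b ^+ 2| <= (2 * X + Z) * Y.
Proof.
move=> bX abY YZ; apply: (le_trans (ler_sqr_enormB _ _)).
have h := enorm_ge0 (a - b); have h' := enorm_ge0 b.
apply: ler_pM => //; first by rewrite addr_ge0// mulr_ge0.
by apply: lerD; [rewrite ler_wpM2l|exact: le_trans YZ].
Qed.

Section fixed_network.
Context (v : R -> 'cV[R]_n -> R) (Hv : tameC1 T v).

Lemma net_feedbackE y t : net_feedback P v y t = loop_ctl P (gradA v) t (y t).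
Proof. by rewrite /net_feedback /feedback gradAE. Qed.

Lemma tame_gradA : tame_vec P (gradA v).
Proof.
have [_ _ h] := Hv => i; apply: eq_tame (h i) => t y _; by rewrite mxE.
Qed.

Lemma ctn_tame_vec p (q : R -> 'cV[R]_n -> 'cV[R]_p) y :
  (forall i, tame T (fun t y => q t y i ord0)) -> ctn 0 T y -> ctn 0 T (fun t => q t (y t)).
Proof. by move=> tq cy i; exact: (tq i).1. Qed.

Lemma ctn_net y : ctn 0 T y -> ctn 0 T (net_feedback P v y).
Proof.
move=> cy; rewrite (_ : net_feedback P v y = fun t => loop_ctl P (gradA v) t (y t)).
  by apply: ctn_tame_vec => // j; apply: tame_loop_ctl => //; exact: tame_gradA.
by apply/funext => t; rewrite net_feedbackE.
Qed.

(** The constant depends on the network [v]. It is used at fixed [e], for continuity and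
    measurability in the initial state. *)
Lemma net_lip (r : R) : 0 <= r -> exists2 C : R, 0 <= C & forall e (y y' : R -> 'cV[R]_n),
  bounded_by P r y -> bounded_by P r y' -> close_by P e y y' ->
  [/\ bounded_by P C (net_feedback P v y),
    close_by P (C * e) (net_feedback P v y) (net_feedback P v y'),
    {in `[0, T], forall t, `|v t (y t)| <= C /\ `|v t (y t) - v t (y' t)| <= C * e} &
    {in `[0, T], forall t, l1 (gradA v t (y t)) <= C /\
      l1 (gradA v t (y t) - gradA v t (y' t)) <= C * e}].
Proof.
move=> r0; have [tv _ _] := Hv; have tg := tame_gradA.
have [C1 C10 h1] := tv.2 r; have [C2 C20 h2] := tame_vec_lip r tg.
have [C3 C30 h3] := tame_bounds (fun j => tame_loop_ctl HS j tg) r.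
have mC3 : 0 <= m%:R * C3 by rewrite mulr_ge0.
exists (C1 + C2 + m%:R * C3); first by rewrite !addr_ge0.
move=> e y y' yr yr' yy.
have up (c : R) t : 0 <= c -> t \in `[0, T] -> c * l1 (y t - y' t) <= c * e.
  by move=> c0 tT; rewrite ler_wpM2l// yy.
have e0 : 0 <= e by apply: le_trans (yy 0 _); rewrite ?l1_ge0// in_itv/= lexx.
have [p1 p2 p3] : [/\ 0 <= C1 * e, 0 <= C2 * e & 0 <= m%:R * C3 * e] by rewrite !mulr_ge0.
split=> t tT; [| |split|split].
- apply: (@le_trans _ _ (m%:R * C3)); last by lra.
  rewrite mulr_natl -[m in _ *+ m]card_ord -sumr_const; apply: ler_sum => j _.
  by rewrite net_feedbackE; have [] := h3 j t tT _ (yr t tT).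
- apply: (@le_trans _ _ (m%:R * C3 * e)); last by rewrite !mulrDl; lra.
  rewrite -mulrA mulr_natl -[m in _ *+ m]card_ord -sumr_const; apply: ler_sum => j _.
  rewrite !net_feedbackE mxE [X in _ + X]mxE.
  have [_ /(_ _ (yr' t tT)) h] := h3 j t tT _ (yr t tT).
  by apply: (le_trans h); exact: up.
- by have [h _] := h1 t tT _ (yr t tT); apply: (le_trans h); lra.
- have [_ /(_ _ (yr' t tT)) h] := h1 t tT _ (yr t tT).
  by apply: (le_trans h); apply: (le_trans (up _ _ C10 tT)); rewrite !mulrDl; lra.
- by have [h _] := h2 t tT _ (yr t tT); apply: (le_trans h); lra.
- have [_ /(_ _ (yr' t tT)) h] := h2 t tT _ (yr t tT).
  by apply: (le_trans h); apply: (le_trans (up _ _ C20 tT)); rewrite !mulrDl; lra.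
Qed.

Definition value_gap y t : R := v t (y t) - cost P t y (net_feedback P v y).

Lemma value_gap_continuous y : ctn 0 T y -> {within `[0, T], continuous (value_gap y)}.
Proof.
move=> cy; have [tv _ _] := Hv; apply: wcB; first exact: tv.1.
apply: cost_tail_continuous => //; first exact: ctn_L2.
by apply: ctn_L2; exact: ctn_net.
Qed.

Lemma gradA_gap_ctn y p : ctn 0 T y -> ctn 0 T p -> ctn 0 T (fun t => gradA v t (y t) - p t).
Proof. by move=> cy cp; apply: ctnB => //; apply: ctn_tame_vec => //; exact: tame_gradA. Qed.

Lemma value_errorE y : value_error P v y = \int[mu]_(t in `]0, T[) value_gap y t ^+ 2.
Proof. by apply: eq_Int => t _; rewrite real_normK ?num_real. Qed.

Lemma grad_errorE y p : grad_error P v y p = sqL2 0 T (fun t => gradA v t (y t) - p t).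
Proof. by apply: eq_Int => t _; rewrite gradAE. Qed.

Lemma value_gap_intg y : ctn 0 T y -> intg 0 T (fun t => value_gap y t ^+ 2).
Proof.
move=> cy; apply: within_intg; rewrite (_ : (fun t => _) = fun t => value_gap y t * value_gap y t).
  by apply: wcM; exact: value_gap_continuous.
by apply/funext => t; rewrite expr2.
Qed.

Lemma value_error_ge0 y : 0 <= value_error P v y.
Proof. by rewrite value_errorE; apply: Int_ge0 => t _; exact: sqr_ge0. Qed.

Lemma grad_error_ge0 y p : 0 <= grad_error P v y p.
Proof. by rewrite grad_errorE sqL2_ge0. Qed.

Lemma value_error_le y C : ctn 0 T y -> 0 <= C -> {in `]0, T[, forall t, `|value_gap y t| <= C} ->
  value_error P v y <= C ^+ 2 * T.
Proof.
move=> cy C0 h; rewrite value_errorE -[leRHS](_ : \int[mu]_(t in `]0, T[) (C ^+ 2) = _).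
  apply: le_Int; [exact: value_gap_intg|exact: intg_cst|].
  move=> t tT; rewrite -real_normK ?num_real// ler_pXn2r ?nnegrE//; exact: h.
by rewrite Int_cst// subr0.
Qed.

Lemma grad_error_le y p C : ctn 0 T y -> ctn 0 T p -> 0 <= C ->
  {in `]0, T[, forall t, l1 (gradA v t (y t) - p t) <= C} -> grad_error P v y p <= C ^+ 2 * T.
Proof.
move=> cy cp C0 h; rewrite grad_errorE -[X in _ * X]subr0; apply: sqL2_le => //.
  by apply: ctn_L2; exact: gradA_gap_ctn.
by apply: aeE.
Qed.

Lemma sample_costE gam1 gam2 y p : ctn 0 T y -> ctn 0 T p ->
  sample_cost P gam1 gam2 v y p = cost P 0 y (net_feedback P v y) +
    (gam1 / 2 * value_error P v y + gam2 / 2 * grad_error P v y p).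
Proof.
move=> cy cp; congr (_ + _); rewrite value_errorE grad_errorE.
have i1 := value_gap_intg cy.
have /L2P[_ i2] := ctn_L2 (gradA_gap_ctn cy cp).
rewrite -IntZ// /sqL2 -IntZ// -IntD; [|exact: intgZ|exact: intgZ].
have E t : gam1 / 2 * `|v t (y t) - cost P t y (net_feedback P v y)| ^+ 2 +
    gam2 / 2 * enorm (grad setT (v t) (y t) - p t) ^+ 2 =
    gam1 / 2 * value_gap y t ^+ 2 + gam2 / 2 * enorm (gradA v t (y t) - p t) ^+ 2.
  by rewrite (real_normK (num_real _)) gradAE.
by apply: eq_Int => t _; exact: E.
Qed.

(** For a fixed network all three functionals depend on trajectory and costate in a locally
    Lipschitz way in the sup norm. This makes them continuous in the initial state and hence
    integrable against the weight. *)
Lemma functionals_lip (r : R) : 0 <= r -> exists2 C : R, 0 <= C & forall e (y y' p p' : R -> 'cV[R]_n),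
  ctn 0 T y -> ctn 0 T y' -> ctn 0 T p -> ctn 0 T p' -> 0 <= e -> e <= 1 ->
  bounded_by P r y -> bounded_by P r y' -> bounded_by P r p' ->
  close_by P e y y' -> close_by P e p p' ->
  [/\ `|cost P 0 y (net_feedback P v y) - cost P 0 y' (net_feedback P v y')| <= C * e,
      `|value_error P v y - value_error P v y'| <= C * e &
      `|grad_error P v y p - grad_error P v y' p'| <= C * e].
Proof.
move=> r0; have [A A0 hA] := net_lip r0.
have rA0 : 0 <= r + A by rewrite addr_ge0.
have [B B0 hB] := cost_lip HP rA0; have [D D0 hD] := cost_bound HP rA0.
pose E := B * (1 + A); have E0 : 0 <= E by rewrite mulr_ge0// addr_ge0.
pose F := 2 * (A + D) * (A + E) * T.
have F0 : 0 <= F by rewrite !mulr_ge0// addr_ge0.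
pose G := A + 1; have G0 : 0 <= G by rewrite addr_ge0.
pose H := (2 * (A + r) + G) * G * T.
have H0 : 0 <= H by rewrite !mulr_ge0// !addr_ge0 ?mulr_ge0 ?addr_ge0.
exists (E + F + H); first by rewrite !addr_ge0.
move=> e y y' p p' cy cy' cp cp' e0 e1 yr yr' pr yy pp.
have [u1 u2 v12 g12] := hA e y y' yr yr' yy.
have yy' : close_by P e y' y by move=> t tT; rewrite l1BC yy.
have [u1' _ v12' g12'] := hA e y' y yr' yr yy'.
have mn z : ctn 0 T z -> mf_vec 0 T (net_feedback P v z) by move=> cz; apply: ctn_mf; exact: ctn_net.
have wk q (z : R -> 'cV[R]_q) c : c <= r + A -> bounded_by P c z -> bounded_by P (r + A) z.
  by move=> cA h t tT; exact: le_trans (h t tT) cA.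
have rr : r <= r + A by rewrite lerDl.
have AA : A <= r + A by rewrite lerDr.
have cl t : t \in `[0, T] -> `|cost P t y (net_feedback P v y) - cost P t y' (net_feedback P v y')| <= E * e.
  move=> tT; rewrite /E -mulrA.
  have e1A : 0 <= (1 + A) * e by rewrite mulr_ge0// addr_ge0.
  have c1 : close_by P ((1 + A) * e) y y'.
    by move=> s sT; rewrite (le_trans (yy s sT))// ler_peMl// lerDl.
  have c2 : close_by P ((1 + A) * e) (net_feedback P v y) (net_feedback P v y').
    by move=> s sT; rewrite (le_trans (u2 s sT))// ler_wpM2r// lerDr.
  exact: (hB _ _ _ _ _ e1A (ctn_mf cy) (ctn_mf cy') (mn _ cy) (mn _ cy')
    (wk _ _ _ rr yr) (wk _ _ _ rr yr') (wk _ _ _ AA u1) (wk _ _ _ AA u1') c1 c2 t tT).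
have cb z : ctn 0 T z -> bounded_by P r z -> bounded_by P A (net_feedback P v z) ->
    {in `[0, T], forall t, `|cost P t z (net_feedback P v z)| <= D}.
  by move=> cz zr zA; apply: hD; [exact: ctn_mf|exact: mn|exact: (wk _ _ _ rr)|exact: (wk _ _ _ AA)].
have [q1 q2 q3] : [/\ 0 <= E * e, 0 <= F * e & 0 <= H * e] by split; exact: mulr_ge0.
split.
- have : (0 : R) \in `[0, T] by rewrite in_itv/= lexx.
  by move=> /cl h; apply: (le_trans h); rewrite !mulrDl; lra.
- apply: (@le_trans _ _ (F * e)); last by rewrite !mulrDl; lra.
  have i1 := value_gap_intg cy; have i2 := value_gap_intg cy'.
  rewrite (value_errorE y) (value_errorE y') -(IntB i1 i2).
  have -> : F * e = \int[mu]_(t in `]0, T[) (2 * (A + D) * ((A + E) * e)).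
    by rewrite Int_cst// subr0 /F; ring.
  apply: norm_Int_le; [exact: intgB|exact: intg_cst|].
  move=> t /subset_itv_oo_cc tT; rewrite subr_sqr normrM mulrC.
  have [b1 b5] := v12 t tT; have [b2 _] := v12' t tT; have b3 := cb y cy yr u1 t tT.
  have b4 := cb y' cy' yr' u1' t tT; have b6 := cl t tT.
  apply: ler_pM => //.
    apply: (le_trans (ler_normD _ _)); rewrite mulr_natl mulr2n.
    exact: (lerD (le_trans (ler_normB _ _) (lerD b1 b3)) (le_trans (ler_normB _ _) (lerD b2 b4))).
  have -> : value_gap y t - value_gap y' t = (v t (y t) - v t (y' t)) -
      (cost P t y (net_feedback P v y) - cost P t y' (net_feedback P v y')).
    exact: subrBB.
  by apply: (le_trans (ler_normB _ _)); rewrite mulrDl lerD.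
- apply: (@le_trans _ _ (H * e)); last by rewrite !mulrDl; lra.
  have /L2P[_ i1] := ctn_L2 (gradA_gap_ctn cy cp).
  have /L2P[_ i2] := ctn_L2 (gradA_gap_ctn cy' cp').
  rewrite (grad_errorE y) (grad_errorE y') /sqL2 -(IntB i1 i2).
  have -> : H * e = \int[mu]_(t in `]0, T[) ((2 * (A + r) + G) * (G * e)).
    by rewrite Int_cst// subr0 /H; ring.
  apply: norm_Int_le; [exact: intgB|exact: intg_cst|].
  move=> t /subset_itv_oo_cc tT; apply: sqr_enorm_gap; last by rewrite ler_piMr.
    apply: (le_trans (enorm_le_l1 _)); apply: (le_trans (ler_l1B _ _)).
    exact: (lerD (g12' t tT).1 (pr t tT)).
  apply: (le_trans (enorm_le_l1 _)); rewrite subrBB.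
  apply: (le_trans (ler_l1B _ _)); rewrite /G mulrDl mul1r.
  exact: (lerD (g12 t tT).2 (pp t tT)).
Qed.

End fixed_network.
End functionals.

(** * The network loop for one initial state *)

Section candidate.
Context {R : realType} (n m : nat) (P : ocp R n m) (HP : standing P) (n_gt0 : (0 < n)%N).
Context (M : R) (M_gt0 : 0 < M) (HS : smooth_data P) (HV : regularity2 P M).
Local Notation mu := (@lebesgue_measure R).
Local Notation T := (horizon P).
Local Notation rho := (Mhat P M).
Context (eps0 : R) (eps0_gt0 : 0 < eps0) (N : R -> nat)
  (ip : forall e, 'cV[R]_(N e) -> 'cV[R]_(N e) -> R)
  (V : forall e, 'cV[R]_(N e) -> R -> 'cV[R]_n -> R) (theta : forall e, 'cV[R]_(N e))
  (HA : approximation_assumption P M eps0 ip V theta).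

Let T0 : 0 <= T. Proof. exact/ltW/(horizon_gt0 HP). Qed.

Lemma rho_gt0 : 0 < rho. Proof. exact: Mhat_gt0. Qed.

Lemma lt_2rho (y : 'cV[R]_n) : enorm y <= 3 / 2 * rho -> enorm y < 2 * rho.
Proof. by move: rho_gt0; lra. Qed.

Lemma le_2rho (y : 'cV[R]_n) : enorm y <= rho -> enorm y < 2 * rho.
Proof. by move: rho_gt0; lra. Qed.

Lemma optimal_feedbackE x t : enorm (x t) < 2 * rho ->
  optimal_feedback P M x t = loop_ctl P (gradV P) t (x t).
Proof. by move=> xr; rewrite /optimal_feedback /feedback gradVE. Qed.

Lemma optimal_trajectory : exists2 r : R, 0 <= r & forall y0 x,
  optimal_closed_loop P M y0 x -> minimizer P y0 x (optimal_feedback P M x) ->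
  [/\ {in `[0, T], forall t, enorm (x t) <= rho}, mf_vec 0 T (optimal_feedback P M x),
    bounded_by P r x /\ bounded_by P r (optimal_feedback P M x),
    is_weak_deriv 0 T x (fun t => field P t (x t) (optimal_feedback P M x t)) &
    is_weak_deriv 0 T x (fun t => loop P (gradV P) t (x t))].
Proof.
have [CV CV0 hCV] := gradV_bounded HP n_gt0 M_gt0 HV eps0_gt0 HA.
have [LV LV0 hLV] := gradV_lipschitz HV.
have [C C0 hC] := loop_bounds HS rho_gt0 CV0 LV0 hCV hLV.
exists C => // y0 x [Hx ex x0 xM] [[_ Lu _ _] _].
have xr t : t \in `[0, T] -> enorm (x t) <= rho.
  move=> tT; apply: (le_trans (embedding_le (horizon_gt0 HP) Hx tT)).
  by rewrite /Mhat mulrC ler_wpM2r// ltW// embedding_gt0// horizon_gt0.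
have E t : t \in `[0, T] -> optimal_feedback P M x t = loop_ctl P (gradV P) t (x t).
  by move=> /xr h; apply: optimal_feedbackE; exact: le_2rho.
have b t : t \in `[0, T] -> [/\ l1 (x t) <= C, l1 (loop_ctl P (gradV P) t (x t)) <= C &
    l1 (loop P (gradV P) t (x t)) <= C].
  move=> tT; have x2 := le_2rho (xr t tT).
  have z : l1 (gradV P t (x t) - gradV P t (x t)) <= 0 by rewrite subrr l10.
  by have [h1 h2 h3 _ _] := hC t tT (x t) (x t) (gradV P t (x t)) 0 x2 x2 ler01 z.
have cx := H1_ctn T0 Hx; have /L2P[mu _] := Lu.
have mfx := field_mf HS cx mu.
have Lf : L2 0 T (fun t => field P t (x t) (optimal_feedback P M x t)).
  apply: (@L2_bounded _ _ _ _ _ C) => // t /subset_itv_oo_cc tT.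
  by rewrite (E t tT); have [_ _] := b t tT.
have w1 : is_weak_deriv 0 T x (fun t => field P t (x t) (optimal_feedback P M x t)).
  by apply: (wd_ae (dot_wd Hx) Lf); apply: aeS ex => t.
split; [exact: xr|exact: mu| |exact: w1|].
- by split=> t tT; [have [] := b t tT|rewrite (E t tT); have [] := b t tT].
- have EL : {in `]0, T[, (fun t => field P t (x t) (optimal_feedback P M x t)) =1
      (fun t => loop P (gradV P) t (x t))}.
    by move=> t /subset_itv_oo_cc tT; rewrite (E t tT).
  apply: (wd_ae w1); first exact: (eq_L2 EL Lf).
  by apply: aeE => t tT; exact: EL.
Qed.

Lemma candidate_sample : exists2 C : R, 0 <= C & exists2 eb : R, 0 < eb <= eps0 &
  forall e, 0 < e <= eb -> forall y0 x,
  optimal_closed_loop P M y0 x -> minimizer P y0 x (optimal_feedback P M x) ->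
  exists y, [/\ y 0 = y0, is_weak_deriv 0 T y (fun t => loop P (gradA (V (theta e))) t (y t)),
    {in `[0, T], forall t, enorm (y t) <= 3 / 2 * rho}, H1norm 0 T y <= 2 * M &
    cost P 0 y (net_feedback P (V (theta e)) y) <= rvalue P 0 y0 + C * e /\
    forall p, is_adjoint P y (net_feedback P (V (theta e)) y) p ->
      value_error P (V (theta e)) y <= C * e /\ grad_error P (V (theta e)) y p <= C * e].
Proof.
have [CV CV0 hCV] := gradV_bounded HP n_gt0 M_gt0 HV eps0_gt0 HA.
have [LV LV0 hLV] := gradV_lipschitz HV.
have [Lr Lr0 hLr] := rvalue_lipschitz HP n_gt0 M_gt0 HV eps0_gt0 HA.
have [cA cA0 hcA] := approximant_close HV HA.
have [K K0 [eta eta0 hK]] := loop_nearby HP HS rho_gt0 CV0 LV0 hCV hLV.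
have [r1 r10 hx] := optimal_trajectory.
(* A radius, independent of [e], that contains the optimal pair and everything within [K * eta] of
   it. All Lipschitz constants below are taken at this radius. *)
pose r := r1 + K * eta.
have Keta : 0 <= K * eta by rewrite mulr_ge0// ltW.
have r0 : 0 <= r by rewrite addr_ge0.
have [Cc Cc0 hCc] := cost_lip HP r0.
have [Ca Ca0 hCa] := adjoint_compare HP HS r0.
pose K1 := K * cA; have K10 : 0 <= K1 by rewrite mulr_ge0.
pose D1 := cA + Lr * K1 + Cc * K1; have D10 : 0 <= D1 by rewrite !addr_ge0// mulr_ge0.
pose D2 := cA + LV * K1 + Ca * K1; have D20 : 0 <= D2 by rewrite !addr_ge0// mulr_ge0.
pose S := Num.sqrt (2 * (T - 0)); have S0 : 0 <= S by exact: sqrtr_ge0.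
have KS0 : 0 < K1 * S + 1 by rewrite ltr_wpDl// mulr_ge0.
have cA1 : 0 < cA + 1 by rewrite ltr_wpDl.
exists (Cc * K1 + D1 ^+ 2 * T + D2 ^+ 2 * T).
  by rewrite !addr_ge0 ?mulr_ge0// exprn_ge0.
(* [eps0] makes the approximation available, one gives [e ^+ 2 <= e], the third bound puts the
   gradient error [cA * e] below [eta], and the last puts the H1 distance to the optimal trajectory
   below [M]. *)
exists (Num.min eps0 (Num.min 1 (Num.min (eta / (cA + 1)) (M / (K1 * S + 1))))).
  by rewrite ge_min lexx/= !lt_min eps0_gt0 ltr01 !divr_gt0.
move=> e /andP[e_gt0]; rewrite !le_min => /and4P[ee e1 e2 e3] y0 x ox mx.
have e0 := ltW e_gt0; have eeps : 0 < e <= eps0 by rewrite e_gt0.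
have [xr mfu [xb ub] xw xw'] := hx y0 x ox mx.
set v := V (theta e); set us := optimal_feedback P M x in mx mfu ub xw *.
have Hv : tameC1 T v by exact: (approximant_tameC1 HA).
have ce : cA * e <= eta.
  by apply: (@le_trans _ _ (e * (cA + 1))); [rewrite mulrC ler_wpM2l// lerDl|rewrite -ler_pdivlMr].
have ce0 : 0 <= cA * e by rewrite mulr_ge0.
have cee : 0 <= cA * e <= eta by rewrite ce0.
have hq t (y : 'cV[R]_n) : t \in `[0, T] -> enorm y < 2 * rho -> l1 (gradA v t y - gradV P t y) <= cA * e.
  by move=> tT yr; have [] := hcA e eeps t y tT yr.
have [y [yx0 yw yr ynear]] := hK (cA * e) (gradA v) x cee (tame_gradA Hv) hq xw' xr.
pose u := net_feedback P v y.
have cy := wd_ctn T0 yw; have cx := wd_ctn T0 xw.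
have mfuy : mf_vec 0 T u by apply: ctn_mf; exact: ctn_net.
have KE : K * (cA * e) = K1 * e by rewrite mulrA.
have K1e0 : 0 <= K1 * e by rewrite mulr_ge0.
have Kle : K * (cA * e) <= K * eta by rewrite ler_wpM2l.
have cly : close_by P (K1 * e) y x by move=> t tT; rewrite -KE; have [] := ynear t tT.
have clu : close_by P (K1 * e) u us.
  move=> t tT; rewrite -KE /u net_feedbackE /us optimal_feedbackE; last exact/le_2rho/xr.
  by have [] := ynear t tT.
have bxr : bounded_by P r x by move=> t tT; rewrite (le_trans (xb t tT))// lerDl.
have bur : bounded_by P r us by move=> t tT; rewrite (le_trans (ub t tT))// lerDl.
have byr : bounded_by P r y.
  move=> t tT; apply: (le_trans (ler_l1_sub _ (x t))); apply: lerD; first exact: xb.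
  by apply: le_trans Kle; rewrite KE; exact: cly.
have buy : bounded_by P r u.
  move=> t tT; apply: (le_trans (ler_l1_sub _ (us t))); apply: lerD; first exact: ub.
  by apply: le_trans Kle; rewrite KE; exact: clu.
have cc t : t \in `[0, T] -> `|cost P t y u - cost P t x us| <= Cc * (K1 * e).
  exact: (hCc _ _ _ _ _ K1e0 (ctn_mf cy) (ctn_mf cx) mfuy mfu byr bxr buy bur cly clu).
have oT : 0 < T by exact: horizon_gt0.
have xy0 : x 0 = y0 by have [_ _] := ox.
have TT0 : (0 : R) \in `[0, T] by rewrite in_itv/= lexx.
have vmin s : 0 <= s -> s < T -> rvalue P s (x s) = cost P s x us.
  by move=> s0 sT; exact: (value_minimizer_tail HP s0 sT mx).
(* The error terms are squares of quantities of order [e]; since [e <= 1] they may be recorded at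
   order [e], like the cost. *)
have De z : 0 <= z -> (z * e) ^+ 2 * T <= z ^+ 2 * T * e.
  move=> z0; rewrite exprMn mulrAC ler_wpM2l ?mulr_ge0 ?exprn_ge0//.
  by rewrite expr2 ler_piMr.
have p1 : 0 <= Cc * K1 * e by rewrite !mulr_ge0.
have p2 : 0 <= D1 ^+ 2 * T * e by rewrite !mulr_ge0// exprn_ge0.
have p3 : 0 <= D2 ^+ 2 * T * e by rewrite !mulr_ge0// exprn_ge0.
exists y; split; [by rewrite yx0|exact: yw|exact: yr| |split].
- apply: (H1norm_near yw xw' (ltW M_gt0)); first by have [] := ox.
  apply: (@le_trans _ _ (K1 * e * S)).
    apply: (H1norm_le T0 (wdB yw xw') K1e0) => [t /subset_itv_oo_cc tT|]; first exact: cly.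
    by apply: aeE => t /subset_itv_oo_cc tT; rewrite -KE; have [] := ynear t tT.
  apply: (@le_trans _ _ (e * (K1 * S + 1))); last by rewrite -ler_pdivlMr.
  by rewrite mulrAC mulrC ler_wpM2l// lerDl.
- rewrite -xy0 (vmin 0)// addrC -lerBlDr.
  apply: (le_trans (ler_norm _)); apply: (le_trans (cc 0 TT0)).
  by rewrite mulrA !mulrDl -addrA lerDl addr_ge0.
(* [px] is the adjoint state of the optimal pair, and every adjoint state of the new loop is within
   O(e) of it. *)
move=> p ap; have [px apx] := adjoint_exists HP HS r0 cx mfu bxr bur.
have cp : ctn 0 T p by have [] := ap.
have [clp _] := hCa _ _ _ _ _ _ _ K1e0 cy mfuy byr buy ap cx mfu bxr bur apx cly clu.
split.
- apply: (@le_trans _ _ ((D1 * e) ^+ 2 * T)).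
    apply: (value_error_le HP HS Hv cy); first by rewrite mulr_ge0.
    move=> t tT'; have tT := subset_itv_oo_cc tT'; move: tT'; rewrite in_itv/= => /andP[t0 tT1].
    have [g1 _] := hcA e eeps t (y t) tT (lt_2rho (yr t tT)).
    have g2 := hLr t tT _ _ (lt_2rho (yr t tT)) (le_2rho (xr t tT)).
    have g3 := cc t tT; have g4 := ler_wpM2l Lr0 (cly t tT).
    rewrite (vmin t (ltW t0) tT1) in g2.
    rewrite distrC in g3.
    (* The chain runs from the network at [y] to the value function at [y], then to the value
       function at [x], which is the cost to go of the optimal pair, and finally to the cost to go
       of [y]. *)
    apply: (le_trans (ler_distD (rvalue P t (y t)) _ _)).
    rewrite /D1 !mulrDl -addrA; apply: lerD; first exact: g1.
    apply: (le_trans (ler_distD (cost P t x us) _ _)).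
    rewrite -(mulrA Lr) -(mulrA Cc); apply: lerD; last exact: g3.
    exact: (le_trans g2 g4).
  by apply: (le_trans (De _ D10)); rewrite !mulrDl -addrA addrCA lerDl addr_ge0.
- apply: (@le_trans _ _ ((D2 * e) ^+ 2 * T)).
    apply: (grad_error_le HP Hv cy cp); first by rewrite mulr_ge0.
    move=> t tT'; have tT := subset_itv_oo_cc tT'; move: tT'; rewrite in_itv/= => /andP[t0 tT1].
    have g1 := hq t (y t) tT (lt_2rho (yr t tT)).
    have g2 := hLV t tT _ _ (lt_2rho (yr t tT)) (le_2rho (xr t tT)).
    have g4 := ler_wpM2l LV0 (cly t tT).
    have fv z : enorm z <= rho + rho -> value P t z \is a fin_num.
      by move=> zr; have [h _ _] := HV; apply: h => //; rewrite /value_ball /eball/= mulr_natl mulr2n.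
    have dV := rvalue_differentiable HV tT (le_2rho (xr t tT)).
    have gE := value_gradient HP HS rho_gt0 r0 mfu bur xw xr (ltW t0) tT1 mx fv apx dV.
    (* This closes the analogous chain for gradients: network at [y], value function at [y], value
       function at [x] which is [px], and [p]. *)
    have gp : gradV P t (x t) = px t.
      apply/matrixP => k j; rewrite (ord1 j) mxE gE /dotv (bigD1 k)//= big1 ?addr0.
        by rewrite mxE !eqxx mulr1.
      by move=> i ik; rewrite mxE (negbTE ik) mulr0.
    rewrite gp in g2.
    apply: (le_trans (ler_l1_distD (gradV P t (y t)) _ _)).
    rewrite /D2 !mulrDl -addrA; apply: lerD; first exact: g1.
    apply: (le_trans (ler_l1_distD (px t) _ _)).
    rewrite -(mulrA LV) -(mulrA Ca); apply: lerD; first exact: (le_trans g2 g4).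
    by rewrite l1BC; exact: clp.
  by apply: (le_trans (De _ D20)); rewrite !mulrDl lerDr addr_ge0.
Qed.

End candidate.

(** * Means over initial states *)

Section means.
Context {R : realType} (n : nat) (Y0 : set 'cV[R]_n) (Y0c : compact Y0).
Context (w : 'cV[R]_n -> R) (Hw : weight Y0 w).
Local Notation D := (Y0 : set (borel_cV R n)).
Local Notation nu := (normalized_lebesgue D).
Implicit Types h k : 'cV[R]_n -> R.

Lemma Y0_measurable : measurable D.
Proof.
have cY : closed (Y0 : set 'cV[R]_n) by apply: compact_closed => //; exact: norm_hausdorff.
rewrite -[D]setCK; apply: measurableC; apply: sub_gen_smallest.
by rewrite /= openC.
Qed.

Lemma wc_measurable h : {within Y0, continuous h} -> measurable_fun D (h : borel_cV R n -> R).
Proof.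
move=> /continuousP ch; apply: (measurability _ (RGenOpens.measurableE R)).
move=> _ [_ [a [b ->] <-]].
have oab : open (`]a, b[%classic : set R) by exact: interval_open.
have /(open_subspaceP Y0)[U oU UE] := ch _ oab.
rewrite setIC -UE; apply: measurableI; last exact: Y0_measurable.
exact: sub_gen_smallest.
Qed.

Lemma nu_lty : (nu D < +oo)%E.
Proof.
rewrite /normalized_lebesgue /= /mscale /=.
(* For an infinite volume [fine] returns zero, whose inverse is zero, so the normalized mass is zero
   and finite in every case. *)
case: (lebesgue_cV D) => [r||] /=; first by rewrite -EFinM ltry.
  by rewrite invr0 mul0e.
by rewrite invr0 mul0e.
Qed.

Lemma wc_bounded h : {within Y0, continuous h} -> exists2 C : R, 0 <= C & forall y, Y0 y -> `|h y| <= C.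
Proof.
move=> ch; have /compact_bounded[C [Cr hC]] := continuous_compact ch Y0c.
exists (`|C| + 1); first by rewrite addr_ge0.
by move=> y Yy; apply: (hC (`|C| + 1)); [rewrite (le_lt_trans (ler_norm C))// ltrDl|exists y].
Qed.

Lemma mean_integrable h : {within Y0, continuous h} ->
  nu.-integrable D (EFin \o (fun y : borel_cV R n => w y * h y)).
Proof.
move=> ch; have [C C0 hC] := wc_bounded ch; have [mw [W wW]] := Hw.
have mD := Y0_measurable.
have mwh : measurable_fun D (fun y : borel_cV R n => w y * h y).
  by apply: measurable_funM => //; exact: wc_measurable.
apply/integrableP; split; first exact/measurable_EFinP.
apply: (@le_lt_trans _ _ (\int[nu]_(y in D) (`|W| * C)%:E)%E).
  apply: ae_ge0_le_integral => //.
  - by apply: measurableT_comp => //; exact/measurable_EFinP.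
  - by move=> y _; rewrite lee_fin mulr_ge0.
  apply: aeS wW => y wy Dy; rewrite /= lee_fin normrM.
  by apply: ler_pM => //; [exact: le_trans (wy Dy) (ler_norm _)|exact: hC].
rewrite integral_cst// lte_mul_pinfty ?lee_fin ?mulr_ge0//.
exact: nu_lty.
Qed.

Lemma meanD h k : {within Y0, continuous h} -> {within Y0, continuous k} ->
  mean Y0 w (fun y => h y + k y) = mean Y0 w h + mean Y0 w k.
Proof.
move=> ch ck; rewrite /mean -RintegralD; [|exact: Y0_measurable|exact: mean_integrable|exact: mean_integrable].
by apply: eq_Rintegral => y _; rewrite mulrDr.
Qed.

Lemma meanZ c h : {within Y0, continuous h} -> mean Y0 w (fun y => c * h y) = c * mean Y0 w h.
Proof.
move=> ch; rewrite /mean -RintegralZl; [|exact: Y0_measurable|exact: mean_integrable].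
by apply: eq_Rintegral => y _; rewrite mulrCA.
Qed.

Lemma meanB h k : {within Y0, continuous h} -> {within Y0, continuous k} ->
  mean Y0 w (fun y => h y - k y) = mean Y0 w h - mean Y0 w k.
Proof.
move=> ch ck; rewrite /mean -RintegralB; [|exact: Y0_measurable|exact: mean_integrable|exact: mean_integrable].
by apply: eq_Rintegral => y _; rewrite mulrBr.
Qed.

Context (cw : R) (cw_gt0 : 0 < cw) (Hcw : {ae nu, forall y0, Y0 y0 -> cw <= w y0}).

Lemma mean_ge0 h : {within Y0, continuous h} -> {ae nu, forall y, Y0 y -> 0 <= h y} ->
  0 <= mean Y0 w h.
Proof.
move=> ch h0; have ih := mean_integrable ch.
have -> : mean Y0 w h = \int[nu]_(y in D) `|w y * h y|.
  rewrite /mean /Rintegral; congr fine; apply: ae_eq_integral => //.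
  - exact: Y0_measurable.
  - exact: measurable_int ih.
  - by apply: measurable_int (integrable_norm ih); exact: Y0_measurable.
  apply: aeS (aeI h0 Hcw) => y [hy wy] Dy /=; rewrite ger0_norm// mulr_ge0//; last exact: hy.
  exact: le_trans (ltW cw_gt0) (wy Dy).
by apply: Rintegral_ge0.
Qed.

Lemma le_mean h k : {within Y0, continuous h} -> {within Y0, continuous k} ->
  {ae nu, forall y, Y0 y -> h y <= k y} -> mean Y0 w h <= mean Y0 w k.
Proof.
move=> ch ck hk; rewrite -subr_ge0 -meanB//; apply: mean_ge0; first exact: wcB.
by apply: aeS hk => y hky /hky; rewrite subr_ge0.
Qed.

Lemma mean_le_cst h c : {within Y0, continuous h} -> (forall y, Y0 y -> h y <= c) ->
  mean Y0 w h <= c * mean Y0 w (fun=> 1).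
Proof.
move=> ch hc; have c1 : {within Y0, continuous (fun _ : 'cV[R]_n => 1 : R)} by exact: wc_cst.
rewrite -meanZ//; apply: le_mean => //; first exact: wcZ.
by apply: aeE => y Yy; rewrite mulr1 hc.
Qed.

End means.

(** Fitted to the Lipschitz estimates above: they hold for [e <= 1] only, and with a constant that
    may depend on [y0]. *)
Lemma wc_of_close {R : realType} n (Y0 : set 'cV[R]_n) (F : 'cV[R]_n -> R) :
  (forall y0, Y0 y0 -> exists2 C : R, 0 <= C & forall e, 0 < e -> e <= 1 ->
     \forall z \near y0, Y0 z -> `|F z - F y0| <= C * e) ->
  {within Y0, continuous F}.
Proof.
move=> h; apply/subspace_continuousP => y0 Yy0; apply/cvgrPdist_le => e e0.
have [C C0 hC] := h y0 Yy0.
have C1 : 0 < C + 1 by rewrite ltr_wpDl.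
pose d := Num.min 1 (e / (C + 1)).
have d0 : 0 < d by rewrite lt_min ltr01 divr_gt0.
have d1 : d <= 1 by rewrite ge_min lexx.
have Cd : C * d <= e.
  have : d <= e / (C + 1) by rewrite ge_min lexx orbT.
  rewrite ler_pdivlMr// => de; apply: le_trans de.
  by rewrite mulrC ler_wpM2l ?ltW// ltrDl.
rewrite near_withinE; apply: filterS (hC d d0 d1) => z hz Yz.
by rewrite distrC; exact: le_trans (hz Yz) Cd.
Qed.

(** * Continuity in the initial state *)

Section sample_continuity.
Context {R : realType} (n m : nat) (P : ocp R n m) (HP : standing P) (HS : smooth_data P).
Context (Y0 : set 'cV[R]_n).
Local Notation T := (horizon P).

Let T0 : 0 <= T. Proof. exact/ltW/(horizon_gt0 HP). Qed.

Lemma CH1_ctn Y y0 : CH1 P Y0 Y -> Y0 y0 -> ctn 0 T (Y y0).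
Proof. by move=> HY /HY[h _]; exact: H1_ctn. Qed.

(** The Sobolev embedding, applied to the difference of two trajectories, turns continuity in the H1
    norm into uniform closeness in time. *)
Lemma CH1_close Y y0 (e : R) : CH1 P Y0 Y -> Y0 y0 -> 0 < e ->
  \forall z \near y0, Y0 z -> close_by P e (Y z) (Y y0).
Proof.
move=> HY Yy0 e0; have [H cY] := HY y0 Yy0.
pose c := n%:R * `|@embedding_norm R n T| + 1.
have c0 : 0 < c by rewrite ltr_wpDl// mulr_ge0.
have ec : 0 < e / c by rewrite divr_gt0.
have /cvgrPdist_le/(_ _ ec) := cY; rewrite near_withinE; apply: filterS => z hz Yz t tT.
have [Hz _] := HY z Yz.
have Hd : H1 0 T (fun t => Y z t - Y y0 t) by exact: wd_H1 (wdB (dot_wd Hz) (dot_wd H)).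
have := hz Yz; rewrite sub0r normrN ger0_norm ?H1norm_ge0// => hN.
apply: (le_trans (l1_le_enorm _)).
have hE := embedding_le (horizon_gt0 HP) Hd tT.
apply: (@le_trans _ _ (c * H1norm 0 T (fun t => Y z t - Y y0 t))).
  apply: (@le_trans _ _ (n%:R * (`|@embedding_norm R n T| * H1norm 0 T (fun t => Y z t - Y y0 t)))).
    rewrite ler_wpM2l//; apply: (le_trans hE); rewrite ler_wpM2r ?H1norm_ge0//; exact: ler_norm.
  by rewrite mulrA /c mulrDl lerDl mul1r H1norm_ge0.
by rewrite mulrC -ler_pdivlMr.
Qed.

Lemma functionals_continuous v Y p : tameC1 T v -> CH1 P Y0 Y -> CH1 P Y0 p ->
  [/\ {within Y0, continuous (fun y0 => cost P 0 (Y y0) (net_feedback P v (Y y0)))},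
    {within Y0, continuous (fun y0 => value_error P v (Y y0))} &
    {within Y0, continuous (fun y0 => grad_error P v (Y y0) (p y0))}].
Proof.
move=> Hv HY Hp.
suff h y0 : Y0 y0 -> exists2 C : R, 0 <= C & forall e, 0 < e -> e <= 1 ->
    \forall z \near y0, Y0 z ->
    [/\ `|cost P 0 (Y z) (net_feedback P v (Y z)) - cost P 0 (Y y0) (net_feedback P v (Y y0))| <= C * e,
      `|value_error P v (Y z) - value_error P v (Y y0)| <= C * e &
      `|grad_error P v (Y z) (p z) - grad_error P v (Y y0) (p y0)| <= C * e].
  by split; apply: wc_of_close => y0 /h[C C0 hC]; exists C => // e e0 e1;
    apply: filterS (hC e e0 e1) => z hz /hz[].
move=> Yy0; have cy := CH1_ctn HY Yy0; have cp := CH1_ctn Hp Yy0.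
have [A A0 hA] := ctn_bounded cy; have [B B0 hB] := ctn_bounded cp.
pose r := A + B + 1; have r0 : 0 <= r by rewrite !addr_ge0.
have [C C0 hC] := functionals_lip HP HS Hv r0.
exists C => // e e0 e1.
apply: filterS2 (CH1_close HY Yy0 e0) (CH1_close Hp Yy0 e0) => z hY hp Yz.
have cY := hY Yz; have cP := hp Yz.
apply: hC => //; [exact: CH1_ctn|exact: CH1_ctn|exact: ltW| | |].
- move=> t tT; apply: (le_trans (ler_l1_sub _ (Y y0 t))).
  by rewrite /r -addrA lerD ?hA//; apply: (le_trans (cY t tT)); apply: (le_trans e1); rewrite lerDr.
- by move=> t tT; apply: (le_trans (hA t tT)); rewrite /r -addrA lerDl addr_ge0.
- by move=> t tT; apply: (le_trans (hB t tT)); rewrite /r addrAC lerDr addr_ge0.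
Qed.

Lemma CH1_of_lip Y (K : R) : (forall y0, Y0 y0 -> H1 0 T (Y y0)) -> 0 <= K ->
  (forall y z, Y0 y -> Y0 z -> H1norm 0 T (fun t => Y y t - Y z t) <= K * l1 (y - z)) ->
  CH1 P Y0 Y.
Proof.
move=> HY K0 h y0 Yy0; split; first exact: HY.
apply/cvgrPdist_le => e e0; rewrite near_withinE.
have Kn : 0 < K * n%:R + 1 by rewrite ltr_wpDl// mulr_ge0.
apply/nbhs_ballP; exists (e / (K * n%:R + 1)); first by rewrite /= divr_gt0.
move=> z; rewrite -ball_normE /ball_/= => zy Yz.
rewrite sub0r normrN ger0_norm ?H1norm_ge0//; apply: (le_trans (h _ _ Yz Yy0)).
apply: (@le_trans _ _ (K * (n%:R * `|z - y0|))); first by rewrite ler_wpM2l// l1_le_norm.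
move: zy; rewrite ltr_pdivlMr// distrC => /ltW; apply: le_trans.
by rewrite mulrA mulrC ler_wpM2l// lerDl.
Qed.

(** The distance of the control to any fixed square integrable [u] is continuous in [y0], which
    gives measurability. With [u] equal to zero and [Y0] compact it is bounded, which gives
    integrability. *)
Lemma L2L2_net v Y : compact Y0 -> tameC1 T v -> CH1 P Y0 Y -> L2L2 P Y0 (fun y0 => net_feedback P v (Y y0)).
Proof.
move=> Y0c Hv HY; have L y0 : Y0 y0 -> L2 0 T (net_feedback P v (Y y0)).
  by move=> Yy0; apply: ctn_L2; apply: ctn_net => //; exact: CH1_ctn Yy0.
have c u : L2 0 T u -> {within Y0, continuous (fun y0 => sqL2 0 T (fun t => net_feedback P v (Y y0) t - u t))}.
  move=> Lu; apply: wc_of_close => y0 Yy0; have cy := CH1_ctn HY Yy0.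
  have [A A0 hA] := ctn_bounded cy; pose r := A + 1.
  have r0 : 0 <= r by rewrite addr_ge0.
  have [C C0 hC] := net_lip HP HS Hv r0.
  have Lw := L2B (L y0 Yy0) Lu; pose S := sqL2 0 T (fun t => net_feedback P v (Y y0) t - u t).
  have S0 : 0 <= S by exact: sqL2_ge0.
  exists (S + 2 * (T - 0)); first by rewrite addr_ge0// mulr_ge0// subr0.
  move=> e e0 e1; have C1 : 0 < C + 1 by rewrite ltr_wpDl.
  have d0 : 0 < e / (C + 1) by rewrite divr_gt0.
  have de : e / (C + 1) <= e by rewrite ler_pdivrMr// ler_peMr ?(ltW e0)// lerDr.
  apply: filterS (CH1_close HY Yy0 d0) => z hz Yz; have cz := hz Yz.
  have b1 : bounded_by P r (Y z).
    move=> t tT; apply: (le_trans (ler_l1_sub _ (Y y0 t))); apply: lerD; first exact: hA.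
    by apply: (le_trans (cz t tT)); exact: le_trans de e1.
  have b2 : bounded_by P r (Y y0).
    by move=> t tT; apply: (le_trans (hA t tT)); rewrite lerDl.
  have [_ cu _ _] := hC (e / (C + 1)) (Y z) (Y y0) b1 b2 cz.
  apply: (sqL2_close T0 (L2B (L z Yz) Lu) Lw (ltW e0) e1).
  move=> t /subset_itv_oo_cc tT; rewrite subrBB subrr subr0.
  apply: (le_trans (cu t tT)); rewrite mulrA ler_pdivrMr// mulrC ler_wpM2l ?(ltW e0)//.
  by rewrite lerDl.
split=> //.
- move=> u Lu; apply: (wc_measurable Y0c); apply: eq_wc (wc_comp (c u Lu) (@sqrt_continuous R)).
  by move=> y0 _; rewrite -L2norm_sqr sqrtr_sqr ger0_norm// sqrtr_ge0.
have z0 : L2 0 T (fun=> 0 : 'cV[R]_m) by apply: ctn_L2 => i; exact: wc_cst.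
have c0 := c _ z0; have [C C0 hC] := wc_bounded Y0c c0.
have mD := Y0_measurable Y0c.
apply: (@le_lt_trans _ _ (\int[normalized_lebesgue (Y0 : set (borel_cV R n))]_(y in
    (Y0 : set (borel_cV R n))) C%:E)%E).
  apply: ge0_le_integral => //.
  - by move=> y _; rewrite lee_fin exprn_ge0// sqrtr_ge0.
  - apply/measurable_EFinP; apply: (wc_measurable Y0c); apply: eq_wc c0 => y _.
    by rewrite L2norm_sqr; apply: eq_Int => t _; rewrite subr0.
  move=> y Yy; rewrite lee_fin L2norm_sqr; apply: le_trans (hC y Yy).
  apply: le_trans (ler_norm _); rewrite (_ : sqL2 _ _ _ = sqL2 0 T (fun t => net_feedback P v (Y y) t - 0))//.
  by apply: eq_Int => t _; rewrite subr0.
rewrite integral_cst// lte_mul_pinfty ?lee_fin//.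
exact: nu_lty.
Qed.

End sample_continuity.

Section mean_costs.
Context {R : realType} (n m : nat) (P : ocp R n m) (HP : standing P) (HS : smooth_data P).
Context (Y0 : set 'cV[R]_n) (Y0c : compact Y0) (w : 'cV[R]_n -> R) (Hw : weight Y0 w).

Lemma mean_sample_cost v Y p gam1 gam2 : tameC1 (horizon P) v -> CH1 P Y0 Y -> CH1 P Y0 p ->
  mean Y0 w (fun y0 => sample_cost P gam1 gam2 v (Y y0) (p y0)) =
  mean Y0 w (fun y0 => cost P 0 (Y y0) (net_feedback P v (Y y0))) +
  (gam1 / 2 * mean Y0 w (fun y0 => value_error P v (Y y0)) +
   gam2 / 2 * mean Y0 w (fun y0 => grad_error P v (Y y0) (p y0))).
Proof.
move=> Hv HY Hp; have [cJ cV cG] := functionals_continuous HP HS Hv HY Hp.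
have cV' := wcZ (k := gam1 / 2) cV; have cG' := wcZ (k := gam2 / 2) cG.
rewrite -(meanZ Y0c Hw _ cV) -(meanZ Y0c Hw _ cG) -(meanD Y0c Hw cV' cG').
rewrite -(meanD Y0c Hw cJ (wcD cV' cG')).
apply: eq_Rintegral => y /set_mem Yy; congr (_ * _).
by rewrite sample_costE//; [exact: CH1_ctn HY Yy|exact: CH1_ctn Hp Yy].
Qed.

End mean_costs.

(** * The comparison triple *)

Section candidate_triple.
Context {R : realType} (n m : nat) (P : ocp R n m) (HP : standing P) (n_gt0 : (0 < n)%N).
Context (Y0 : set 'cV[R]_n) (Y0c : compact Y0) (M : R) (Hreg : regularity_assumption P Y0 M).
Local Notation mu := (@lebesgue_measure R).
Local Notation T := (horizon P).
Local Notation rho := (Mhat P M).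
Context (eps0 : R) (eps0_gt0 : 0 < eps0) (N : R -> nat)
  (ip : forall e, 'cV[R]_(N e) -> 'cV[R]_(N e) -> R)
  (V : forall e, 'cV[R]_(N e) -> R -> 'cV[R]_n -> R) (theta : forall e, 'cV[R]_(N e))
  (HA : approximation_assumption P M eps0 ip V theta).

Let T0 : 0 <= T. Proof. exact/ltW/(horizon_gt0 HP). Qed.

Lemma dyn_ctl_differentiable t (y : 'cV[R]_n) : t \in `[0, T] ->
  differentiable (dyn P t) y /\ differentiable (ctl P t) y.
Proof.
move=> tT; have [_ [Cf Cg _] _ _] := Hreg.
have uA s (z : 'cV[R]_n) : s \in `[0, T] -> (`[0, T]%classic `*` setT) (id s, z) by [].
by split; [have [] := slice_diff uA y tT (Ck2_Ck1 Cf)|have [] := slice_diff uA y tT (Ck2_Ck1 Cg)].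
Qed.

Lemma Y0_ball y0 : Y0 y0 -> enorm y0 <= rho.
Proof.
have [_ _ _ h3] := Hreg => /h3[x [[Hx _ <- xM] _ _]].
have TT0 : (0 : R) \in `[0, T] by rewrite in_itv/= lexx.
apply: (le_trans (embedding_le (horizon_gt0 HP) Hx TT0)).
by rewrite /Mhat mulrC ler_wpM2r// ltW// embedding_gt0// horizon_gt0.
Qed.

(** What needs proof is continuity in the initial state. Lipschitz dependence passes from initial
    states to loops, then to feedback controls, then to adjoint states, each time including the
    derivatives that the H1 norm contains. *)
Lemma feasible_of_loops v Y : tameC1 T v ->
  (forall y0, Y0 y0 -> [/\ Y y0 0 = y0,
    is_weak_deriv 0 T (Y y0) (fun t => loop P (gradA v) t (Y y0 t)),
    {in `[0, T], forall t, enorm (Y y0 t) <= 3 / 2 * rho} & H1norm 0 T (Y y0) <= 2 * M]) ->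
  exists2 p, feasible P M Y0 v Y p &
    forall y0, Y0 y0 -> is_adjoint P (Y y0) (net_feedback P v (Y y0)) (p y0).
Proof.
move=> Hv HY; have [M0 R1 R2 R3] := Hreg; have HS := smooth_of_regularity1 R1.
have r00 := ltW (Mhat_gt0 HP n_gt0 M0).
pose r := n%:R * (3 / 2 * rho).
have r0 : 0 <= r by apply: mulr_ge0 => //; apply: mulr_ge0 => //; exact: divr_ge0.
have Yr y0 : Y0 y0 -> bounded_by P r (Y y0).
  move=> /HY[_ _ h _] t tT; apply: (le_trans (l1_le_enorm _)).
  by rewrite ler_wpM2l// h.
have cY y0 : Y0 y0 -> ctn 0 T (Y y0) by move=> /HY[_ h _ _]; exact: wd_ctn T0 h.
have mY y0 : Y0 y0 -> mf_vec 0 T (net_feedback P v (Y y0)).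
  by move=> /cY h; apply: ctn_mf; exact: ctn_net.
have [A A0 hA] := net_lip HP HS Hv r0.
have [K K0 hK] := loop_stable HP r (tame_loop HS (tame_gradA Hv)).
pose r2 := r + A; have r20 : 0 <= r2 by rewrite addr_ge0.
have Yr2 y0 : Y0 y0 -> bounded_by P r2 (Y y0).
  by move=> /Yr h t tT; rewrite (le_trans (h t tT))// lerDl.
have self y0 : close_by P 0 (Y y0) (Y y0) by move=> t _; rewrite subrr l10.
have ur2 y0 : Y0 y0 -> bounded_by P r2 (net_feedback P v (Y y0)).
  move=> /Yr h t tT; have [b _ _ _] := hA 0 _ _ h h (self y0).
  by rewrite (le_trans (b t tT))// lerDr.
(* The adjoint states are selected without any relation between different [y0]. Continuity is not
   lost, because [adjoint_compare] applies to any two adjoint states. *)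
have /choice[p hp] : forall y0, exists p, Y0 y0 -> is_adjoint P (Y y0) (net_feedback P v (Y y0)) p.
  move=> y0; have [Yy|nY] := pselect (Y0 y0); last by exists (fun=> 0).
  by have [p hp] := adjoint_exists HP HS r20 (cY _ Yy) (mY _ Yy) (Yr2 _ Yy) (ur2 _ Yy); exists p.
have pw y0 (Yy : Y0 y0) := adjoint_wd HP HS r20 (cY _ Yy) (mY _ Yy) (Yr2 _ Yy) (ur2 _ Yy) (hp _ Yy).
pose S := Num.sqrt (2 * (T - 0)); have S0 : 0 <= S by exact: sqrtr_ge0.
have clY y z : Y0 y -> Y0 z -> close_by P (K * l1 (y - z)) (Y y) (Y z) /\
    {in `[0, T], forall t, l1 (loop P (gradA v) t (Y y t) - loop P (gradA v) t (Y z t)) <= K * l1 (y - z)}.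
  move=> Yy Yz; have [y0 yw _ _] := HY y Yy; have [z0 zw _ _] := HY z Yz.
  by have := hK _ _ yw zw (Yr _ Yy) (Yr _ Yz); rewrite y0 z0.
have CY : CH1 P Y0 Y.
  apply: (@CH1_of_lip _ _ _ _ _ _ (K * S)); [|by rewrite mulr_ge0|].
    by move=> y0 /HY[_ h _ _]; exact: wd_H1 h.
  move=> y z Yy Yz; have [_ yw _ _] := HY y Yy; have [_ zw _ _] := HY z Yz.
  have [c1 c2] := clY y z Yy Yz.
  rewrite mulrAC; apply: (H1norm_le T0 (wdB yw zw)); first by rewrite mulr_ge0// l1_ge0.
    by move=> t /subset_itv_oo_cc tT; exact: c1.
  by apply: aeE => t /subset_itv_oo_cc tT; exact: c2.
have [Ca Ca0 hCa] := adjoint_compare HP HS r20.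
have Cp : CH1 P Y0 p.
  apply: (@CH1_of_lip _ _ _ _ _ _ (Ca * ((1 + A) * K) * S)); [|by rewrite !mulr_ge0// addr_ge0|].
    by move=> y0 Yy; exact: wd_H1 (pw _ Yy).
  move=> y z Yy Yz; have [c1 _] := clY y z Yy Yz.
  have [_ c2 _ _] := hA _ _ _ (Yr _ Yy) (Yr _ Yz) c1.
  have d0 : 0 <= K * l1 (y - z) by rewrite mulr_ge0// l1_ge0.
  pose d := (1 + A) * (K * l1 (y - z)).
  have d0' : 0 <= d by rewrite mulr_ge0// addr_ge0.
  have c1' : close_by P d (Y y) (Y z).
    by move=> t tT; apply: (le_trans (c1 t tT)); rewrite /d mulrDl mul1r lerDl mulr_ge0.
  have c2' : close_by P d (net_feedback P v (Y y)) (net_feedback P v (Y z)).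
    by move=> t tT; apply: (le_trans (c2 t tT)); rewrite /d mulrDl mul1r lerDr.
  have [c3 c4] := hCa _ _ _ _ _ _ _ d0' (cY _ Yy) (mY _ Yy) (Yr2 _ Yy) (ur2 _ Yy) (hp _ Yy)
    (cY _ Yz) (mY _ Yz) (Yr2 _ Yz) (ur2 _ Yz) (hp _ Yz) c1' c2'.
  have -> : Ca * ((1 + A) * K) * S * l1 (y - z) = Ca * d * S by rewrite /d; ring.
  apply: (H1norm_le T0 (wdB (pw _ Yy) (pw _ Yz))); first by rewrite mulr_ge0.
    by move=> t /subset_itv_oo_cc tT; exact: c3.
  apply: aeE => t /subset_itv_oo_cc tT; rewrite -opprD l1N; exact: c4.
exists p => //; split=> //.
(* For an empty [Y0] the supremum takes its default value zero. *)
- rewrite /CH1norm; have [->|/set0P[y0 Yy]] := eqVneq Y0 set0.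
    by rewrite image_set0 sup0 mulr_ge0// ltW.
  apply: ge_sup; first by exists (H1norm 0 T (Y y0)); exists y0.
  by move=> _ [z Yz <-]; have [] := HY z Yz.
- exact: L2L2_net.
apply: aeE => y0 Yy; have [h0 hw hr hM] := HY y0 Yy; split=> //.
- by split=> //; exact: wd_H1 hw.
- by apply: aeS (dot_ae hw) => t ht /ht ->; rewrite net_feedbackE.
- apply: (adjoint_adjoint_eq HP HS r20 (cY _ Yy) (mY _ Yy) (Yr2 _ Yy) (ur2 _ Yy) (hp _ Yy)).
    by move=> t z tT; have [] := dyn_ctl_differentiable z tT.
  by move=> t z tT; have [] := dyn_ctl_differentiable z tT.
Qed.

Lemma candidate_triple : exists2 C : R, 0 <= C & exists2 eb : R, 0 < eb <= eps0 &
  forall e, 0 < e <= eb -> exists Y p, feasible P M Y0 (V (theta e)) Y p /\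
  forall y0, Y0 y0 ->
   [/\ cost P 0 (Y y0) (net_feedback P (V (theta e)) (Y y0)) - rvalue P 0 y0 <= C * e,
    value_error P (V (theta e)) (Y y0) <= C * e & grad_error P (V (theta e)) (Y y0) (p y0) <= C * e].
Proof.
have [M0 R1 R2 R3] := Hreg; have HS := smooth_of_regularity1 R1.
have [C C0 [eb ebE hC]] := candidate_sample HP n_gt0 M0 HS R2 eps0_gt0 HA.
exists C => //; exists eb => // e ee.
(* Again a pointwise selection. [C] and [eb] were fixed before [y0], so the estimates are uniform
   over [Y0]. *)
have /choice[Y hY] : forall y0, exists y, Y0 y0 -> [/\ y 0 = y0,
    is_weak_deriv 0 T y (fun t => loop P (gradA (V (theta e))) t (y t)),
    {in `[0, T], forall t, enorm (y t) <= 3 / 2 * rho}, H1norm 0 T y <= 2 * M &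
    cost P 0 y (net_feedback P (V (theta e)) y) <= rvalue P 0 y0 + C * e /\
    forall p, is_adjoint P y (net_feedback P (V (theta e)) y) p ->
      value_error P (V (theta e)) y <= C * e /\ grad_error P (V (theta e)) y p <= C * e].
  move=> y0; have [Yy|nY] := pselect (Y0 y0); last by exists (fun=> 0).
  have [x [ox _ mx]] := R3 y0 Yy.
  by have [y hy] := hC e ee y0 x ox mx; exists y.
have eeps : 0 < e <= eps0.
  by move: ee ebE => /andP[-> h1] /andP[_ h2]; exact: le_trans h2.
have Hv := approximant_tameC1 HA (theta e) eeps.
have HY y0 : Y0 y0 -> [/\ Y y0 0 = y0,
    is_weak_deriv 0 T (Y y0) (fun t => loop P (gradA (V (theta e))) t (Y y0 t)),
    {in `[0, T], forall t, enorm (Y y0 t) <= 3 / 2 * rho} & H1norm 0 T (Y y0) <= 2 * M].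
  by move=> /hY[].
have [p fp hp] := feasible_of_loops Hv HY.
exists Y, p; split => // y0 Yy; have [_ _ _ _ [h1 h2]] := hY y0 Yy.
by have [h3 h4] := h2 _ (hp _ Yy); split=> //; rewrite lerBlDl.
Qed.

Lemma rvalue_continuous : {within Y0, continuous (rvalue P 0)}.
Proof.
have [M0 R1 R2 R3] := Hreg.
have [L L0 hL] := rvalue_lipschitz HP n_gt0 M0 R2 eps0_gt0 HA.
have TT0 : (0 : R) \in `[0, T] by rewrite in_itv/= lexx.
have Yr y0 : Y0 y0 -> enorm y0 < 2 * rho.
  by move=> /Y0_ball h; have := Mhat_gt0 HP n_gt0 M0; lra.
apply: wc_of_close => y0 Yy; exists (L * n%:R); first by rewrite mulr_ge0.
move=> e e0 e1; apply/nbhs_ballP; exists e => //= z; rewrite -ball_normE /ball_/= => zy Yz.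
apply: (le_trans (hL 0 TT0 z y0 (Yr _ Yz) (Yr _ Yy))); rewrite -mulrA ler_wpM2l//.
by apply: (le_trans (l1_le_norm _)); rewrite ler_wpM2l// distrC ltW.
Qed.

(** A feasible closed loop, together with its feedback control, is in particular an admissible pair
    for almost every initial state, so its cost is at least the value. *)
Lemma feasible_cost_ge v Y p : feasible P M Y0 v Y p ->
  {ae normalized_lebesgue (Y0 : set (borel_cV R n)), forall y0, Y0 y0 ->
    0 <= cost P 0 (Y y0) (net_feedback P v (Y y0)) - rvalue P 0 y0}.
Proof.
move=> [CY _ _ [LU _ _] aeY]; have [M0 _ [fin _ _] _] := Hreg.
apply: aeS aeY => y0 h Yy; have [[HY _] eY Y00 _] := h Yy.
rewrite subr_ge0; apply: rvalue_le_cost.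
  apply: fin; first by rewrite in_itv/= lexx.
  rewrite /value_ball /eball/=; apply: (le_trans (Y0_ball Yy)).
  by rewrite ler_peMl ?ler1n// ltW// Mhat_gt0.
by split=> //; exact: LU.
Qed.

End candidate_triple.

(* Unprimed: means for the optimal triple; primed: for the candidate; [v] is the
   mean of the value function. At [gam1 = 0] or [gam2 = 0] the quotient in [c]
   is [0], and the second bound is not claimed. *)
Lemma compare_means (R : realFieldType) (e C W Cg gam1 gam2 ge ipo ipc J V G J' V' G' v : R) :
  0 < e -> 0 <= gam1 -> 0 <= gam2 -> 0 <= C -> 0 <= W ->
  ge * ipc ^+ 2 <= Cg * e -> 0 <= ge / 2 * ipo ^+ 2 ->
  0 <= J - v -> 0 <= V -> 0 <= G ->
  J' - v <= C * e * W -> V' <= C * e * W -> G' <= C * e * W ->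
  J + (gam1 / 2 * V + gam2 / 2 * G) + ge / 2 * ipo ^+ 2 <=
  J' + (gam1 / 2 * V' + gam2 / 2 * G') + ge / 2 * ipc ^+ 2 ->
  let B := C * W * (1 + gam1 / 2 + gam2 / 2) + `|Cg| / 2 in
  let c := B + 1 + 2 * B / Num.min gam1 gam2 in
  0 <= J - v <= c * e /\ (0 < gam1 -> 0 < gam2 -> V + G <= c * e).
Proof.
move=> e0 g1 g2 C0 W0 hg no Jv V0 G0 hJ hV hG hmin B c.
have Be0 : 0 <= B by rewrite addr_ge0 ?mulr_ge0 ?addr_ge0// divr_ge0.
have g0 : 0 <= Num.min gam1 gam2 by rewrite le_min g1.
have Bg0 : 0 <= 2 * B / Num.min gam1 gam2 by rewrite divr_ge0// mulr_ge0.
have Bge0 : 0 <= 2 * B / Num.min gam1 gam2 * e by rewrite mulr_ge0// ltW.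
have BE0 : 0 <= B * e by rewrite mulr_ge0// ltW.
have h1 : gam1 / 2 * V' <= gam1 / 2 * (C * e * W) by rewrite ler_wpM2l// divr_ge0.
have h2 : gam2 / 2 * G' <= gam2 / 2 * (C * e * W) by rewrite ler_wpM2l// divr_ge0.
have h3 : Cg * e <= `|Cg| * e by rewrite ler_wpM2r ?ler_norm// ltW.
have BE : B * e = C * e * W + gam1 / 2 * (C * e * W) + gam2 / 2 * (C * e * W) + `|Cg| * e / 2.
  by rewrite /B; field.
(* Subtract [v] from the minimality inequality. The nonnegative penalty on the left is dropped, and
   the one on the right is at most [|Cg| * e / 2]. *)
have main : J - v + (gam1 / 2 * V + gam2 / 2 * G) <= B * e.
  by rewrite BE; move: hmin no hg; set x := ge / 2 * ipo ^+ 2; have -> : ge / 2 * ipc ^+ 2 = ge * ipc ^+ 2 / 2;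
    [by field|lra].
have p1 : 0 <= gam1 / 2 * V by rewrite mulr_ge0// divr_ge0.
have p2 : 0 <= gam2 / 2 * G by rewrite mulr_ge0// divr_ge0.
have cE : c * e = B * e + e + 2 * B / Num.min gam1 gam2 * e by rewrite /c; ring.
split=> [|g1' g2']; first by rewrite Jv cE; lra.
have g'0 : 0 < Num.min gam1 gam2 by rewrite lt_min g1' g2'.
(* The weighted errors are bounded by [B * e]; dividing by half the smaller weight bounds their
   unweighted sum. *)
have q1 : Num.min gam1 gam2 * V <= gam1 * V by rewrite ler_wpM2r// ge_min lexx.
have q2 : Num.min gam1 gam2 * G <= gam2 * G by rewrite ler_wpM2r// ge_min lexx orbT.
have : V + G <= 2 * B / Num.min gam1 gam2 * e.
  rewrite mulrAC ler_pdivlMr//; lra.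
by rewrite cE; lra.
Qed.

Theorem theorem14 (R : realType) (n m : nat) (n_gt0 : (0 < n)%N)
    (m_gt0 : (0 < m)%N) (P : ocp R n m) (HP : standing P)
    (Y0 : set 'cV[R]_n) (Y0_compact : compact Y0)
    (Y0_pos : (0 < lebesgue_cV (Y0 : set (borel_cV R n)))%E)
    (M : R) (Hreg : regularity_assumption P Y0 M)
    (eps0 : R) (eps0_gt0 : 0 < eps0) (N : R -> nat)
    (ip : forall e, 'cV[R]_(N e) -> 'cV[R]_(N e) -> R)
    (V : forall e, 'cV[R]_(N e) -> R -> 'cV[R]_n -> R)
    (theta : forall e, 'cV[R]_(N e))
    (Happrox : approximation_assumption P M eps0 ip V theta)
    (w : 'cV[R]_n -> R) (Hw : weight Y0 w)
    (cw : R) (cw_gt0 : 0 < cw)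
    (Hcw : {ae normalized_lebesgue (Y0 : set (borel_cV R n)),
             forall y0, Y0 y0 -> cw <= w y0})
    (gam1 gam2 : R) (gam1_ge0 : 0 <= gam1) (gam2_ge0 : 0 <= gam2)
    (gam : R -> R) (gam_gt0 : forall e, 0 < e <= eps0 -> 0 < gam e)
    (Y p : R -> 'cV[R]_n -> R -> 'cV[R]_n) (th : forall e, 'cV[R]_(N e))
    (Hopt : \forall e \near 0^'+,
      optimal_triple P M Y0 w gam1 gam2 (@ip e) (V e) (gam e)
        (Y e) (p e) (th e))
    (Hgam : exists C : R, \forall e \near 0^'+,
      gam e * ipnorm (@ip e) (theta e) ^+ 2 <= C * e) :
  exists c : R, 0 < c /\ \forall e \near 0^'+,
    0 <= mean Y0 w (fun y0 =>
           cost P 0 (Y e y0) (net_feedback P (V e (th e)) (Y e y0))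
           - rvalue P 0 y0) <= c * e /\
    (0 < gam1 -> 0 < gam2 ->
      mean Y0 w (fun y0 =>
        value_error P (V e (th e)) (Y e y0)
        + grad_error P (V e (th e)) (Y e y0) (p e y0)) <= c * e).
Proof.
have [M0 R1 R2 _] := Hreg; have HS := smooth_of_regularity1 R1.
have [C C0 [eb /andP[eb0 ebe] hC]] := candidate_triple HP n_gt0 Y0_compact Hreg eps0_gt0 Happrox.
have [Cg hg] := Hgam.
(* The total weight, by which the bounds valid for every initial state are multiplied when they are
   averaged. *)
pose W := mean Y0 w (fun=> 1).
have W0 : 0 <= W.
  by apply: (mean_ge0 Y0_compact Hw cw_gt0 Hcw); [exact: wc_cst|apply: aeE => y _].
pose B := C * W * (1 + gam1 / 2 + gam2 / 2) + `|Cg| / 2.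
have B0 : 0 <= B by rewrite addr_ge0 ?mulr_ge0 ?addr_ge0// ?divr_ge0.
pose g := Num.min gam1 gam2; have g0 : 0 <= g by rewrite le_min gam1_ge0.
have Bg0 : 0 <= 2 * B / g by rewrite divr_ge0// mulr_ge0.
(* This is the constant [c] of [compare_means]; the summand one makes it positive even if [B]
   vanishes. *)
exists (B + 1 + 2 * B / g); split; first by rewrite ltr_pwDl// ltr_wpDl.
near=> e.
have e0 : 0 < e by near: e; exact: nbhs_right_gt.
have ee : e <= eb by near: e; exact: nbhs_right_le.
have eeb : 0 < e <= eb by rewrite e0.
have eeps : 0 < e <= eps0 by rewrite e0 (le_trans ee).
have [fo hmin] : optimal_triple P M Y0 w gam1 gam2 (@ip e) (V e) (gam e) (Y e) (p e) (th e).
  by near: e.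
have ge : gam e * ipnorm (@ip e) (theta e) ^+ 2 <= Cg * e by near: e.
have [Yc [pc [fc hc]]] := hC e eeb.
have := hmin _ _ _ fc; rewrite /learning_cost.
have Ho := approximant_tameC1 Happrox (th e) eeps.
have Hc := approximant_tameC1 Happrox (theta e) eeps.
have [CYo _ Cpo _ _] := fo; have [CYc _ Cpc _ _] := fc.
have [oJ oV oG] := functionals_continuous HP HS Ho CYo Cpo.
have [cJ cV cG] := functionals_continuous HP HS Hc CYc Cpc.
have cR := rvalue_continuous HP n_gt0 Hreg eps0_gt0 Happrox.
rewrite (mean_sample_cost HP HS Y0_compact Hw _ _ Ho CYo Cpo).
rewrite (mean_sample_cost HP HS Y0_compact Hw _ _ Hc CYc Cpc).
have Jo := mean_ge0 Y0_compact Hw cw_gt0 Hcw (wcB oJ cR)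
  (feasible_cost_ge HP n_gt0 Hreg fo).
have Vo : 0 <= mean Y0 w (fun y0 => value_error P (V e (th e)) (Y e y0)).
  by apply: (mean_ge0 Y0_compact Hw cw_gt0 Hcw oV); apply: aeE => y _; exact: value_error_ge0.
have Go : 0 <= mean Y0 w (fun y0 => grad_error P (V e (th e)) (Y e y0) (p e y0)).
  by apply: (mean_ge0 Y0_compact Hw cw_gt0 Hcw oG); apply: aeE => y _; exact: grad_error_ge0.
have Jc := mean_le_cst Y0_compact Hw cw_gt0 Hcw (wcB cJ cR) (fun y Yy => let: And3 h _ _ := hc y Yy in h).
have Vc := mean_le_cst Y0_compact Hw cw_gt0 Hcw cV (fun y Yy => let: And3 _ h _ := hc y Yy in h).
have Gc := mean_le_cst Y0_compact Hw cw_gt0 Hcw cG (fun y Yy => let: And3 _ _ h := hc y Yy in h).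
have no : 0 <= gam e / 2 * ipnorm (@ip e) (th e) ^+ 2.
  by apply: mulr_ge0; [apply: divr_ge0 => //; exact/ltW/gam_gt0|exact: sqr_ge0].
rewrite (meanD Y0_compact Hw oV oG).
rewrite (meanB Y0_compact Hw oJ cR) in Jo *; rewrite (meanB Y0_compact Hw cJ cR) in Jc.
move=> hle; exact: (compare_means e0 gam1_ge0 gam2_ge0 C0 W0 ge no Jo Vo Go Jc Vc Gc hle).
Unshelve. all: by end_near. Qed.
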